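(* (1) For every integer $j$ let $f_{4,j}(\tau)=\theta(\tau/2-(-1)^j/4)$. Then for all integers $j$ and $\tau\in\mathcal{H}$: $f_{4,j}^4(\tau)=F_{4,j}(\tau)$, $f_{4,j}(\tau)f_{4,j+1}(\tau)=E_{4,2}^{1/2}(\tau)=\theta^2(\tau)$, $f_{4,j}(\tau+1)=f_{4,j+1}(\tau)$, and $f_{4,j}(-1/(4\tau))=(1+(-1)^j\sqrt{-1})(\tau/i)^{1/2}f_{4,j+1}(\tau)$. (2) For every integer $j$ let $g_{4,j}(\tau)=2\theta^2(2\tau)-\theta^2((\tau+j)/2)$. Then for all integers $j$ and $\tau\in\mathcal{H}$: $g_{4,j}^2(\tau)=G_{4,j}(\tau)$, $g_{4,j}(\tau)g_{4,j+1}(\tau)=E'_{4,2}(\tau)$, $g_{4,j}(\tau+1)=g_{4,j+1}(\tau)$, and $g_{4,j}(-1/(4\tau))=(-1)^j2\sqrt{-1}\,\tau g_{4,j}(\tau)$.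
   Context: $\mathcal{H}$ is the upper half-plane, $q=e^{2\pi i\tau}$, $\theta(\tau)=\sum_{n\in\mathbb Z}q^{n^2}$, $\eta(\tau)=q^{1/24}\prod_{n\ge1}(1-q^n)$, $E_2=1-24\sum_{n\ge1}\sigma_1(n)q^n$. $E_{4,2}(\tau)=(4E_2(4\tau)-E_2(\tau))/3$ (which equals $\theta^4(\tau)$; $E_{4,2}^{1/2}$ denotes $\theta^2$), $E'_{4,2}(\tau)=4E_2(4\tau)-4E_2(2\tau)+E_2(\tau)$, $\eta_4(\tau)=\eta(\tau)\eta(4\tau)/\eta(2\tau)$, $F_{4,j}=E'_{4,2}-(-1)^j\sqrt{-64}\,\eta_4^4$ with $\sqrt{-64}=8i$, and $G_{4,j}=E_{4,2}-(-1)^j8\eta_4^4$. $\sqrt{-1}=i$ and $(\tau/i)^{1/2}$ is the principal branch (positive on the imaginary axis).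
   Formalization: In (1) the last identity is proved with the factor 1-(-1)^j sqrt(-1) in place of 1+(-1)^j sqrt(-1); the printed sign is false, e.g. at j=0, tau=i/2, where it would force -B=(A+B)/sqrt 2 with A,B>0. *)

(* Defs.v *)
From Stdlib Require Export Reals ZArith List.
From Coquelicot Require Export Coquelicot.

Open Scope R_scope.
Open Scope C_scope.

Definition Cexp (z : C) : C :=
  (exp (Re z) * cos (Im z), exp (Re z) * sin (Im z))%R.

(* The principal branch of the square root: the root with nonnegative real
   part, and with nonnegative imaginary part when z is real and negative. *)
Definition Csqrt (z : C) : C :=
  (sqrt ((Cmod z + Re z) / 2),
   (if Rle_dec 0 (Im z) then 1 else -1) * sqrt ((Cmod z - Re z) / 2))%R.

(* Limits are taken componentwise; like [Lim_seq] and [Series], the values are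
   meaningful only in case of convergence, which holds wherever these
   operators are used below with a point of the upper half-plane. *)
Definition CLim_seq (u : nat -> C) : C :=
  (real (Lim_seq (fun n => Re (u n))), real (Lim_seq (fun n => Im (u n)))).

Definition CSeries (a : nat -> C) : C :=
  (Series (fun n => Re (a n)), Series (fun n => Im (a n))).

Definition ZSeries (a : Z -> C) : C :=
  CSeries (fun n => a (Z.of_nat n)) + CSeries (fun n => a (- Z.of_nat (S n))%Z).

Fixpoint Cprod (a : nat -> C) (n : nat) : C :=
  match n with
  | O => 1
  | S m => Cprod a m * a m
  end.

(* [qpow r tau] is q^r with q = e^(2 pi i tau); the real exponent r selects
   the branch e^(2 pi i r tau), as is usual for q^(1/24). *)
Definition qpow (r : R) (tau : C) : C := Cexp (2 * PI * Ci * r * tau).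

Definition q (tau : C) : C := qpow 1 tau.

Definition theta (tau : C) : C := ZSeries (fun n => q tau ^ Z.to_nat (n ^ 2)).

Definition eta (tau : C) : C :=
  qpow (1 / 24) tau * CLim_seq (Cprod (fun n => 1 - q tau ^ S n)).

Definition sigma1 (n : nat) : nat :=
  list_sum (filter (fun d => Nat.eqb (n mod d) 0) (seq 1 n)).

Definition E2 (tau : C) : C :=
  1 - 24 * CSeries (fun n => INR (sigma1 (S n)) * q tau ^ S n).

Definition E42 (tau : C) : C := (4 * E2 (4 * tau) - E2 tau) / 3.

(* The square root E_{4,2}^{1/2}, by definition theta^2. *)
Definition E42_half (tau : C) : C := theta tau ^ 2.

(* In E'_{4,2} the prime is part of the name, not a derivative. *)
Definition E42' (tau : C) : C := 4 * E2 (4 * tau) - 4 * E2 (2 * tau) + E2 tau.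

Definition eta4 (tau : C) : C := eta tau * eta (4 * tau) / eta (2 * tau).

Definition sgn (j : Z) : C := powerRZ (-1) j.

Definition F4 (j : Z) (tau : C) : C := E42' tau - sgn j * (8 * Ci) * eta4 tau ^ 4.

Definition G4 (j : Z) (tau : C) : C := E42 tau - sgn j * 8 * eta4 tau ^ 4.

(* With this sign of the shift, f_{4,j}(-1/(4 tau)) carries the factor
   1 - (-1)^j i, not 1 + (-1)^j i: at tau = i/2, f_{4,0} = A - i B and
   f_{4,1} = A + i B with A, B > 0, so f_{4,0} / f_{4,1} is not (1+i)/sqrt 2. *)
Definition f4 (j : Z) (tau : C) : C := theta (tau / 2 - sgn j / 4).

Definition g4 (j : Z) (tau : C) : C :=
  2 * theta (2 * tau) ^ 2 - theta ((tau + IZR j) / 2) ^ 2.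

(* Main.v *)
(** Write [y = e^(pi i tau)], [A = theta (2 tau)] and [theta (tau / 2) = A + B], where [A] and
    [B] collect the even and the odd terms.  Then [f_{4,j} = A - (-1)^j i B] and
    [g_{4,j} = A^2 - B^2 - 2 (-1)^j A B], so everything follows from the formulas for
    [theta^2], [E_{4,2}], [E'_{4,2}] and [eta_4^4] as polynomials in [A] and [B] together with
    the behaviour of [A] and [B] under [tau + 1] and [-1/(4 tau)].

    The polynomial formulas are identities between formal power series.  The Jacobi triple
    product at [z = 1] gives the product formulas and the quadratic (AGM) relations between
    theta constants of [q] and of [q^2].  By these relations, the quotient of the two sides of
    Jacobi's formula for the logarithmic derivative of [theta_2 / theta_3] is invariant under
    [q -> q^2], hence constant; translated through the product formulas this expresses
    [theta^4] by the Lambert series in [E_2].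

    The inversion formula is Poisson summation for a complex Gaussian.  It is obtained by
    finite Fourier analysis modulo [N] of the samples at the points [m / N]: the Fourier
    coefficients are dominated by [1 / k^2] by a second-difference argument, and their limits
    are compared by deforming the real line into another line of the complex plane.  The value
    of the Gaussian integral is read off from the self-dual case. *)

From Stdlib Require Import Lia Lra FunctionalExtensionality.
Require Import Defs.

(** * Formal power series *)

Local Open Scope R_scope.

(** The identities are proved for formal series because there two solutions of a functional equation
    under [q -> q^2] with the same constant term coincide: otherwise their difference would have
    order of vanishing both [v > 0] and at least [2v]. This does the work of the finite dimension of
    spaces of modular forms, and convergence matters only when finished identities are evaluated in
    the disc. The inversion is needed on the whole upper half-plane, so Poisson summation is proved
    directly for complex [r] with [|arg r| < pi/4], without continuation from the positive axis. No
    integral occurs: contour shifts are made for sums over a lattice of mesh [1/N]. Moving the line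
    in [N] steps of size [1/N] changes such a sum by [O(1/N)] per step, hence by [O(1)] altogether,
    and the normalising factor [1/N] kills this. Of the Riemann sums of the Gaussian only
    boundedness is known beforehand; their convergence itself comes out of the case [r = 1]. *)

Definition fps := nat -> R.

Definition ftail (a : fps) : fps := fun n => a (S n).
Definition fadd (a b : fps) : fps := fun n => a n + b n.
Definition fopp (a : fps) : fps := fun n => - a n.
Definition fsub (a b : fps) : fps := fun n => a n - b n.
(** Recursion through [a = a 0 + q * ftail a] instead of a finite sum: the ring laws then follow by
    induction on the index, for all [a] at once. The usual Cauchy sum is recovered in [conv_sum]. *)
Fixpoint conv (a b : fps) (n : nat) : R :=
  match n with
  | O => a O * b O
  | S m => a O * b n + conv (ftail a) b m
  end.
Definition fmul (a b : fps) : fps := fun n => conv a b n.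
Definition fconst (c : R) : fps := fun n => match n with O => c | _ => 0 end.
Definition mono (k : nat) : fps := fun n => if Nat.eqb n k then 1 else 0.

Lemma conv_addl a b c n : conv (fadd a b) c n = conv a c n + conv b c n.
Proof.
  revert a b; induction n as [|n IH]; intros a b; simpl.
  - unfold fadd; ring.
  - change (ftail (fadd a b)) with (fadd (ftail a) (ftail b)).
    rewrite IH; unfold fadd; ring.
Qed.

Lemma conv_scall k a c n : conv (fun m => k * a m) c n = k * conv a c n.
Proof.
  revert a; induction n as [|n IH]; intros a; simpl; [ring|].
  change (ftail (fun m => k * a m)) with (fun m => k * ftail a m).
  rewrite IH; ring.
Qed.

(** The mirror image of the defining recursion, splitting the second factor; the two together give
    commutativity. *)
Lemma conv_tail_r a b n : conv a b (S n) = a (S n) * b O + conv a (ftail b) n.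
Proof.
  revert a; induction n as [|n IH]; intros a; [simpl; unfold ftail; ring|].
  change (a O * b (S (S n)) + conv (ftail a) b (S n) =
          a (S (S n)) * b O + (a O * ftail b (S n) + conv (ftail a) (ftail b) n)).
  rewrite IH; unfold ftail; ring.
Qed.

Lemma conv_comm a b n : conv a b n = conv b a n.
Proof.
  revert a b; induction n as [|n IH]; intros a b; [simpl; ring|].
  rewrite conv_tail_r. simpl. rewrite (IH a). ring.
Qed.

Lemma conv_assoc a b c n : conv (fmul a b) c n = conv a (fmul b c) n.
Proof.
  revert a; induction n as [|n IH]; intros a; [simpl; unfold fmul; simpl; ring|].
  cbn [conv].
  replace (ftail (fmul a b)) with (fadd (fun m => a O * ftail b m) (fmul (ftail a) b)).
  2: { apply functional_extensionality; intros m; unfold fadd, fmul, ftail; simpl; reflexivity. }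
  rewrite conv_addl, conv_scall, IH. unfold fmul at 1 3. simpl. ring.
Qed.

Lemma conv_const c b n : conv (fconst c) b n = c * b n.
Proof.
  destruct n as [|n]; simpl; [reflexivity|].
  replace (ftail (fconst c)) with (fun m => 0 * b m)
    by (apply functional_extensionality; intros m; unfold ftail, fconst; ring).
  rewrite conv_scall; ring.
Qed.

Lemma fps_ring_theory :
  ring_theory (fconst 0) (fconst 1) fadd fmul fsub fopp (@eq fps).
Proof.
  constructor; intros; apply functional_extensionality; intros m;
    unfold fadd, fsub, fopp, fmul.
  - destruct m; simpl; ring.
  - ring.
  - ring.
  - rewrite conv_const; ring.
  - apply conv_comm.
  - symmetry; apply conv_assoc.
  - apply conv_addl.
  - ring.
  - destruct m; simpl; ring.
Qed.

Add Ring fps_ring : fps_ring_theory.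

Declare Scope fps_scope.
Delimit Scope fps_scope with fps.
Infix "+" := fadd : fps_scope.
Infix "-" := fsub : fps_scope.
Infix "*" := fmul : fps_scope.
Notation "- x" := (fopp x) : fps_scope.
Notation "1" := (fconst 1) : fps_scope.
Notation "0" := (fconst 0) : fps_scope.
Bind Scope fps_scope with fps.
Local Open Scope fps_scope.

Lemma fadd0 a b : (a + b) O = (a O + b O)%R. Proof. reflexivity. Qed.
Lemma fsub0 a b : (a - b) O = (a O - b O)%R. Proof. reflexivity. Qed.
Lemma fmul0 a b : (a * b) O = (a O * b O)%R. Proof. reflexivity. Qed.

Lemma mono_0 : mono 0 = 1.
Proof. apply functional_extensionality; intros [|m]; reflexivity. Qed.

Lemma mono_mul_S i a n : (mono (S i) * a) (S n) = (mono i * a) n.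
Proof.
  unfold fmul; simpl.
  change (ftail (mono (S i))) with (mono i). unfold mono at 1; simpl; ring.
Qed.

Lemma mono_mul_low i a n : (n < i)%nat -> (mono i * a) n = 0%R.
Proof.
  revert n; induction i as [|i IH]; intros n H; [lia|].
  destruct n as [|n].
  - unfold fmul, mono; simpl; ring.
  - rewrite mono_mul_S; apply IH; lia.
Qed.

Lemma mono_mul_add i a n : (mono i * a) (i + n)%nat = a n.
Proof.
  induction i as [|i IH].
  - rewrite mono_0; unfold fmul; rewrite conv_const; simpl; ring.
  - change (S i + n)%nat with (S (i + n)). rewrite mono_mul_S; apply IH.
Qed.

Lemma mono_mul i j : mono i * mono j = mono (i + j).
Proof.
  apply functional_extensionality; intros n.
  destruct (le_lt_dec i n) as [H|H].
  - replace n with (i + (n - i))%nat by lia. rewrite mono_mul_add.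
    unfold mono. destruct (Nat.eqb_spec (n - i) j), (Nat.eqb_spec (i + (n - i)) (i + j)); auto; lia.
  - rewrite mono_mul_low by assumption. unfold mono.
    destruct (Nat.eqb_spec n (i + j)); auto; lia.
Qed.

(** Used where a factor [q] has to be cancelled: [mul_cancel_r] below only removes factors with
    nonzero constant term. *)
Lemma mono_cancel i a b : mono i * a = mono i * b -> a = b.
Proof.
  intros H; apply functional_extensionality; intros n.
  rewrite <- (mono_mul_add i a n), H; apply mono_mul_add.
Qed.

(** * The substitutions [q -> q^2] ([dbl]) and [q -> -q] ([alt]) and the derivation [q d/dq]
    ([der]) *)

Fixpoint dbl (a : fps) (n : nat) : R :=
  match n with
  | O => a O
  | S O => 0
  | S (S m) => dbl (ftail a) m
  end.

Definition alt (a : fps) : fps := fun n => ((-1) ^ n * a n)%R.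
Definition der (a : fps) : fps := fun n => (INR n * a n)%R.

Lemma nat_ind2 (P : nat -> Prop) :
  P O -> P 1%nat -> (forall n, P n -> P (S (S n))) -> forall n, P n.
Proof.
  intros H0 H1 H n.
  cut (P n /\ P (S n)); [tauto|].
  induction n as [|n [IH1 IH2]]; auto.
Qed.

Lemma dbl_double a n : dbl a (2 * n) = a n.
Proof.
  revert a; induction n as [|n IH]; intros a; [reflexivity|].
  replace (2 * S n)%nat with (S (S (2 * n))) by lia.
  cbn [dbl]; rewrite IH; reflexivity.
Qed.

Lemma dbl_odd a n : dbl a (S (2 * n)) = 0%R.
Proof.
  revert a; induction n as [|n IH]; intros a; [reflexivity|].
  replace (2 * S n)%nat with (S (S (2 * n))) by lia.
  cbn [dbl]; apply IH.
Qed.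

Lemma dbl_inj a b : dbl a = dbl b -> a = b.
Proof.
  intros H; apply functional_extensionality; intros n.
  rewrite <- (dbl_double a), H; apply dbl_double.
Qed.

Lemma dbl_add a b : dbl (a + b) = dbl a + dbl b.
Proof.
  apply functional_extensionality; intros n; revert a b; pattern n; apply nat_ind2.
  - reflexivity.
  - intros; unfold fadd; simpl; ring.
  - intros m IH a b. cbn [dbl]. change (ftail (a + b)) with (ftail a + ftail b).
    rewrite IH; reflexivity.
Qed.

Lemma dbl_sub a b : dbl (a - b) = dbl a - dbl b.
Proof.
  apply functional_extensionality; intros n; revert a b; pattern n; apply nat_ind2.
  - reflexivity.
  - intros; unfold fsub; simpl; ring.
  - intros m IH a b. cbn [dbl]. change (ftail (a - b)) with (ftail a - ftail b).
    rewrite IH; reflexivity.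
Qed.

Lemma dbl_scal k a : dbl (fun m => (k * a m)%R) = fun m => (k * dbl a m)%R.
Proof.
  apply functional_extensionality; intros n; revert a; pattern n; apply nat_ind2.
  - reflexivity.
  - intros; simpl; ring.
  - intros m IH a. cbn [dbl]. change (ftail (fun m => (k * a m)%R)) with (fun m => (k * ftail a m)%R).
    rewrite IH; reflexivity.
Qed.

Lemma dbl_mul a b : dbl (a * b) = dbl a * dbl b.
Proof.
  apply functional_extensionality; intros n; revert a; pattern n; apply nat_ind2.
  - reflexivity.
  - intros a; unfold fmul; simpl; unfold ftail; simpl; ring.
  - intros m IH a. cbn [dbl].
    replace (ftail (a * b)) with ((fun m => (a O * ftail b m)%R) + ftail a * b)
      by (apply functional_extensionality; intros i; reflexivity).
    rewrite dbl_add, dbl_scal. unfold fadd. rewrite IH.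
    unfold fmul. cbn [conv dbl].
    change (ftail (dbl a) O) with 0%R.
    change (ftail (ftail (dbl a))) with (dbl (ftail a)). ring.
Qed.

Lemma dbl_const c : dbl (fconst c) = fconst c.
Proof.
  apply functional_extensionality; intros [|[|n]]; try reflexivity.
  cbn [dbl]. change (ftail (fconst c)) with (fun m : nat => 0%R).
  assert (H : forall a m, (forall i, a i = 0%R) -> dbl a m = 0%R).
  { intros a m; revert a; pattern m; apply nat_ind2; intros; simpl; auto.
    apply H; intros i; apply H0. }
  rewrite H; auto.
Qed.

Lemma dbl_mono k : dbl (mono k) = mono (2 * k).
Proof.
  induction k as [|k IH].
  - simpl; rewrite mono_0; apply dbl_const.
  - replace (mono (S k)) with (mono 1 * mono k) by (rewrite mono_mul; reflexivity).
    rewrite dbl_mul, IH.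
    replace (dbl (mono 1)) with (mono 2).
    + rewrite mono_mul; f_equal; lia.
    + apply functional_extensionality; intros [|[|[|n]]]; try reflexivity.
      change (0%R = dbl (ftail (mono 1)) (S n)).
      change (ftail (mono 1)) with (mono 0). rewrite mono_0, dbl_const; reflexivity.
Qed.

Lemma alt_add a b : alt (a + b) = alt a + alt b.
Proof. apply functional_extensionality; intros n; unfold alt, fadd; ring. Qed.

Lemma alt_sub a b : alt (a - b) = alt a - alt b.
Proof. apply functional_extensionality; intros n; unfold alt, fsub; ring. Qed.

Lemma alt_mul a b : alt (a * b) = alt a * alt b.
Proof.
  apply functional_extensionality; intros n; revert a; induction n as [|n IH]; intros a.
  - unfold alt, fmul; simpl; ring.
  - specialize (IH (ftail a)). unfold alt, fmul in *. cbn [conv].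
    replace (ftail (fun n0 => ((-1) ^ n0 * a n0)%R))
      with (fun m => (-1 * ((-1) ^ m * ftail a m))%R)
      by (apply functional_extensionality; intros m; unfold ftail; simpl; ring).
    rewrite conv_scall, <- IH. simpl. ring.
Qed.

Lemma alt_const c : alt (fconst c) = fconst c.
Proof. apply functional_extensionality; intros [|n]; unfold alt; simpl; ring. Qed.

Lemma alt_mono k : alt (mono k) = fconst ((-1) ^ k) * mono k.
Proof.
  apply functional_extensionality; intros n; unfold alt, fmul.
  rewrite conv_const; unfold mono. destruct (Nat.eqb_spec n k); subst; ring.
Qed.

Lemma alt_dbl a : alt (dbl a) = dbl a.
Proof.
  apply functional_extensionality; intros n; unfold alt; revert a; pattern n; apply nat_ind2.
  - intros; simpl; ring.
  - intros; simpl; ring.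
  - intros m IH a. cbn [dbl pow]. rewrite <- (IH (ftail a)) at 2. ring.
Qed.

Lemma alt_alt a : alt (alt a) = a.
Proof.
  apply functional_extensionality; intros n; unfold alt.
  rewrite <- Rmult_assoc, <- Rpow_mult_distr.
  replace (-1 * -1)%R with 1%R by ring. rewrite pow1; ring.
Qed.

Lemma der_add a b : der (a + b) = der a + der b.
Proof. apply functional_extensionality; intros n; unfold der, fadd; ring. Qed.

Lemma der_sub a b : der (a - b) = der a - der b.
Proof. apply functional_extensionality; intros n; unfold der, fsub; ring. Qed.

Lemma der_const c : der (fconst c) = 0.
Proof. apply functional_extensionality; intros [|n]; unfold der; simpl; ring. Qed.

Lemma der_mono k : der (mono k) = fconst (INR k) * mono k.
Proof.
  apply functional_extensionality; intros n; unfold der, fmul.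
  rewrite conv_const; unfold mono. destruct (Nat.eqb_spec n k); subst; ring.
Qed.

Lemma der_mul a b : der (a * b) = der a * b + a * der b.
Proof.
  apply functional_extensionality; intros n; revert a; induction n as [|n IH]; intros a.
  - unfold der, fadd, fmul; simpl; ring.
  - specialize (IH (ftail a)). unfold fadd, fmul in *.
    change (der (fun n => conv (ftail a) b n) n) with (INR n * conv (ftail a) b n)%R in IH.
    unfold der at 1. cbn [conv].
    replace (ftail (der a)) with (fadd (der (ftail a)) (ftail a))
      by (apply functional_extensionality; intros m; unfold ftail, der, fadd; rewrite S_INR; ring).
    rewrite conv_addl, Rmult_plus_distr_l.
    replace (INR (S n) * conv (ftail a) b n)%R
      with (INR n * conv (ftail a) b n + conv (ftail a) b n)%R by (rewrite S_INR; ring).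
    rewrite IH.
    change (der a 0%nat) with (INR 0 * a 0%nat)%R.
    change (der b (S n)) with (INR (S n) * b (S n))%R. simpl (INR 0). ring.
Qed.

Lemma der_dbl a : der (dbl a) = fconst 2 * dbl (der a).
Proof.
  apply functional_extensionality; intros n; unfold fmul; rewrite conv_const.
  destruct (Nat.Even_or_Odd n) as [[m ->]|[m ->]].
  - unfold der at 1; rewrite !dbl_double; unfold der. rewrite mult_INR; simpl; ring.
  - replace (2 * m + 1)%nat with (S (2 * m)) by lia.
    unfold der at 1. rewrite !dbl_odd; ring.
Qed.

(** * Congruences modulo powers of the variable *)

Definition eqm (N : nat) (a b : fps) := forall n, (n < N)%nat -> a n = b n.

Lemma eqm_refl N a : eqm N a a. Proof. intros n _; reflexivity. Qed.
Lemma eqm_sym N a b : eqm N a b -> eqm N b a.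
Proof. intros H n Hn; symmetry; auto. Qed.
Lemma eqm_trans N a b c : eqm N a b -> eqm N b c -> eqm N a c.
Proof. intros H1 H2 n Hn; rewrite H1; auto. Qed.
Lemma eqm_le N M a b : (N <= M)%nat -> eqm M a b -> eqm N a b.
Proof. intros H H1 n Hn; apply H1; lia. Qed.
Lemma eqm_eq a b : (forall N, eqm N a b) -> a = b.
Proof. intros H; apply functional_extensionality; intros n; apply (H (S n)); lia. Qed.

Lemma eqm_add N a b c d : eqm N a b -> eqm N c d -> eqm N (a + c) (b + d).
Proof. intros H1 H2 n Hn; unfold fadd; rewrite H1, H2; auto. Qed.
Lemma eqm_sub N a b c d : eqm N a b -> eqm N c d -> eqm N (a - c) (b - d).
Proof. intros H1 H2 n Hn; unfold fsub; rewrite H1, H2; auto. Qed.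

Lemma eqm_mul N a b c d : eqm N a b -> eqm N c d -> eqm N (a * c) (b * d).
Proof.
  assert (L : forall a b c, eqm N a b -> eqm N (a * c) (b * c)).
  { clear; intros a b c H n Hn. unfold fmul.
    revert N a b H Hn; induction n as [|n IH]; intros N a b H Hn; simpl.
    - rewrite H; auto.
    - rewrite (H O) by lia. f_equal. apply (IH (pred N)); [|lia].
      intros m Hm; apply H; lia. }
  intros H1 H2. apply eqm_trans with (b * c); [apply L; auto|].
  replace (b * c) with (c * b) by ring. replace (b * d) with (d * b) by ring.
  apply L; auto.
Qed.

Lemma eqm_dbl N a b : eqm N a b -> eqm N (dbl a) (dbl b).
Proof.
  intros H n Hn. destruct (Nat.Even_or_Odd n) as [[m ->]|[m ->]].
  - rewrite !dbl_double; apply H; lia.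
  - replace (2 * m + 1)%nat with (S (2 * m)) by lia. rewrite !dbl_odd; reflexivity.
Qed.

Lemma eqm_alt N a b : eqm N a b -> eqm N (alt a) (alt b).
Proof. intros H n Hn; unfold alt; rewrite H; auto. Qed.
Lemma eqm_der N a b : eqm N a b -> eqm N (der a) (der b).
Proof. intros H n Hn; unfold der; rewrite H; auto. Qed.

Lemma eqm_mono N k : (N <= k)%nat -> eqm N (mono k) 0.
Proof.
  intros H n Hn; unfold mono. destruct (Nat.eqb_spec n k); [lia|].
  destruct n; reflexivity.
Qed.

Lemma eqm_mono_mul N k a : (N <= k)%nat -> eqm N (mono k * a) 0.
Proof. intros H n Hn; rewrite mono_mul_low by lia; destruct n; reflexivity. Qed.

(** Only the two leading coefficients meet in degree [n]. The arguments by order of vanishing all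
    read off this coefficient. *)
Lemma mul_lowest a b n : eqm n a 0 -> (a * b) n = (a n * b O)%R.
Proof.
  unfold fmul; revert a; induction n as [|n IH]; intros a H; [reflexivity|].
  simpl. rewrite IH.
  - rewrite (H O) by lia. unfold ftail; simpl; ring.
  - intros m Hm. unfold ftail. rewrite (H (S m)) by lia. destruct m; reflexivity.
Qed.

(* A solution of [e(q) K(q) = K'(q) e(q^2)] of positive order v would have order
   both v and at least 2v. *)
Lemma doubling_zero e K K' : e * K = K' * dbl e -> e O = 0%R -> K O <> 0%R -> e = 0.
Proof.
  intros H H0 HK. apply eqm_eq; intros N. induction N as [|n IH]; [intros m Hm; lia|].
  intros m Hm. destruct (Nat.eq_dec m n) as [->|]; [|apply IH; lia].
  destruct n as [|n]; [exact H0|].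
  assert (E : (e * K) (S n) = 0%R).
  { rewrite H. replace (K' * dbl e) with (dbl e * K') by ring.
    assert (Hd : forall m, (m <= S n)%nat -> dbl e m = 0%R).
    { intros i Hi. destruct (Nat.Even_or_Odd i) as [[j ->]|[j ->]].
      - rewrite dbl_double, (IH j) by lia. destruct j; reflexivity.
      - replace (2 * j + 1)%nat with (S (2 * j)) by lia. apply dbl_odd. }
    rewrite mul_lowest.
    - rewrite Hd by lia; ring.
    - intros i Hi; rewrite Hd by lia; destruct i; reflexivity. }
  rewrite mul_lowest in E by exact IH.
  apply Rmult_integral in E. simpl. tauto.
Qed.

(** Induction on the order of [a - b]: its first coefficient times [K 0] is a coefficient of
    [(a - b) * K = 0]. *)
Lemma mul_cancel_r a b K : K O <> 0%R -> a * K = b * K -> a = b.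
Proof.
  intros HK H. apply eqm_eq; intros N. induction N as [|n IH]; [intros m Hm; lia|].
  intros m Hm. destruct (Nat.eq_dec m n) as [->|]; [|apply IH; lia].
  assert (E : ((a - b) * K) n = 0%R).
  { replace ((a - b) * K) with (a * K - b * K) by ring. rewrite H. unfold fsub; ring. }
  rewrite mul_lowest in E.
  - apply Rmult_integral in E. unfold fsub in E. destruct E; [lra|tauto].
  - intros i Hi; unfold fsub; rewrite (IH i Hi). destruct i; simpl; ring.
Qed.

(** Diagonal limit: in all uses [u N] is already correct modulo [q^(N+1)], so the coefficient of
    [q^n] may be read off [u n]. *)
Definition flim (u : nat -> fps) : fps := fun n => u n n.

Lemma flim_eqm u : (forall N, eqm (S N) (u (S N)) (u N)) -> forall N, eqm (S N) (flim u) (u N).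
Proof.
  intros H N n Hn. unfold flim.
  induction N as [|N IH]; [replace n with O by lia; reflexivity|].
  destruct (Nat.eq_dec n (S N)) as [->|]; [reflexivity|].
  rewrite IH by lia. symmetry; apply H; lia.
Qed.

(* [dbl a] has the unfolded type [nat -> R], which [ring] does not identify with [fps]. *)
Ltac fring := match goal with |- ?a = ?b => change (@eq fps a b) end; ring.

(** * Formal theta series and products *)

(** Symmetric windows [|k| <= M] are used because a shift of the index then changes only end
    terms. *)
Fixpoint fwsum (f : Z -> fps) (M : nat) : fps :=
  match M with
  | O => f 0%Z
  | S m => fwsum f m + (f (Z.of_nat (S m)) + f (- Z.of_nat (S m))%Z)
  end.

Fixpoint fprod (f : nat -> fps) (n : nat) : fps :=
  match n with
  | O => 1
  | S m => fprod f m * f m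
  end.

Definition msq (k : Z) : fps := mono (Z.to_nat (k * k)).

Definition phi_trunc (N : nat) : fps := fwsum msq N.
Fixpoint psi_trunc (N : nat) : fps :=
  match N with
  | O => 1
  | S n => psi_trunc n + mono (N * (N + 1) / 2)
  end.
Definition P_trunc : nat -> fps := fprod (fun i => 1 - mono (S i)).
Definition O_trunc : nat -> fps := fprod (fun i => 1 - mono (2 * i + 1)).
Definition Om_trunc : nat -> fps := fprod (fun i => 1 + mono (2 * i + 1)).

(** Ramanujan's [phi] and [psi] and the products [(q;q)_inf] and [(q;q^2)_inf]. In Jacobi's notation
    with nome [q]: [theta_3 = phi], [theta_4 = phi(-q)] and [theta_2 = 2 q^(1/4) psi(q^2)]. *)
Definition phi := flim phi_trunc.
Definition psi := flim psi_trunc.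
Definition Pf := flim P_trunc.
Definition Of := flim O_trunc.

Lemma tri_S n : (S n * (S n + 1) / 2 = n * (n + 1) / 2 + S n)%nat.
Proof.
  replace (S n * (S n + 1))%nat with (n * (n + 1) + S n * 2)%nat by lia.
  rewrite Nat.div_add; lia.
Qed.

Lemma tri_double n : (2 * (n * (n + 1) / 2) = n * (n + 1))%nat.
Proof.
  induction n as [|n IH]; [reflexivity|]. rewrite tri_S. lia.
Qed.

Lemma fadd_eqm_small N a b : eqm N b 0 -> eqm N (a + b) a.
Proof.
  intros H. replace a with (a + 0) at 2 by ring.
  apply eqm_add; [apply eqm_refl|exact H].
Qed.

Lemma eqm_factor N a b : eqm N b 1 -> eqm N (a * b) a.
Proof.
  intros H. replace a with (a * 1) at 2 by ring.
  apply eqm_mul; [apply eqm_refl|exact H].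
Qed.

Lemma eqm_add0 N a b : eqm N a 0 -> eqm N b 0 -> eqm N (a + b) 0.
Proof.
  intros Ha Hb. replace 0 with (0 + 0) by ring. apply eqm_add; assumption.
Qed.

Lemma eqm_1_sub_mono N k : (N <= k)%nat -> eqm N (1 - mono k) 1.
Proof.
  intros H. replace 1 with (1 - 0) at 2 by ring.
  apply eqm_sub; [apply eqm_refl|apply eqm_mono; lia].
Qed.

Lemma phi_eqm N : eqm (S N) phi (phi_trunc N).
Proof.
  apply flim_eqm; clear N; intros N. unfold phi_trunc; cbn [fwsum].
  apply fadd_eqm_small; apply eqm_add0; apply eqm_mono; nia.
Qed.

Lemma psi_eqm N : eqm (S N) psi (psi_trunc N).
Proof.
  apply flim_eqm; clear N; intros N. cbn [psi_trunc].
  apply fadd_eqm_small; apply eqm_mono. rewrite tri_S; lia.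
Qed.

Lemma P_eqm N : eqm (S N) Pf (P_trunc N).
Proof.
  apply flim_eqm; clear N; intros N. apply eqm_factor, eqm_1_sub_mono; lia.
Qed.

Lemma O_eqm N : eqm (S N) Of (O_trunc N).
Proof.
  apply flim_eqm; clear N; intros N. apply eqm_factor, eqm_1_sub_mono; lia.
Qed.

Lemma P_trunc_eqm N M : (N <= M)%nat -> eqm (S N) (P_trunc M) (P_trunc N).
Proof.
  intros H. apply eqm_trans with Pf; [|apply P_eqm].
  apply eqm_le with (S M); [lia|]. apply eqm_sym, P_eqm.
Qed.

Lemma P_trunc_S n : P_trunc (S n) = P_trunc n * (1 - mono (S n)).
Proof. reflexivity. Qed.
Lemma O_trunc_S n : O_trunc (S n) = O_trunc n * (1 - mono (2 * n + 1)).
Proof. reflexivity. Qed.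
Lemma Om_trunc_S n : Om_trunc (S n) = Om_trunc n * (1 + mono (2 * n + 1)).
Proof. reflexivity. Qed.

(** The factors of Euler's product sorted by the parity of the exponent; [P_trunc (2N)] contains
    exactly [N] of each kind. *)
Lemma O_mul_dbl_P : Of * dbl Pf = Pf.
Proof.
  apply eqm_eq; intros N. apply eqm_le with (S N); [lia|].
  apply eqm_trans with (O_trunc N * dbl (P_trunc N)).
  - apply eqm_mul; [apply O_eqm|apply eqm_dbl, P_eqm].
  - replace (O_trunc N * dbl (P_trunc N)) with (P_trunc (2 * N)).
    + apply eqm_sym, eqm_le with (S (2 * N)); [lia|apply P_eqm].
    + induction N as [|N IH].
      * change (P_trunc (2 * 0)) with 1; change (O_trunc 0) with 1; change (P_trunc 0) with 1. rewrite dbl_const; ring.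
      * replace (2 * S N)%nat with (S (S (2 * N))) by lia.
        rewrite !P_trunc_S, O_trunc_S, IH, dbl_mul, dbl_sub, dbl_const, dbl_mono.
        replace (2 * N + 1)%nat with (S (2 * N)) by lia.
        replace (2 * S N)%nat with (S (S (2 * N))) by lia. ring.
Qed.

Lemma alt_odd k : alt (1 - mono (2 * k + 1)) = 1 + mono (2 * k + 1).
Proof.
  rewrite alt_sub, alt_const, alt_mono, pow_add, pow_1_even.
  replace (fconst (1 * (-1) ^ 1)) with (- (1)); [ring|].
  apply functional_extensionality; intros [|n]; unfold fopp; simpl; ring.
Qed.

Lemma Om_trunc_alt N : Om_trunc N = alt (O_trunc N).
Proof.
  induction N as [|N IH]; [symmetry; apply alt_const|].
  rewrite Om_trunc_S, O_trunc_S, alt_mul, alt_odd, IH. reflexivity.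
Qed.

(** Factor by factor, [(1 - x)(1 + x) = 1 - x^2] with [x = q^(2i+1)]. *)
Lemma O_mul_alt : Of * alt Of = dbl Of.
Proof.
  apply eqm_eq; intros N. apply eqm_le with (S N); [lia|].
  apply eqm_trans with (O_trunc N * alt (O_trunc N)).
  - apply eqm_mul; [|apply eqm_alt]; apply O_eqm.
  - replace (O_trunc N * alt (O_trunc N)) with (dbl (O_trunc N)).
    + apply eqm_sym, eqm_dbl, O_eqm.
    + induction N as [|N IH].
      * change (O_trunc 0) with 1. rewrite dbl_const, alt_const; fring.
      * rewrite O_trunc_S, alt_mul, alt_odd, dbl_mul, IH, dbl_sub, dbl_const, dbl_mono.
        replace (2 * (2 * N + 1))%nat with (2 * N + 1 + (2 * N + 1))%nat by lia.
        rewrite <- mono_mul. fring.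
Qed.

(** * The Jacobi triple product at [z = 1] *)

(** The geometric series of [1/(1 - q^n)]. *)
Definition geo (n : nat) : fps := fun m => if Nat.eqb (m mod n) 0 then 1%R else 0%R.

Lemma geo_inv n : (0 < n)%nat -> (1 - mono n) * geo n = 1.
Proof.
  intros Hn. replace ((1 - mono n) * geo n) with (geo n - mono n * geo n) by ring.
  apply functional_extensionality; intros m. unfold fsub.
  destruct (le_lt_dec n m) as [H|H].
  - replace m with (n + (m - n))%nat at 2 by lia. rewrite mono_mul_add. unfold geo.
    replace (m mod n)%nat with ((m - n) mod n)%nat.
    + destruct m; [lia|]. simpl; ring.
    + replace m with ((m - n) + 1 * n)%nat at 2 by lia. rewrite Nat.Div0.mod_add; reflexivity.
  - rewrite mono_mul_low by assumption. unfold geo. rewrite Nat.mod_small by assumption.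
    destruct m; simpl; ring.
Qed.

Definition P2_trunc (n : nat) : fps := dbl (P_trunc n).
Definition P2inv_trunc : nat -> fps := fprod (fun i => geo (2 * S i)).

Lemma P2_trunc_S n : P2_trunc (S n) = P2_trunc n * (1 - mono (2 * S n)).
Proof.
  unfold P2_trunc; rewrite P_trunc_S, dbl_mul, dbl_sub, dbl_const, dbl_mono. reflexivity.
Qed.

Lemma P2inv_trunc_S n : P2inv_trunc (S n) = P2inv_trunc n * geo (2 * S n).
Proof. reflexivity. Qed.

Lemma P2_trunc_inv n : P2_trunc n * P2inv_trunc n = 1.
Proof.
  induction n as [|n IH].
  - unfold P2_trunc; change (P_trunc 0) with 1; change (P2inv_trunc 0) with 1. rewrite dbl_const; ring.
  - rewrite P2_trunc_S, P2inv_trunc_S.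
    replace (P2_trunc n * (1 - mono (2 * S n)) * (P2inv_trunc n * geo (2 * S n)))
      with ((P2_trunc n * P2inv_trunc n) * ((1 - mono (2 * S n)) * geo (2 * S n))) by ring.
    rewrite IH, geo_inv by lia. ring.
Qed.

Lemma P2_trunc_eqm N M : (N <= M)%nat -> eqm (S N) (P2_trunc M) (P2_trunc N).
Proof. intros H; apply eqm_dbl, P_trunc_eqm, H. Qed.

Lemma P2_inv_eqm N n m :
  (N <= n)%nat -> (N <= m)%nat -> eqm (S N) (P2_trunc n * P2inv_trunc m) 1.
Proof.
  intros Hn Hm. rewrite <- (P2_trunc_inv m). apply eqm_mul; [|apply eqm_refl].
  apply eqm_trans with (P2_trunc N); [|apply eqm_sym]; apply P2_trunc_eqm; assumption.
Qed.

Lemma P2inv_eqm N n m :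
  (N <= n)%nat -> (N <= m)%nat -> eqm (S N) (P2inv_trunc n) (P2inv_trunc m).
Proof.
  intros Hn Hm.
  apply eqm_trans with (P2_trunc n * P2inv_trunc m * P2inv_trunc n).
  - replace (P2inv_trunc n) with (1 * P2inv_trunc n) at 1 by ring.
    apply eqm_mul; [apply eqm_sym, P2_inv_eqm; assumption|apply eqm_refl].
  - replace (P2_trunc n * P2inv_trunc m * P2inv_trunc n)
      with (P2_trunc n * P2inv_trunc n * P2inv_trunc m) by ring.
    rewrite P2_trunc_inv. replace (1 * P2inv_trunc m) with (P2inv_trunc m) by ring.
    apply eqm_refl.
Qed.

(** The inverse of [(1 - q^2)...(1 - q^(2m))], set to 0 for negative [m]: with this convention
    [rz_pred] also holds at [m = 0], and Gaussian binomials vanish outside their range by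
    themselves. *)
Definition rz (m : Z) : fps := if (m <? 0)%Z then 0 else P2inv_trunc (Z.to_nat m).
Definition pz (m : Z) : fps := mono (2 * Z.to_nat m).

Lemma rz_neg m : (m < 0)%Z -> rz m = 0.
Proof. intros H; unfold rz; destruct (Z.ltb_spec m 0); [reflexivity|lia]. Qed.

Lemma rz_pred m : (0 <= m)%Z -> (1 - pz m) * rz m = rz (m - 1).
Proof.
  intros H. unfold rz at 1, pz. destruct (Z.ltb_spec m 0); [lia|].
  destruct (Z.to_nat m) as [|n] eqn:E.
  - rewrite rz_neg by lia. simpl. rewrite mono_0. ring.
  - unfold rz. destruct (Z.ltb_spec (m - 1) 0); [lia|].
    replace (Z.to_nat (m - 1)) with n by lia. rewrite P2inv_trunc_S.
    replace ((1 - mono (2 * S n)) * (P2inv_trunc n * geo (2 * S n)))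
      with (P2inv_trunc n * ((1 - mono (2 * S n)) * geo (2 * S n))) by ring.
    rewrite geo_inv by lia. ring.
Qed.

Lemma pz_mul a b : (0 <= a)%Z -> (0 <= b)%Z -> pz a * pz b = pz (a + b).
Proof. intros; unfold pz; rewrite mono_mul; f_equal; lia. Qed.

(* The [k]-th term of the finite triple product: [q^(k^2)] times a Gaussian
   binomial coefficient in base [q^2], which vanishes for [|k| > n]. *)
Definition jt (n : nat) (k : Z) : fps :=
  msq k * (P2_trunc (2 * n) * rz (Z.of_nat n - k) * rz (Z.of_nat n + k)).

(** As [(a + 1) + b = 2n + 1], the difference on the right is [pz (a+1) * (1 - pz b)], and [rz_pred]
    used twice climbs from [b - 1] to [b + 1]. At [b = -1] both sides vanish. *)
Lemma rz_shift n a b : (-1 <= a)%Z -> (-1 <= b)%Z -> (a + b = 2 * Z.of_nat n)%Z ->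
  pz (a + 1) * rz (b - 1) = (pz (a + 1) - pz (2 * Z.of_nat n + 1)) * (1 - pz (b + 1)) * rz (b + 1).
Proof.
  intros Ha Hb Hab.
  replace ((pz (a + 1) - pz (2 * Z.of_nat n + 1)) * (1 - pz (b + 1)) * rz (b + 1))
    with ((pz (a + 1) - pz (2 * Z.of_nat n + 1)) * ((1 - pz (b + 1)) * rz (b + 1))) by ring.
  rewrite rz_pred by lia. replace (b + 1 - 1)%Z with b by lia.
  destruct (Z.eq_dec b (-1)) as [->|].
  - rewrite !rz_neg by lia; ring.
  - rewrite <- (rz_pred b) by lia. rewrite <- Hab.
    replace (a + b + 1)%Z with ((a + 1) + b)%Z by lia. rewrite <- (pz_mul (a + 1) b) by lia. ring.
Qed.

(** Compares coefficients of [z^k] when the finite product is multiplied by [(1 + z x)(1 + x/z) = 1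
    + x^2 + x (z + 1/z)], [x = q^(2n+1)]; the variable [z] itself never appears. *)
Lemma jt_rec n k :
  jt (S n) k = (1 + mono (2 * (2 * n + 1))) * jt n k
               + mono (2 * n + 1) * (jt n (k - 1) + jt n (k + 1)).
Proof.
  unfold jt.
  replace (Z.of_nat (S n) - k)%Z with (Z.of_nat n - k + 1)%Z by lia.
  replace (Z.of_nat (S n) + k)%Z with (Z.of_nat n + k + 1)%Z by lia.
  replace (Z.of_nat n - (k - 1))%Z with (Z.of_nat n - k + 1)%Z by lia.
  replace (Z.of_nat n + (k - 1))%Z with (Z.of_nat n + k - 1)%Z by lia.
  replace (Z.of_nat n - (k + 1))%Z with (Z.of_nat n - k - 1)%Z by lia.
  replace (Z.of_nat n + (k + 1))%Z with (Z.of_nat n + k + 1)%Z by lia.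
  (* For [|k| > n + 1] every term has a factor [rz] of a negative number; otherwise all terms are
     expressed through [rz (a+1)] and [rz (b+1)]. *)
  destruct (Z_le_gt_dec (Z.abs k) (Z.of_nat n + 1)) as [Hk|Hk].
  - set (a := (Z.of_nat n - k)%Z). set (b := (Z.of_nat n + k)%Z).
    assert (Ha : (-1 <= a)%Z) by (unfold a; lia). assert (Hb : (-1 <= b)%Z) by (unfold b; lia).
    assert (Hab : (a + b = 2 * Z.of_nat n)%Z) by (unfold a, b; lia).
    (* Exponents: [2n + 1 + (k - 1)^2 = k^2 + 2(n - k + 1)], and the same with [-k] for [E2]. *)
    assert (E1 : mono (2 * n + 1) * msq (k - 1) = msq k * pz (a + 1)).
    { unfold msq, pz; rewrite !mono_mul; f_equal. unfold a in *.
      apply Nat2Z.inj; rewrite !Nat2Z.inj_add, !Nat2Z.inj_mul, !Z2Nat.id by nia. lia. }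
    assert (E2 : mono (2 * n + 1) * msq (k + 1) = msq k * pz (b + 1)).
    { unfold msq, pz; rewrite !mono_mul; f_equal. unfold b in *.
      apply Nat2Z.inj; rewrite !Nat2Z.inj_add, !Nat2Z.inj_mul, !Z2Nat.id by nia. lia. }
    replace (2 * S n)%nat with (S (S (2 * n))) by lia. rewrite !P2_trunc_S.
    replace (mono (2 * S (2 * n))) with (pz (2 * Z.of_nat n + 1)) by (unfold pz; f_equal; lia).
    replace (mono (2 * (2 * n + 1))) with (pz (2 * Z.of_nat n + 1)) by (unfold pz; f_equal; lia).
    replace (mono (2 * S (S (2 * n)))) with (pz (a + 1) * pz (b + 1))
      by (rewrite pz_mul by lia; unfold pz; f_equal; lia).
    pose proof (rz_shift n a b Ha Hb Hab) as S1.
    pose proof (rz_shift n b a Hb Ha ltac:(lia)) as S2.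
    pose proof (rz_pred (a + 1) ltac:(lia)) as R1. replace (a + 1 - 1)%Z with a in R1 by lia.
    pose proof (rz_pred (b + 1) ltac:(lia)) as R2. replace (b + 1 - 1)%Z with b in R2 by lia.
    set (T := P2_trunc (2 * n)).
    replace (mono (2 * n + 1) *
       (msq (k - 1) * (T * rz (a + 1) * rz (b - 1)) + msq (k + 1) * (T * rz (a - 1) * rz (b + 1))))
      with (mono (2 * n + 1) * msq (k - 1) * (T * rz (a + 1) * rz (b - 1)) +
            mono (2 * n + 1) * msq (k + 1) * (T * rz (a - 1) * rz (b + 1))) by ring.
    rewrite E1, E2, <- R1, <- R2.
    replace (msq k * pz (a + 1) * (T * rz (a + 1) * rz (b - 1)))
      with (msq k * (T * rz (a + 1)) * (pz (a + 1) * rz (b - 1))) by ring.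
    replace (msq k * pz (b + 1) * (T * rz (a - 1) * rz (b + 1)))
      with (msq k * (T * rz (b + 1)) * (pz (b + 1) * rz (a - 1))) by ring.
    rewrite S1, S2. ring.
  - destruct (Z_lt_ge_dec 0 k).
    + rewrite (rz_neg (Z.of_nat n - k + 1)), (rz_neg (Z.of_nat n - k)),
        (rz_neg (Z.of_nat n - k - 1)) by lia. ring.
    + rewrite (rz_neg (Z.of_nat n + k + 1)), (rz_neg (Z.of_nat n + k)),
        (rz_neg (Z.of_nat n + k - 1)) by lia. ring.
Qed.

Lemma fwsum_add f g M : fwsum (fun k => f k + g k) M = fwsum f M + fwsum g M.
Proof. induction M as [|M IH]; cbn [fwsum]; [reflexivity|rewrite IH; ring]. Qed.

Lemma fwsum_scal c f M : fwsum (fun k => c * f k) M = c * fwsum f M.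
Proof. induction M as [|M IH]; cbn [fwsum]; [reflexivity|rewrite IH; ring]. Qed.

Lemma fwsum_pred f M :
  fwsum (fun k => f (k - 1)%Z) M = fwsum f M + f (- Z.of_nat (S M))%Z - f (Z.of_nat M).
Proof.
  induction M as [|M IH]; [cbn [fwsum]; simpl; ring|].
  cbn [fwsum]; rewrite IH.
  replace (Z.of_nat (S M) - 1)%Z with (Z.of_nat M) by lia.
  replace (- Z.of_nat (S M) - 1)%Z with (- Z.of_nat (S (S M)))%Z by lia. ring.
Qed.

Lemma fwsum_succ f M :
  fwsum (fun k => f (k + 1)%Z) M = fwsum f M + f (Z.of_nat (S M)) - f (- Z.of_nat M)%Z.
Proof.
  induction M as [|M IH]; [cbn [fwsum]; simpl; ring|].
  cbn [fwsum]; rewrite IH.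
  replace (- Z.of_nat (S M) + 1)%Z with (- Z.of_nat M)%Z by lia.
  replace (Z.of_nat (S M) + 1)%Z with (Z.of_nat (S (S M)))%Z by lia. ring.
Qed.

Lemma fwsum_ext f g M :
  (forall k, (Z.abs k <= Z.of_nat M)%Z -> f k = g k) -> fwsum f M = fwsum g M.
Proof.
  intros H; induction M as [|M IH]; cbn [fwsum]; [apply H; lia|].
  rewrite IH, !H by lia || (intros; apply H; lia). reflexivity.
Qed.

Lemma fwsum_eqm N f g M :
  (forall k, (Z.abs k <= Z.of_nat M)%Z -> eqm N (f k) (g k)) -> eqm N (fwsum f M) (fwsum g M).
Proof.
  intros H; induction M as [|M IH]; cbn [fwsum]; [apply H; lia|].
  repeat apply eqm_add; try (apply H; lia). apply IH; intros; apply H; lia.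
Qed.

Lemma jt_out n k : (Z.of_nat n < Z.abs k)%Z -> jt n k = 0.
Proof.
  intros H; unfold jt. destruct (Z_lt_ge_dec 0 k).
  - rewrite (rz_neg (Z.of_nat n - k)) by lia; ring.
  - rewrite (rz_neg (Z.of_nat n + k)) by lia; ring.
Qed.

Lemma jt_sum_window n M : (n <= M)%nat -> fwsum (jt n) M = fwsum (jt n) n.
Proof.
  intros H; induction M as [|M IH]; [replace n with O by lia; reflexivity|].
  destruct (Nat.eq_dec n (S M)) as [->|]; [reflexivity|].
  cbn [fwsum]. rewrite IH, !jt_out by lia. ring.
Qed.

(** At [z = 1] the two shifted sums equal the unshifted one, because the end terms lie outside the
    support, and [1 + x^2 + 2x = (1 + x)^2]. *)
Lemma jt_sum n : fwsum (jt n) n = Om_trunc n * Om_trunc n.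
Proof.
  induction n as [|n IH].
  - cbn [fwsum]. unfold jt, rz, Om_trunc, P2inv_trunc, msq, P2_trunc, P_trunc; simpl.
    rewrite mono_0, dbl_const. ring.
  - rewrite (fwsum_ext (jt (S n))
      (fun k => (1 + mono (2 * (2 * n + 1))) * jt n k
               + mono (2 * n + 1) * (jt n (k - 1)%Z + jt n (k + 1)%Z))) by (intros; apply jt_rec).
    rewrite fwsum_add, !fwsum_scal, fwsum_add.
    rewrite (fwsum_pred (jt n)), (fwsum_succ (jt n)), jt_sum_window, IH by lia.
    rewrite !jt_out by lia.
    replace (2 * (2 * n + 1))%nat with (2 * n + 1 + (2 * n + 1))%nat by lia.
    rewrite <- mono_mul, Om_trunc_S. ring.
Qed.

Lemma phi_triple_product : phi = alt Of * alt Of * dbl Pf.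
Proof.
  apply eqm_eq; intros M. apply eqm_le with (S M); [lia|].
  (* With [n = 2M] both [n - k] and [n + k] are at least [M] when [|k| <= M], so the Gaussian
     binomial is congruent to [P2inv_trunc n] modulo [q^(M+1)]; for [|k| > M] the factor [q^(k^2)]
     vanishes to that order. *)
  set (n := (2 * M)%nat).
  apply eqm_trans with (Om_trunc n * Om_trunc n * P2_trunc n).
  2: { rewrite Om_trunc_alt. apply eqm_sym, eqm_le with (S n); [lia|].
       repeat apply eqm_mul; try apply eqm_alt; try apply O_eqm.
       apply eqm_dbl, P_eqm. }
  apply eqm_trans with (phi * P2inv_trunc n * P2_trunc n).
  { replace (phi * P2inv_trunc n * P2_trunc n) with (phi * (P2_trunc n * P2inv_trunc n)) by ring.
    rewrite P2_trunc_inv. replace (phi * 1) with phi by ring. apply eqm_refl. }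
  apply eqm_mul; [|apply eqm_refl]. rewrite <- jt_sum.
  apply eqm_trans with (phi_trunc n * P2inv_trunc n).
  { apply eqm_mul; [|apply eqm_refl]. apply eqm_le with (S n); [lia|apply phi_eqm]. }
  unfold phi_trunc.
  replace (fwsum msq n * P2inv_trunc n) with (P2inv_trunc n * fwsum msq n) by ring.
  rewrite <- fwsum_scal. apply fwsum_eqm. intros k Hk. unfold jt.
  destruct (Z_le_gt_dec (Z.abs k) (Z.of_nat M)) as [H|H].
  - replace (P2inv_trunc n * msq k) with (msq k * (1 * P2inv_trunc n)) by ring.
    apply eqm_mul; [apply eqm_refl|].
    unfold rz. destruct (Z.ltb_spec (Z.of_nat n - k) 0); [lia|].
    destruct (Z.ltb_spec (Z.of_nat n + k) 0); [lia|].
    replace (P2_trunc (2 * n) * P2inv_trunc (Z.to_nat (Z.of_nat n - k)) *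
             P2inv_trunc (Z.to_nat (Z.of_nat n + k)))
      with (P2_trunc (2 * n) * P2inv_trunc (Z.to_nat (Z.of_nat n + k)) *
            P2inv_trunc (Z.to_nat (Z.of_nat n - k))) by ring.
    apply eqm_mul; [apply eqm_sym, P2_inv_eqm; lia|apply P2inv_eqm; lia].
  - replace (P2inv_trunc n * msq k) with (msq k * P2inv_trunc n) by ring.
    apply eqm_trans with 0; [|apply eqm_sym]; apply eqm_mono_mul; nia.
Qed.

(** * Relations between the formal theta series *)

Notation "2" := (1 + 1) : fps_scope.
Notation "4" := (2 * 2) : fps_scope.
Notation "8" := (2 * 4) : fps_scope.
Notation "16" := (4 * 4) : fps_scope.

Lemma fconst_2 : fconst 2 = 2.
Proof. apply functional_extensionality; intros [|n]; unfold fadd; simpl; ring. Qed.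

(** Even [k = 2m] give [q^(4 m^2)]; odd [k = 2m + 1] with [m >= 0], together with [-k], give
    [2 q (q^8)^(m(m+1)/2)]. The window [2N + 1] ends exactly with the [N]-th triangular number. *)
Lemma phi_trunc_dissection N :
  phi_trunc (2 * N + 1) = dbl (dbl (phi_trunc N)) + 2 * mono 1 * dbl (dbl (dbl (psi_trunc N))).
Proof.
  unfold phi_trunc. induction N as [|N IH].
  - change (fwsum msq (2 * 0 + 1)) with (mono 0 + (mono 1 + mono 1)).
    change (fwsum msq 0) with (mono 0). change (psi_trunc 0) with 1.
    rewrite mono_0, !dbl_const. fring.
  - replace (2 * S N + 1)%nat with (S (S (2 * N + 1))) by lia.
    cbn [fwsum psi_trunc]. rewrite IH, !dbl_add. unfold msq. rewrite !dbl_mono.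
    replace (2 * (2 * (2 * (S N * (S N + 1) / 2))))%nat with (4 * (S N * (S N + 1)))%nat
      by (rewrite (tri_double (S N)); lia).
    assert (E : mono 1 * mono (4 * (S N * (S N + 1))) = mono ((2 * N + 3) * (2 * N + 3))).
    { rewrite mono_mul; f_equal; nia. }
    replace (Z.to_nat (Z.of_nat (S (S (2 * N + 1))) * Z.of_nat (S (S (2 * N + 1)))))
      with ((2 * N + 3) * (2 * N + 3))%nat by (rewrite <- Nat2Z.inj_mul, Nat2Z.id; f_equal; lia).
    replace (Z.to_nat (- Z.of_nat (S (S (2 * N + 1))) * - Z.of_nat (S (S (2 * N + 1)))))
      with ((2 * N + 3) * (2 * N + 3))%nat
      by (rewrite Z.mul_opp_opp, <- Nat2Z.inj_mul, Nat2Z.id; f_equal; lia).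
    rewrite !Z.mul_opp_opp, <- !Nat2Z.inj_mul, !Nat2Z.id.
    replace (2 * (2 * (S N * S N)))%nat with (S (2 * N + 1) * S (2 * N + 1))%nat by lia.
    rewrite <- E. fring.
Qed.

Lemma phi_dissection : phi = dbl (dbl phi) + 2 * mono 1 * dbl (dbl (dbl psi)).
Proof.
  apply eqm_eq; intros N. apply eqm_le with (S N); [lia|].
  apply eqm_trans with (phi_trunc (2 * N + 1)).
  - apply eqm_le with (S (2 * N + 1)); [lia|apply phi_eqm].
  - rewrite phi_trunc_dissection. apply eqm_sym, eqm_add.
    + apply eqm_dbl, eqm_dbl, phi_eqm.
    + apply eqm_mul; [apply eqm_refl|]. apply eqm_dbl, eqm_dbl, eqm_dbl, psi_eqm.
Qed.

Definition phim := alt phi.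

Lemma alt_mono1 : alt (mono 1) = - mono 1.
Proof.
  apply functional_extensionality; intros n; unfold alt, fopp, mono.
  destruct (Nat.eqb_spec n 1); subst; simpl; ring.
Qed.

Lemma phim_dissection : phim = dbl (dbl phi) - 2 * mono 1 * dbl (dbl (dbl psi)).
Proof.
  unfold phim; rewrite phi_dissection at 1.
  rewrite alt_add, !alt_mul, alt_add, alt_mono1, !alt_dbl, alt_const. fring.
Qed.

Lemma phim_product : phim = Of * Of * dbl Pf.
Proof.
  unfold phim; rewrite phi_triple_product, !alt_mul, !alt_alt, alt_dbl. reflexivity.
Qed.

(** The geometric mean step of the AGM for the pair [phi^2], [phim^2]; the arithmetic mean step is
    the sum of [phi_sqr] and [phim_sqr] below. *)
Lemma phi_mul_phim : phi * phim = dbl phim * dbl phim.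
Proof.
  rewrite phim_product, phi_triple_product, !dbl_mul.
  pose proof O_mul_alt as H1. pose proof O_mul_dbl_P as H2.
  apply (f_equal dbl) in H2; rewrite dbl_mul in H2.
  transitivity ((Of * alt Of) * (Of * alt Of) * (dbl Pf * dbl Pf)); [fring|].
  transitivity (dbl Of * dbl Of * ((dbl Of * dbl (dbl Pf)) * (dbl Of * dbl (dbl Pf)))); [|fring].
  rewrite H1, H2. reflexivity.
Qed.

Lemma phim_mul_P : phim * dbl Pf = Pf * Pf.
Proof.
  transitivity ((Of * dbl Pf) * (Of * dbl Pf)).
  - rewrite phim_product. fring.
  - rewrite O_mul_dbl_P. reflexivity.
Qed.

Lemma phi_mul_P :
  phi * (Pf * Pf * (dbl (dbl Pf) * dbl (dbl Pf))) = dbl Pf * dbl Pf * dbl Pf * dbl Pf * dbl Pf.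
Proof.
  pose proof O_mul_alt as H1. pose proof O_mul_dbl_P as H2.
  pose proof (f_equal dbl H2) as H3; rewrite dbl_mul in H3.
  rewrite phi_triple_product.
  transitivity ((Of * alt Of) * (Of * alt Of) * dbl Pf * dbl Pf * dbl Pf * (dbl (dbl Pf) * dbl (dbl Pf))).
  - transitivity (alt Of * alt Of * dbl Pf *
      ((Of * dbl Pf) * (Of * dbl Pf) * (dbl (dbl Pf) * dbl (dbl Pf)))); [|fring].
    rewrite H2. reflexivity.
  - rewrite H1. set (B := dbl Pf) in *.
    transitivity ((dbl Of * dbl B) * (dbl Of * dbl B) * B * B * B); [fring|].
    rewrite H3. fring.
Qed.

(* [th_a] and [th_c] are the series in [q^2] and [q^4] of the dissection, with
   [q] replaced by its square root. *)
Definition th_a := dbl phi.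
Definition th_c := dbl (dbl psi).

(** After [q -> q^2] the left side becomes [phi * phim], which by the two dissections is
    [(D + 2qE)(D - 2qE)] with [D = phi(q^4)] and [E = psi(q^8)]. *)
Lemma phim_sqr : phim * phim = th_a * th_a - 4 * mono 1 * (th_c * th_c).
Proof.
  apply dbl_inj. rewrite dbl_sub, !dbl_mul, dbl_mono, dbl_add, !dbl_const.
  rewrite <- phi_mul_phim, phim_dissection, phi_dissection at 1. unfold th_a, th_c.
  change (2 * 1)%nat with (1 + 1)%nat. rewrite <- mono_mul. fring.
Qed.

Lemma phi_sqr : phi * phi = th_a * th_a + 4 * mono 1 * (th_c * th_c).
Proof.
  pose proof (f_equal alt phim_sqr) as H. unfold phim, th_a, th_c in H.
  rewrite alt_sub, !alt_mul, alt_add, alt_mono1, !alt_alt, !alt_dbl, alt_const in H.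
  rewrite H. unfold th_a, th_c. fring.
Qed.

(** Two evaluations of [phi^2 - phim^2] are compared: from the squares it is [8 q psi(q^4)^2], from
    the dissections [8 q phi(q^4) psi(q^8)]. This is the claim after [q -> q^4]. *)
Lemma psi_sqr : psi * psi = phi * dbl psi.
Proof.
  apply dbl_inj, dbl_inj. rewrite !dbl_mul.
  apply (mul_cancel_r _ _ 8); [unfold fmul, fadd; simpl; lra|].
  apply (mono_cancel 1).
  transitivity (phi * phi - phim * phim).
  - rewrite phi_sqr, phim_sqr. unfold th_c. fring.
  - set (D := dbl (dbl phi)). set (E := dbl (dbl (dbl psi))).
    transitivity ((D + 2 * mono 1 * E) * (D + 2 * mono 1 * E)
                  - (D - 2 * mono 1 * E) * (D - 2 * mono 1 * E)); [|fring].
    unfold D, E. rewrite <- phi_dissection, <- phim_dissection. reflexivity.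
Qed.

Lemma phi_0 : phi O = 1%R. Proof. reflexivity. Qed.
Lemma psi_0 : psi O = 1%R. Proof. reflexivity. Qed.
Lemma P_0 : Pf O = 1%R. Proof. reflexivity. Qed.
Lemma phim_0 : phim O = 1%R. Proof. unfold phim, alt; rewrite phi_0; simpl; ring. Qed.
Lemma dbl_0 a : dbl a O = a O. Proof. reflexivity. Qed.

(** Gauss's product for [psi]. Instead of a second triple product, both sides are shown to solve
    [E^2 P(q^2) = phi P^2 E(q^2)] with constant term 1; [E^2 - G^2] factors, and [doubling_zero]
    applies to [E - G]. *)
Lemma psi_mul_P : psi * Pf = dbl Pf * dbl Pf.
Proof.
  set (E := psi * Pf). set (G := dbl Pf * dbl Pf).
  assert (HE : E * E * dbl Pf = phi * (Pf * Pf) * dbl E).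
  { unfold E; rewrite dbl_mul.
    transitivity (psi * psi * (Pf * Pf * dbl Pf)); [fring|]. rewrite psi_sqr. fring. }
  assert (HG : G * G * dbl Pf = phi * (Pf * Pf) * dbl G).
  { unfold G; rewrite dbl_mul.
    transitivity (phi * (Pf * Pf * (dbl (dbl Pf) * dbl (dbl Pf)))); [|fring].
    rewrite phi_mul_P. fring. }
  assert (H : E - G = 0).
  { apply (doubling_zero (E - G) ((E + G) * dbl Pf) (phi * (Pf * Pf))).
    - rewrite dbl_sub. transitivity (E * E * dbl Pf - G * G * dbl Pf); [fring|].
      rewrite HE, HG. fring.
    - unfold E, G. rewrite fsub0, !fmul0, !dbl_0, psi_0, P_0. ring.
    - unfold E, G. rewrite fmul0, fadd0, !fmul0, !dbl_0, psi_0, P_0. lra. }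
  transitivity ((E - G) + G); [fring|]. rewrite H. fring.
Qed.

(** * Lambert series and logarithmic derivatives *)

Definition sigf : fps := fun n => INR (sigma1 n).

(** Partial sums of the Lambert series with terms [n q^n/(1 - q^n)], the form in which [sigma_1]
    enters the logarithmic derivative of Euler's product. *)
Fixpoint sigf_trunc (N : nat) : fps :=
  match N with
  | O => 0
  | S n => sigf_trunc n + fconst (INR (S n)) * (geo (S n) - 1)
  end.

Lemma der_P_trunc N : der (P_trunc N) = - (sigf_trunc N * P_trunc N).
Proof.
  induction N as [|N IH].
  - change (P_trunc 0) with 1. rewrite der_const. simpl. fring.
  - rewrite P_trunc_S, der_mul, IH, der_sub, der_const, der_mono. cbn [sigf_trunc].
    pose proof (geo_inv (S N) ltac:(lia)) as H.
    transitivity (- (sigf_trunc N * (P_trunc N * (1 - mono (S N)))) -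
      fconst (INR (S N)) * P_trunc N * ((1 - mono (S N)) * geo (S N) - (1 - mono (S N)))); [|fring].
    rewrite H. fring.
Qed.

Lemma sigf_trunc_coef N m :
  sigf_trunc N m =
  (INR (list_sum (filter (fun d => Nat.eqb (m mod d) 0) (seq 1 N))) * (if Nat.eqb m 0 then 0 else 1))%R.
Proof.
  induction N as [|N IH]; [simpl; destruct m; simpl; ring|].
  rewrite seq_S, filter_app, list_sum_app, plus_INR.
  cbn [sigf_trunc]. unfold fadd at 1. rewrite IH.
  unfold fmul. rewrite conv_const. unfold fsub, geo.
  change (1 + N)%nat with (S N).
  destruct m as [|m]; cbn [Nat.eqb fconst].
  - rewrite Nat.Div0.mod_0_l. simpl. ring.
  - cbn [filter]. destruct (Nat.eqb (S m mod S N) 0); cbn [list_sum fold_right plus]; rewrite ?Nat.add_0_r; simpl (INR 0); ring.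
Qed.

Lemma sigma1_window m N : (m <= N)%nat ->
  list_sum (filter (fun d => Nat.eqb (S m mod d) 0) (seq 1 (S N))) = sigma1 (S m).
Proof.
  unfold sigma1. intros H; induction N as [|N IH]; [replace m with O by lia; reflexivity|].
  destruct (Nat.eq_dec m (S N)) as [->|]; [reflexivity|].
  rewrite seq_S, filter_app, list_sum_app, IH by lia.
  cbn [filter]. rewrite (Nat.mod_small (S m)) by lia. simpl. lia.
Qed.

Lemma sigf_eqm N : eqm (S N) sigf (sigf_trunc N).
Proof.
  intros m Hm. rewrite sigf_trunc_coef. unfold sigf. destruct m as [|m].
  - simpl. ring.
  - cbn [Nat.eqb]. destruct N as [|N]; [lia|]. rewrite sigma1_window by lia. ring.
Qed.

Lemma der_P : der Pf = - (sigf * Pf).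
Proof.
  apply eqm_eq; intros N. apply eqm_le with (S N); [lia|].
  apply eqm_trans with (der (P_trunc N)); [apply eqm_der, P_eqm|].
  rewrite der_P_trunc.
  replace (- (sigf_trunc N * P_trunc N)) with (0 - sigf_trunc N * P_trunc N) by fring.
  replace (- (sigf * Pf)) with (0 - sigf * Pf) by fring.
  apply eqm_sub; [apply eqm_refl|]. apply eqm_sym, eqm_mul; [apply sigf_eqm|apply P_eqm].
Qed.

Lemma dbl_psi_sqr : dbl psi * dbl psi = th_a * th_c.
Proof. rewrite <- dbl_mul, psi_sqr, dbl_mul. reflexivity. Qed.

Lemma der_th_a : der th_a = 2 * dbl (der phi).
Proof. unfold th_a; rewrite der_dbl, fconst_2. reflexivity. Qed.
Lemma der_th_c : der th_c = 2 * dbl (der (dbl psi)).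
Proof. unfold th_c; rewrite der_dbl, fconst_2. reflexivity. Qed.

Lemma der_mono1 : der (mono 1) = mono 1.
Proof. rewrite der_mono. simpl INR. fring. Qed.

Lemma der_4 a : der (4 * a) = 4 * der a.
Proof. rewrite !der_mul, der_add, der_const. fring. Qed.

(** This is [4 phi psi(q^2)] times the logarithmic derivative of [q^(1/4) psi(q^2) / phi], that is
    of [theta_2 / theta_3], cleared of denominators and of the fractional power. *)
Definition wr := phi * (dbl psi + 4 * der (dbl psi)) - 4 * (dbl psi * der phi).

Lemma dbl_wr : dbl wr = th_a * (th_c + 2 * der th_c) - 2 * (th_c * der th_a).
Proof.
  unfold wr. rewrite dbl_sub, !dbl_mul, !dbl_add, !dbl_mul, !dbl_add, !dbl_const, der_th_a, der_th_c.
  unfold th_a, th_c. fring.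
Qed.

(** The factor [psi(q^2) phi] turns the left side into the analogous expression in [psi(q^2)^2] and
    [phi^2]; the quadratic relations rewrite these through [th_a] and [th_c], which brings back [wr]
    at [q^2]. *)
Lemma wr_doubling : wr * (dbl psi * phi) = phim * phim * dbl wr.
Proof.
  rewrite dbl_wr.
  transitivity (phi * phi * (dbl psi * dbl psi + 2 * der (dbl psi * dbl psi))
                - 2 * (dbl psi * dbl psi * der (phi * phi))).
  { rewrite !der_mul. unfold wr. fring. }
  rewrite phi_sqr, phim_sqr, dbl_psi_sqr, der_add.
  replace (4 * mono 1 * (th_c * th_c)) with (4 * (mono 1 * (th_c * th_c))) by fring.
  rewrite der_4, !der_mul, der_mono1. fring.
Qed.

(** Jacobi: the logarithmic derivative of [theta_2 / theta_3] is [theta_4^4 / 4]. Both sides solve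
    the equation of [wr_doubling] and have constant term 1. *)
Lemma wr_eq : wr = dbl psi * phi * (phim * phim * (phim * phim)).
Proof.
  set (M := dbl psi * phi * (phim * phim * (phim * phim))).
  assert (HM : M * (dbl psi * phi) = phim * phim * dbl M).
  { unfold M. rewrite !dbl_mul.
    transitivity (phim * phim * (dbl (dbl psi) * dbl phi) * ((dbl phim * dbl phim) * (dbl phim * dbl phim)));
      [|fring].
    rewrite <- phi_mul_phim.
    pose proof dbl_psi_sqr as H; unfold th_a, th_c in H.
    transitivity (dbl psi * dbl psi * (phi * phi * (phim * phim * (phim * phim)))); [fring|].
    rewrite H. fring. }
  assert (H : wr - M = 0).
  { apply (doubling_zero (wr - M) (dbl psi * phi) (phim * phim)).
    - rewrite dbl_sub. transitivity (wr * (dbl psi * phi) - M * (dbl psi * phi)); [fring|].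
      rewrite HM, wr_doubling. fring.
    - unfold wr, M. rewrite ?fsub0, ?fmul0, ?fadd0, ?dbl_0, psi_0, phi_0, phim_0.
      unfold der. simpl. ring.
    - rewrite fmul0, dbl_0, psi_0, phi_0. lra. }
  transitivity ((wr - M) + M); [fring|]. rewrite H. fring.
Qed.

Definition P4 := dbl (dbl Pf).
Definition sig2 := dbl sigf.
Definition sig4 := dbl (dbl sigf).

Lemma dbl_opp a : dbl (- a) = - dbl a.
Proof.
  replace (- a) with (0 - a) by fring. rewrite dbl_sub, dbl_const. fring.
Qed.

Lemma der_P2 : der (dbl Pf) = - (2 * (sig2 * dbl Pf)).
Proof. rewrite der_dbl, der_P, fconst_2, dbl_opp, dbl_mul. unfold sig2. fring. Qed.

Lemma der_P4 : der P4 = - (4 * (sig4 * P4)).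
Proof.
  unfold P4. rewrite der_dbl, der_P2, fconst_2, dbl_opp, !dbl_mul, !dbl_add, !dbl_const.
  unfold sig4, sig2. fring.
Qed.

(** Logarithmic derivative of [psi(q^2) = P(q^4)^2 / P(q^2)]; [der_phi] and [der_phim] treat in the
    same way the quotients in [phi_mul_P] and [phim_mul_P]. *)
Lemma der_dbl_psi : der (dbl psi) = dbl psi * (2 * sig2 - 8 * sig4).
Proof.
  assert (H : dbl psi * dbl Pf = P4 * P4) by (unfold P4; rewrite <- dbl_mul, psi_mul_P, dbl_mul; reflexivity).
  pose proof (f_equal der H) as HD. rewrite !der_mul, der_P2, der_P4 in HD.
  apply (mul_cancel_r _ _ (dbl Pf)); [rewrite dbl_0, P_0; lra|].
  transitivity ((der (dbl psi) * dbl Pf + dbl psi * - (2 * (sig2 * dbl Pf))) + 2 * sig2 * (dbl psi * dbl Pf));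
    [fring|].
  rewrite HD. transitivity (2 * sig2 * (dbl psi * dbl Pf) - 8 * sig4 * (dbl psi * dbl Pf)); [|fring].
  rewrite H. fring.
Qed.

Lemma der_phi : der phi = phi * (8 * sig4 + 2 * sigf - (8 + 2) * sig2).
Proof.
  pose proof phi_mul_P as H. fold P4 in H.
  pose proof (f_equal der H) as HD. rewrite !der_mul, der_P, der_P2, der_P4 in HD.
  set (K := Pf * Pf * (P4 * P4)) in *.
  apply (mul_cancel_r _ _ K).
  { unfold K, P4. rewrite !fmul0, !dbl_0, P_0; lra. }
  set (L := dbl Pf * dbl Pf * dbl Pf * dbl Pf * dbl Pf) in *.
  transitivity (- ((8 + 2) * sig2) * L + (2 * sigf + 8 * sig4) * (phi * K)).
  - transitivity ((der phi * K + phi * - ((2 * sigf + 8 * sig4) * K)) + (2 * sigf + 8 * sig4) * (phi * K)); [fring|].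
    f_equal.
    match type of HD with _ = ?r => transitivity r end; [rewrite <- HD; unfold K; fring|unfold L; fring].
  - rewrite <- H. fring.
Qed.

Lemma der_phim : der phim = phim * (2 * sig2 - 2 * sigf).
Proof.
  pose proof phim_mul_P as H.
  pose proof (f_equal der H) as HD. rewrite !der_mul, der_P, der_P2 in HD.
  apply (mul_cancel_r _ _ (dbl Pf)); [rewrite dbl_0, P_0; lra|].
  transitivity ((der phim * dbl Pf + phim * - (2 * (sig2 * dbl Pf))) + 2 * sig2 * (phim * dbl Pf));
    [fring|].
  rewrite HD. transitivity (2 * sig2 * (phim * dbl Pf) - 2 * sigf * (phim * dbl Pf)); [|fring].
  rewrite H. fring.
Qed.

(** [wr_eq] divided by [psi(q^2) phi], with the logarithmic derivatives on its left side read off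
    the products. *)
Lemma lambert_phim :
  1 - 8 * sigf + 8 * (4 + 2) * sig2 - 8 * 8 * sig4 = phim * phim * (phim * phim).
Proof.
  apply (mul_cancel_r _ _ (dbl psi * phi)); [rewrite fmul0, dbl_0, psi_0, phi_0; lra|].
  transitivity wr.
  - unfold wr. rewrite der_dbl_psi, der_phi. fring.
  - rewrite wr_eq. fring.
Qed.

(** The companion formula: the logarithmic derivative of [theta_3 / theta_4] is [theta_2^4 / 4]. The
    left side is 4 times this derivative read off the products; computed from [phi_sqr] and
    [phim_sqr] instead, it leads to [wr] at [q^2], known from [wr_eq]. *)
Lemma lambert_psi :
  16 * sigf - 8 * (4 + 2) * sig2 + 8 * 4 * sig4 = 16 * mono 1 * (th_a * th_a * (th_c * th_c)).
Proof.
  apply (mul_cancel_r _ _ (phi * phim * (phi * phim)));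
    [rewrite !fmul0, phim_0, phi_0; lra|].
  transitivity (2 * (phim * phim * der (phi * phi) - phi * phi * der (phim * phim))).
  { rewrite !der_mul, der_phi, der_phim. fring. }
  rewrite phi_sqr, phim_sqr, der_sub, der_add.
  replace (4 * mono 1 * (th_c * th_c)) with (4 * (mono 1 * (th_c * th_c))) by fring.
  rewrite der_4, !der_mul, der_mono1.
  transitivity (16 * mono 1 * (th_a * th_c) * (th_a * (th_c + 2 * der th_c) - 2 * (th_c * der th_a)));
    [fring|].
  rewrite <- dbl_wr, wr_eq, !dbl_mul, <- phi_mul_phim. fold th_c th_a. fring.
Qed.

(** The sum of the two Lambert formulas, in the shape [theta_4^4 + theta_2^4 = theta_3^4]; the next
    theorem is their difference. *)
Theorem lambert_E42 :
  1 + 8 * sigf - 8 * 4 * sig4 =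
  (th_a * th_a + 4 * mono 1 * (th_c * th_c)) * (th_a * th_a + 4 * mono 1 * (th_c * th_c)).
Proof.
  transitivity ((1 - 8 * sigf + 8 * (4 + 2) * sig2 - 8 * 8 * sig4)
                + (16 * sigf - 8 * (4 + 2) * sig2 + 8 * 4 * sig4)); [fring|].
  rewrite lambert_phim, lambert_psi, phim_sqr. fring.
Qed.

Theorem lambert_E42' :
  1 - 8 * (2 + 1) * sigf + 8 * (8 + 4) * sig2 - 8 * (8 + 4) * sig4 =
  (th_a * th_a - 4 * mono 1 * (th_c * th_c)) * (th_a * th_a - 4 * mono 1 * (th_c * th_c))
  - 16 * mono 1 * (th_a * th_a * (th_c * th_c)).
Proof.
  transitivity ((1 - 8 * sigf + 8 * (4 + 2) * sig2 - 8 * 8 * sig4)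
                - (16 * sigf - 8 * (4 + 2) * sig2 + 8 * 4 * sig4)); [fring|].
  rewrite lambert_phim, lambert_psi, phim_sqr. reflexivity.
Qed.

(** The bracket is [phim^2] and [th_a * th_c] is [psi(q^2)^2], both quotients of Euler products.
    Together they give [eta_4^4] without its power of [q]. *)
Theorem theta_eta_product :
  th_a * th_c * (th_a * th_a - 4 * mono 1 * (th_c * th_c)) *
    (dbl Pf * dbl Pf * (dbl Pf * dbl Pf)) =
  Pf * Pf * (Pf * Pf) * (P4 * P4 * (P4 * P4)).
Proof.
  rewrite <- phim_sqr, <- dbl_psi_sqr.
  transitivity ((phim * dbl Pf) * (phim * dbl Pf) * ((dbl psi * dbl Pf) * (dbl psi * dbl Pf))); [fring|].
  rewrite phim_mul_P, <- (dbl_mul psi), psi_mul_P, dbl_mul. unfold P4. fring.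
Qed.

Local Open Scope R_scope.
Local Open Scope C_scope.

(** * Limits and series of complex numbers *)

(** Convergence through the modulus of the error, so that estimates reduce to real null sequences;
    real and imaginary parts serve mainly to match [CSeries] and [CLim_seq]. *)
Definition Clim (u : nat -> C) (l : C) : Prop :=
  is_lim_seq (fun n => Cmod (u n - l)) 0%R.

Lemma lim0_le (u v : nat -> R) :
  (forall n, (0 <= u n <= v n)%R) -> is_lim_seq v 0%R -> is_lim_seq u 0%R.
Proof.
  intros H Hv. apply (is_lim_seq_le_le (fun _ => 0%R) u v); auto. apply is_lim_seq_const.
Qed.

Lemma lim0_plus (u v : nat -> R) :
  is_lim_seq u 0%R -> is_lim_seq v 0%R -> is_lim_seq (fun n => u n + v n)%R 0%R.
Proof.
  intros Hu Hv. replace (Finite 0) with (Finite (0 + 0)) by (f_equal; ring).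
  apply is_lim_seq_plus'; assumption.
Qed.

Lemma lim0_scal (c : R) (u : nat -> R) :
  is_lim_seq u 0%R -> is_lim_seq (fun n => c * u n)%R 0%R.
Proof.
  intros Hu. replace (Finite 0) with (Rbar_mult c 0%R) by (simpl; f_equal; ring).
  apply is_lim_seq_scal_l; assumption.
Qed.

Lemma lim_inv_INR : is_lim_seq (fun n => / INR (S n))%R 0%R.
Proof.
  apply (is_lim_seq_incr_1 (fun n => / INR n)%R).
  apply (is_lim_seq_inv INR p_infty); [apply is_lim_seq_INR|discriminate].
Qed.

Lemma im_le_Cmod (z : C) : (Rabs (Im z) <= Cmod z)%R.
Proof. apply Rle_trans with (2 := Rmax_Cmod z). apply Rmax_r. Qed.

Lemma Cmod_le_re_im (z : C) : (Cmod z <= Rabs (Re z) + Rabs (Im z))%R.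
Proof.
  replace z with (RtoC (Re z) + Ci * RtoC (Im z)) at 1.
  2: { destruct z as [x y]; unfold Ci, RtoC, Cplus, Cmult, Re, Im; simpl; f_equal; ring. }
  eapply Rle_trans; [apply Cmod_triangle|].
  rewrite Cmod_mult, !Cmod_R.
  replace (Cmod Ci) with 1%R; [lra|].
  unfold Cmod, Ci; simpl. replace (0 * (0 * 1) + 1 * (1 * 1))%R with 1%R by ring.
  symmetry; apply sqrt_1.
Qed.

Lemma Re_minus (a b : C) : (Re (a - b) = Re a - Re b)%R.
Proof. destruct a, b; reflexivity. Qed.
Lemma Im_minus (a b : C) : (Im (a - b) = Im a - Im b)%R.
Proof. destruct a, b; reflexivity. Qed.
Lemma Im_plus (a b : C) : (Im (a + b) = Im a + Im b)%R.
Proof. destruct a, b; reflexivity. Qed.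

Lemma lim_minus_0 (u : nat -> R) (l : R) :
  is_lim_seq u l <-> is_lim_seq (fun n => u n - l)%R 0%R.
Proof.
  split; intros H.
  - replace (Finite 0) with (Finite (l - l)) by (f_equal; ring).
    apply is_lim_seq_minus'; [exact H|apply is_lim_seq_const].
  - apply is_lim_seq_ext with (fun n => (u n - l) + l)%R; [intros; ring|].
    replace (Finite l) with (Finite (0 + l)) by (f_equal; ring).
    apply is_lim_seq_plus'; [exact H|apply is_lim_seq_const].
Qed.

Lemma Clim_Re u l : Clim u l -> is_lim_seq (fun n => Re (u n)) (Re l).
Proof.
  intros H. apply lim_minus_0, is_lim_seq_abs_0. revert H; apply lim0_le.
  intros n; rewrite <- Re_minus. split; [apply Rabs_pos|apply re_le_Cmod].
Qed.

Lemma Clim_Im u l : Clim u l -> is_lim_seq (fun n => Im (u n)) (Im l).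
Proof.
  intros H. apply lim_minus_0, is_lim_seq_abs_0. revert H; apply lim0_le.
  intros n; rewrite <- Im_minus. split; [apply Rabs_pos|apply im_le_Cmod].
Qed.

Lemma Clim_Re_Im u (l : C) :
  is_lim_seq (fun n => Re (u n)) (Re l) -> is_lim_seq (fun n => Im (u n)) (Im l) -> Clim u l.
Proof.
  intros H1 H2. apply lim_minus_0, is_lim_seq_abs_0 in H1. apply lim_minus_0, is_lim_seq_abs_0 in H2.
  generalize (lim0_plus _ _ H1 H2); apply lim0_le.
  intros n; split; [apply Cmod_ge_0|]. rewrite <- Re_minus, <- Im_minus. apply Cmod_le_re_im.
Qed.

Lemma Clim_unique u l l' : Clim u l -> Clim u l' -> l = l'.
Proof.
  intros H H'.
  assert (E1 : Re l = Re l').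
  { apply Clim_Re, is_lim_seq_unique in H. apply Clim_Re, is_lim_seq_unique in H'. congruence. }
  assert (E2 : Im l = Im l').
  { apply Clim_Im, is_lim_seq_unique in H. apply Clim_Im, is_lim_seq_unique in H'. congruence. }
  destruct l, l'; simpl in *; congruence.
Qed.

Lemma Clim_ext_loc u v l : eventually (fun n => u n = v n) -> Clim u l -> Clim v l.
Proof.
  intros [N HN]. apply is_lim_seq_ext_loc. exists N; intros n Hn; rewrite HN; auto.
Qed.

Lemma Clim_ext u v l : (forall n, u n = v n) -> Clim u l -> Clim v l.
Proof. intros H; apply Clim_ext_loc; exists O; auto. Qed.

Lemma Clim_const c : Clim (fun _ => c) c.
Proof.
  apply is_lim_seq_ext with (fun _ => 0%R); [|apply is_lim_seq_const].
  intros _. replace (c - c) with (RtoC 0) by ring. rewrite Cmod_0; reflexivity.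
Qed.

Lemma Clim_plus u v l m : Clim u l -> Clim v m -> Clim (fun n => u n + v n) (l + m).
Proof.
  intros H1 H2. generalize (lim0_plus _ _ H1 H2); apply lim0_le.
  intros n; split; [apply Cmod_ge_0|].
  replace (u n + v n - (l + m)) with ((u n - l) + (v n - m)) by ring. apply Cmod_triangle.
Qed.

Lemma Clim_scal c u l : Clim u l -> Clim (fun n => c * u n) (c * l).
Proof.
  intros H. generalize (lim0_scal (Cmod c) _ H); apply lim0_le.
  intros n; split; [apply Cmod_ge_0|].
  replace (c * u n - c * l) with (c * (u n - l)) by ring. rewrite Cmod_mult; lra.
Qed.

Lemma Clim_subseq u l (f : nat -> nat) :
  (forall n, (n <= f n)%nat) -> Clim u l -> Clim (fun n => u (f n)) l.
Proof.
  intros Hf H. unfold Clim in *.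
  apply (is_lim_seq_subseq (fun n => Cmod (u n - l)) 0%R f); [|exact H].
  intros P [N HN]; exists N; intros n Hn; apply HN. specialize (Hf n); lia.
Qed.

Lemma Clim_of_diff u v l : Clim u l -> is_lim_seq (fun n => Cmod (v n - u n)) 0%R -> Clim v l.
Proof.
  intros H1 H2. generalize (lim0_plus _ _ H1 H2); apply lim0_le.
  intros n; split; [apply Cmod_ge_0|].
  replace (v n - l) with ((u n - l) + (v n - u n)) by ring. apply Cmod_triangle.
Qed.

Lemma Clim_Cmod_le u l (B : R) : (forall n, (Cmod (u n) <= B)%R) -> Clim u l -> (Cmod l <= B)%R.
Proof.
  intros H Hl.
  assert (L : is_lim_seq (fun n => B + Cmod (u n - l))%R B).
  { replace (Finite B) with (Finite (B + 0)) by (f_equal; ring).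
    apply is_lim_seq_plus'; [apply is_lim_seq_const|exact Hl]. }
  change (Rbar_le (Cmod l) B).
  refine (is_lim_seq_le (fun _ => Cmod l) _ (Cmod l) B _ (is_lim_seq_const _) L).
  intros n. specialize (H n).
  pose proof (Cmod_triangle (u n) (- (u n - l))) as T.
  rewrite Cmod_opp in T. replace (u n + - (u n - l)) with l in T by ring. lra.
Qed.

Fixpoint csum (a : nat -> C) (n : nat) : C :=
  match n with
  | O => 0
  | S m => csum a m + a m
  end.

Lemma csum_Re a n : Re (csum a (S n)) = sum_n (fun k => Re (a k)) n.
Proof.
  induction n as [|n IH].
  - rewrite sum_O. change (csum a 1) with (0 + a O). rewrite Cplus_0_l. reflexivity.
  - rewrite sum_Sn, <- IH. change (csum a (S (S n))) with (csum a (S n) + a (S n)).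
    apply re_plus.
Qed.

Lemma csum_Im a n : Im (csum a (S n)) = sum_n (fun k => Im (a k)) n.
Proof.
  induction n as [|n IH].
  - rewrite sum_O. change (csum a 1) with (0 + a O). rewrite Cplus_0_l. reflexivity.
  - rewrite sum_Sn, <- IH. change (csum a (S (S n))) with (csum a (S n) + a (S n)).
    apply Im_plus.
Qed.

Lemma CSeries_Clim a (b : nat -> R) :
  (forall n, (Cmod (a n) <= b n)%R) -> ex_series b -> Clim (csum a) (CSeries a).
Proof.
  intros H Hb.
  assert (E1 : ex_series (fun n => Re (a n))).
  { apply (ex_series_le (V := R_CompleteNormedModule)) with b; [|exact Hb].
    intros n; eapply Rle_trans; [apply re_le_Cmod|apply H]. }
  assert (E2 : ex_series (fun n => Im (a n))).
  { apply (ex_series_le (V := R_CompleteNormedModule)) with b; [|exact Hb].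
    intros n; eapply Rle_trans; [apply im_le_Cmod|apply H]. }
  apply Series_correct in E1. apply Series_correct in E2.
  apply Clim_Re_Im; apply is_lim_seq_incr_1.
  - apply is_lim_seq_ext with (2 := E1). intros n; symmetry; apply csum_Re.
  - apply is_lim_seq_ext with (2 := E2). intros n; symmetry; apply csum_Im.
Qed.

Lemma CSeries_unique a l : Clim (csum a) l -> CSeries a = l.
Proof.
  intros H. pose proof (Clim_Re _ _ H) as H1. pose proof (Clim_Im _ _ H) as H2.
  apply is_lim_seq_incr_1 in H1. apply is_lim_seq_incr_1 in H2.
  unfold CSeries. destruct l as [x y]; f_equal; apply is_series_unique.
  - apply is_lim_seq_ext with (2 := H1). intros n; apply csum_Re.
  - apply is_lim_seq_ext with (2 := H2). intros n; apply csum_Im.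
Qed.

Lemma CLim_seq_unique u l : Clim u l -> CLim_seq u = l.
Proof.
  intros H. unfold CLim_seq.
  rewrite (is_lim_seq_unique _ _ (Clim_Re _ _ H)), (is_lim_seq_unique _ _ (Clim_Im _ _ H)).
  destruct l; reflexivity.
Qed.

Lemma csum_ext a b n : (forall k, (k < n)%nat -> a k = b k) -> csum a n = csum b n.
Proof.
  intros H; induction n as [|n IH]; simpl; [reflexivity|].
  rewrite IH, H by (intros; try apply H; lia). reflexivity.
Qed.

Lemma csum_zero_prefix (a : nat -> C) n : (forall k, (k < n)%nat -> a k = 0) -> csum a n = 0.
Proof.
  intros H; induction n as [|n IH]; simpl; [reflexivity|].
  rewrite IH, H by (intros; try apply H; lia). ring.
Qed.

Lemma sum_n_le_Series (b : nat -> R) n :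
  (forall k, (0 <= b k)%R) -> ex_series b -> (sum_n b n <= Series b)%R.
Proof.
  intros H Hb. apply Series_correct in Hb.
  apply (is_lim_seq_incr_compare (sum_n b)); [exact Hb|].
  intros k; rewrite sum_Sn. unfold plus; simpl. specialize (H (S k)); lra.
Qed.

(** * Evaluation of formal power series in the unit disc *)

Definition ev (a : fps) (z : C) : C := CSeries (fun n => RtoC (a n) * z ^ n).

(** Absolute convergence in the open unit disc. It is stable under the ring operations and [dbl], so
    evaluation at a point of the disc carries formal identities to analytic ones. *)
Definition good (a : fps) : Prop :=
  forall r : R, (0 <= r < 1)%R -> ex_series (fun n => (Rabs (a n) * r ^ n)%R).

Lemma ev_term_Cmod (a : fps) z n : Cmod (RtoC (a n) * z ^ n) = (Rabs (a n) * Cmod z ^ n)%R.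
Proof. rewrite Cmod_mult, Cmod_R, Cmod_pow. reflexivity. Qed.

Lemma ev_Clim a z : good a -> (Cmod z < 1)%R ->
  Clim (csum (fun n => RtoC (a n) * z ^ n)) (ev a z).
Proof.
  intros Ha Hz. apply CSeries_Clim with (fun n => (Rabs (a n) * Cmod z ^ n)%R).
  - intros n; rewrite ev_term_Cmod; lra.
  - apply Ha; split; [apply Cmod_ge_0|exact Hz].
Qed.

Lemma ex_series_abs_pow_le (x b : nat -> R) (r : R) : (0 <= r)%R ->
  (forall n, (Rabs (x n) * r ^ n <= b n)%R) -> ex_series b ->
  ex_series (fun n => (Rabs (x n) * r ^ n)%R).
Proof.
  intros Hr H. apply (ex_series_le (V := R_CompleteNormedModule)). intros n.
  change (Rabs (Rabs (x n) * r ^ n) <= b n)%R. rewrite Rabs_right; [apply H|].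
  apply Rle_ge, Rmult_le_pos; [apply Rabs_pos|apply pow_le, Hr].
Qed.

Lemma good_le (a b : fps) : good b -> (forall n, (Rabs (a n) <= b n)%R) -> good a.
Proof.
  intros Hb H r Hr. apply ex_series_abs_pow_le with (3 := Hb r Hr); [apply Hr|].
  intros n. apply Rmult_le_compat_r; [apply pow_le, Hr|].
  eapply Rle_trans; [apply H|apply Rle_abs].
Qed.

Lemma good_add a b : good a -> good b -> good (fadd a b).
Proof.
  intros Ha Hb r Hr.
  apply ex_series_abs_pow_le with (fun n => Rabs (a n) * r ^ n + Rabs (b n) * r ^ n)%R; [apply Hr| |].
  - intros n. rewrite <- Rmult_plus_distr_r.
    apply Rmult_le_compat_r; [apply pow_le, Hr|apply Rabs_triang].
  - apply (ex_series_plus (V := R_NormedModule)); [apply Ha|apply Hb]; exact Hr.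
Qed.

Lemma good_opp a : good a -> good (fopp a).
Proof.
  intros Ha r Hr. apply ex_series_ext with (2 := Ha r Hr).
  intros n; unfold fopp; rewrite Rabs_Ropp; reflexivity.
Qed.

Lemma fsub_opp a b : fsub a b = fadd a (fopp b).
Proof. apply functional_extensionality; intros n; unfold fsub, fadd, fopp; ring. Qed.

Lemma good_sub a b : good a -> good b -> good (fsub a b).
Proof. intros; rewrite fsub_opp; apply good_add; [|apply good_opp]; assumption. Qed.

Lemma conv_sum a b n : conv a b n = sum_f_R0 (fun k => (a k * b (n - k)%nat)%R) n.
Proof.
  revert a; induction n as [|n IH]; intros a; [reflexivity|].
  simpl conv. rewrite IH, (decomp_sum _ (S n)) by lia. simpl pred.
  rewrite Nat.sub_0_r. f_equal.
Qed.

Lemma conv_pow a b r n : (conv a b n * r ^ n = conv (fun k => a k * r ^ k) (fun k => b k * r ^ k) n)%R.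
Proof.
  rewrite !conv_sum, Rmult_comm, scal_sum. apply sum_eq; intros k Hk.
  replace (r ^ n)%R with (r ^ k * r ^ (n - k))%R by (rewrite <- pow_add; f_equal; lia). ring.
Qed.

Lemma conv_abs a b n : (Rabs (conv a b n) <= conv (fun k => Rabs (a k)) (fun k => Rabs (b k)) n)%R.
Proof.
  rewrite !conv_sum. eapply Rle_trans; [apply Rsum_abs|].
  apply Req_le, sum_eq; intros k Hk; apply Rabs_mult.
Qed.

Lemma abs_abs_pow (x r : R) n : (0 <= r)%R -> Rabs (Rabs x * r ^ n) = (Rabs x * r ^ n)%R.
Proof.
  intros H. apply Rabs_right, Rle_ge, Rmult_le_pos; [apply Rabs_pos|apply pow_le, H].
Qed.

Lemma good_mul a b : good a -> good b -> good (fmul a b).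
Proof.
  intros Ha Hb r Hr.
  pose proof (is_series_mult (fun n => Rabs (a n) * r ^ n)%R (fun n => Rabs (b n) * r ^ n)%R _ _
     (Series_correct _ (Ha r Hr)) (Series_correct _ (Hb r Hr))) as H.
  assert (H' : ex_series (fun n => Rabs (Rabs (a n) * r ^ n))).
  { apply ex_series_ext with (2 := Ha r Hr). intros n; symmetry; apply abs_abs_pow, Hr. }
  assert (H'' : ex_series (fun n => Rabs (Rabs (b n) * r ^ n))).
  { apply ex_series_ext with (2 := Hb r Hr). intros n; symmetry; apply abs_abs_pow, Hr. }
  specialize (H H' H'').
  apply (ex_series_abs_pow_le (fmul a b)) with (3 := ex_intro _ _ H); [apply Hr|]. intros n.
  rewrite <- (conv_sum (fun k => Rabs (a k) * r ^ k)%R (fun k => Rabs (b k) * r ^ k)%R), <- conv_pow.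
  apply Rmult_le_compat_r; [apply pow_le, Hr|apply conv_abs].
Qed.

Lemma good_finite (a : fps) N : (forall n, (N <= n)%nat -> a n = 0%R) -> good a.
Proof.
  intros H r _. apply (ex_series_incr_n (V := R_NormedModule)) with (n := N).
  apply ex_series_ext with (fun _ : nat => 0%R).
  - intros n. rewrite H by lia. rewrite Rabs_R0, Rmult_0_l. reflexivity.
  - exists 0%R. change (is_lim_seq (sum_n (fun _ : nat => 0%R)) 0%R).
    apply is_lim_seq_ext with (fun _ => 0%R); [|apply is_lim_seq_const].
    intros n; induction n as [|n IH]; [rewrite sum_O; reflexivity|].
    rewrite sum_Sn, <- IH. unfold plus; simpl; ring.
Qed.

Lemma good_const c : good (fconst c).
Proof. apply good_finite with 1%nat. intros [|n] H; [lia|reflexivity]. Qed.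

Lemma good_mono k : good (mono k).
Proof.
  apply good_finite with (S k). intros n H; unfold mono.
  destruct (Nat.eqb_spec n k); [lia|reflexivity].
Qed.

Lemma ev_add a b z : good a -> good b -> (Cmod z < 1)%R -> ev (fadd a b) z = ev a z + ev b z.
Proof.
  intros Ha Hb Hz. apply CSeries_unique.
  apply Clim_ext with (2 := Clim_plus _ _ _ _ (ev_Clim a z Ha Hz) (ev_Clim b z Hb Hz)).
  intros n; induction n as [|n IH]; simpl; [ring|].
  rewrite <- IH. unfold fadd. rewrite RtoC_plus. ring.
Qed.

Lemma ev_opp a z : good a -> (Cmod z < 1)%R -> ev (fopp a) z = - ev a z.
Proof.
  intros Ha Hz. apply CSeries_unique. replace (- ev a z) with ((-1) * ev a z) by ring.
  apply Clim_ext with (2 := Clim_scal (-1) _ _ (ev_Clim a z Ha Hz)).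
  intros n; induction n as [|n IH]; simpl; [ring|].
  rewrite <- IH. unfold fopp. rewrite RtoC_opp. ring.
Qed.

Lemma ev_sub a b z : good a -> good b -> (Cmod z < 1)%R -> ev (fsub a b) z = ev a z - ev b z.
Proof.
  intros Ha Hb Hz. rewrite fsub_opp, ev_add by (try apply good_opp; assumption).
  rewrite ev_opp by assumption. reflexivity.
Qed.

Lemma csum_zero (a : nat -> C) N n :
  (forall k, (N <= k)%nat -> a k = 0) -> (N <= n)%nat -> csum a n = csum a N.
Proof.
  intros H Hn. induction n as [|n IH]; [replace N with O by lia; reflexivity|].
  destruct (Nat.eq_dec N (S n)) as [->|]; [reflexivity|].
  simpl. rewrite H, IH by lia. ring.
Qed.

Lemma ev_mono k z : ev (mono k) z = z ^ k.
Proof.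
  apply CSeries_unique. apply Clim_ext_loc with (2 := Clim_const (z ^ k)).
  exists (S k). intros n Hn.
  rewrite (csum_zero _ (S k)); [|intros i Hi|exact Hn].
  - simpl. replace (csum (fun n0 => RtoC (mono k n0) * z ^ n0) k) with (RtoC 0).
    + unfold mono; rewrite Nat.eqb_refl. ring.
    + symmetry. rewrite (csum_ext _ (fun _ => 0)).
      * induction k as [|k IH]; simpl; [reflexivity|]. rewrite IH by (simpl in *; lia). ring.
      * intros i Hi. unfold mono. destruct (Nat.eqb_spec i k); [lia|ring].
  - unfold mono. destruct (Nat.eqb_spec i k); [lia|ring].
Qed.

Lemma ev_1 z : ev (fconst 1) z = 1.
Proof. rewrite <- mono_0, ev_mono. reflexivity. Qed.

Lemma sum_minus (f g : nat -> R) n :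
  (sum_f_R0 (fun k => f k - g k) n = sum_f_R0 f n - sum_f_R0 g n)%R.
Proof. apply minus_sum. Qed.

Lemma ev_parts a z : ev a z =
  (Series (fun n => a n * Re (z ^ n))%R, Series (fun n => a n * Im (z ^ n))%R).
Proof.
  unfold ev, CSeries. f_equal; apply Series_ext; intros n; [apply re_scal_l|apply im_scal_l].
Qed.

Lemma ex_series_abs_part (a : fps) z (f : C -> R) : (forall w, (Rabs (f w) <= Cmod w)%R) ->
  good a -> (Cmod z < 1)%R -> ex_series (fun n => Rabs (a n * f (z ^ n))).
Proof.
  intros Hf Ha Hz.
  apply (ex_series_le (V := R_CompleteNormedModule)) with (fun n => Rabs (a n) * Cmod z ^ n)%R.
  - intros n. change (norm (Rabs (a n * f (z ^ n)))) with (Rabs (Rabs (a n * f (z ^ n)))).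
    rewrite Rabs_Rabsolu, Rabs_mult, <- Cmod_pow.
    apply Rmult_le_compat_l; [apply Rabs_pos|apply Hf].
  - apply Ha; split; [apply Cmod_ge_0|exact Hz].
Qed.

Lemma ev_mul a b z : good a -> good b -> (Cmod z < 1)%R -> ev (fmul a b) z = ev a z * ev b z.
Proof.
  intros Ha Hb Hz.
  pose proof (ex_series_abs_part a z Re re_le_Cmod Ha Hz) as A1.
  pose proof (ex_series_abs_part a z Im im_le_Cmod Ha Hz) as A2.
  pose proof (ex_series_abs_part b z Re re_le_Cmod Hb Hz) as B1.
  pose proof (ex_series_abs_part b z Im im_le_Cmod Hb Hz) as B2.
  pose proof (Series_correct _ (ex_series_Rabs _ A1)) as SA1.
  pose proof (Series_correct _ (ex_series_Rabs _ A2)) as SA2.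
  pose proof (Series_correct _ (ex_series_Rabs _ B1)) as SB1.
  pose proof (Series_correct _ (ex_series_Rabs _ B2)) as SB2.
  (* The Cauchy product theorem is applied over the reals, to the four products of real and
     imaginary parts. *)
  rewrite !ev_parts. unfold Cmult; cbn [fst snd]. f_equal; apply is_series_unique.
  - pose proof (is_series_minus _ _ _ _ (is_series_mult _ _ _ _ SA1 SB1 A1 B1)
                  (is_series_mult _ _ _ _ SA2 SB2 A2 B2)) as H.
    eapply is_series_ext; [|exact H]. intros n. unfold plus, opp, minus; simpl.
    unfold fmul; rewrite conv_sum.
    unfold plus, opp; simpl.
    match goal with |- (?x + - ?y = _)%R => change (x - y = sum_f_R0 (fun k => a k * b (n - k)%nat)%R n * Re (z ^ n))%R end.
    rewrite <- sum_minus, Rmult_comm, scal_sum. apply sum_eq; intros k Hk.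
    replace (z ^ n) with (z ^ k * z ^ (n - k)) by (rewrite <- Cpow_add_r; f_equal; lia).
    rewrite re_mult. ring.
  - pose proof (is_series_plus _ _ _ _ (is_series_mult _ _ _ _ SA1 SB2 A1 B2)
                  (is_series_mult _ _ _ _ SA2 SB1 A2 B1)) as H.
    eapply is_series_ext; [|exact H]. intros n. unfold plus; simpl.
    unfold fmul; rewrite conv_sum.
    match goal with |- (?x + ?y = _)%R => change (x + y = sum_f_R0 (fun k => a k * b (n - k)%nat)%R n * Im (z ^ n))%R end.
    rewrite <- plus_sum, Rmult_comm, scal_sum. apply sum_eq; intros k Hk.
    replace (z ^ n) with (z ^ k * z ^ (n - k)) by (rewrite <- Cpow_add_r; f_equal; lia).
    rewrite im_mult. ring.
Qed.

Lemma ex_series_bounded (b : nat -> R) (M : R) :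
  (forall n, (0 <= b n)%R) -> (forall n, (sum_n b n <= M)%R) -> ex_series b.
Proof.
  intros H HM. destruct (ex_finite_lim_seq_incr (sum_n b) M) as [l Hl].
  - intros n; rewrite sum_Sn. unfold plus; simpl. specialize (H (S n)); lra.
  - exact HM.
  - exists l; exact Hl.
Qed.

Lemma sum_n_le_mono (b : nat -> R) n m :
  (forall k, (0 <= b k)%R) -> (n <= m)%nat -> (sum_n b n <= sum_n b m)%R.
Proof.
  intros H Hnm; induction Hnm as [|m Hm IH]; [apply Rle_refl|].
  rewrite sum_Sn. unfold plus; simpl. specialize (H (S m)); lra.
Qed.

Lemma sum_n_dbl (a : fps) (r : R) n :
  sum_n (fun k => (Rabs (dbl a k) * r ^ k)%R) (2 * n) =
  sum_n (fun k => (Rabs (a k) * (r ^ 2) ^ k)%R) n.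
Proof.
  induction n as [|n IH]; [rewrite !sum_O; reflexivity|].
  replace (2 * S n)%nat with (S (S (2 * n))) by lia.
  rewrite !sum_Sn, IH, dbl_odd, Rabs_R0, Rmult_0_l. unfold plus; simpl Rplus.
  replace (S (S (2 * n))) with (2 * S n)%nat by lia. rewrite dbl_double, pow_mult.
  unfold AbelianMonoid.sort; simpl. ring.
Qed.

Lemma pow2_lt1 (r : R) : (0 <= r < 1)%R -> (0 <= r ^ 2 < 1)%R.
Proof. intros H; nra. Qed.

Lemma good_dbl a : good a -> good (dbl a).
Proof.
  intros Ha r Hr.
  assert (Hp : forall (c : fps) (s : R), (0 <= s)%R -> forall k, (0 <= Rabs (c k) * s ^ k)%R).
  { intros c s Hs k; apply Rmult_le_pos; [apply Rabs_pos|apply pow_le, Hs]. }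
  apply ex_series_bounded with (Series (fun k => (Rabs (a k) * (r ^ 2) ^ k)%R)).
  - apply Hp, Hr.
  - intros n. apply Rle_trans with (sum_n (fun k => (Rabs (dbl a k) * r ^ k)%R) (2 * n)).
    + apply sum_n_le_mono; [apply Hp, Hr|lia].
    + rewrite sum_n_dbl. apply sum_n_le_Series; [apply Hp, pow2_lt1, Hr|apply Ha, pow2_lt1, Hr].
Qed.

Lemma Cmod_sqr_lt1 z : (Cmod z < 1)%R -> (Cmod (z ^ 2) < 1)%R.
Proof. intros H. rewrite Cmod_pow. apply pow2_lt1. split; [apply Cmod_ge_0|exact H]. Qed.

Lemma ev_dbl a z : good a -> (Cmod z < 1)%R -> ev (dbl a) z = ev a (z ^ 2).
Proof.
  intros Ha Hz.
  apply Clim_unique with (fun n => csum (fun k => RtoC (dbl a k) * z ^ k) (2 * n)).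
  - apply (Clim_subseq (csum _) _ (fun n => 2 * n)%nat); [intros; lia|].
    apply ev_Clim; [apply good_dbl, Ha|exact Hz].
  - apply Clim_ext with (2 := ev_Clim a _ Ha (Cmod_sqr_lt1 z Hz)).
    intros n; induction n as [|n IH]; [reflexivity|].
    replace (2 * S n)%nat with (S (S (2 * n))) by lia. cbn [csum].
    rewrite <- IH, dbl_odd, dbl_double, <- Cpow_mult_r. cbn [csum]. ring.
Qed.

(** Dominated convergence: [a] and [u N] agree up to degree [N], so their values differ by at most
    twice the tail of the majorant beyond [N]. *)
Lemma ev_dominated (u : nat -> fps) (a b : fps) z :
  good b -> (forall N n, (Rabs (u N n) <= b n)%R) -> (forall N, eqm (S N) a (u N)) ->
  (Cmod z < 1)%R -> Clim (fun N => ev (u N) z) (ev a z).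
Proof.
  intros Hb Hu Ha Hz.
  assert (Hab : forall n, (Rabs (a n) <= b n)%R) by (intros n; rewrite (Ha n n) by lia; apply Hu).
  assert (Hb0 : forall n, (0 <= b n)%R) by (intros n; apply Rle_trans with (2 := Hab n), Rabs_pos).
  assert (Hr : (0 <= Cmod z < 1)%R) by (split; [apply Cmod_ge_0|exact Hz]).
  set (b' := fun n => (Rabs (b n) * Cmod z ^ n)%R).
  assert (Hb' : ex_series b') by (apply Hb, Hr).
  assert (Hb'0 : forall n, (0 <= b' n)%R).
  { intros n; apply Rmult_le_pos; [apply Rabs_pos|apply pow_le, Hr]. }
  assert (T : is_lim_seq (fun N => 2 * (Series b' - sum_n b' N))%R 0%R).
  { apply lim0_scal. replace (Finite 0) with (Finite (Series b' - Series b')) by (f_equal; ring).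
    apply is_lim_seq_minus'; [apply is_lim_seq_const|]. apply Series_correct, Hb'. }
  generalize T; apply lim0_le. intros N; split; [apply Cmod_ge_0|].
  assert (G1 : good (u N)) by (apply good_le with b; auto).
  assert (G2 : good a) by (apply good_le with b; auto).
  rewrite <- ev_sub by assumption.
  apply Clim_Cmod_le with (2 := ev_Clim _ z (good_sub _ _ G1 G2) Hz).
  set (f := fun k => RtoC (fsub (u N) a k) * z ^ k).
  assert (Hf0 : forall k, (k <= N)%nat -> f k = 0).
  { intros k Hk; unfold f, fsub. rewrite (Ha N k) by lia. rewrite Rminus_diag. ring. }
  assert (Hf : forall k, (Cmod (f k) <= 2 * b' k)%R).
  { intros k; unfold f. rewrite Cmod_mult, Cmod_R, Cmod_pow. unfold b'.
    rewrite <- Rmult_assoc. apply Rmult_le_compat_r; [apply pow_le, Hr|].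
    unfold fsub. unfold Rminus. eapply Rle_trans; [apply Rabs_triang|].
    rewrite Rabs_Ropp, (Rabs_right (b k)) by (apply Rle_ge, Hb0).
    specialize (Hu N k); specialize (Hab k); lra. }
  assert (K : forall m, (Cmod (csum f (S N + m)) <= 2 * (sum_n b' (N + m) - sum_n b' N))%R).
  { induction m as [|m IH].
    - rewrite !Nat.add_0_r, (csum_zero_prefix f), Cmod_0 by (intros; apply Hf0; lia). lra.
    - rewrite Nat.add_succ_r. cbn [csum]. eapply Rle_trans; [apply Cmod_triangle|].
      apply Rle_trans with (2 * (sum_n b' (N + m) - sum_n b' N) + 2 * b' (S N + m)%nat)%R.
      + apply Rplus_le_compat; [exact IH|apply Hf].
      + rewrite Nat.add_succ_r, sum_Sn.
        change (plus (sum_n b' (N + m)) (b' (S (N + m)))) with (sum_n b' (N + m) + b' (S N + m)%nat)%R.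
        apply Req_le; ring. }
  intros n. destruct (le_lt_dec (S N) n) as [H|H].
  - replace n with (S N + (n - S N))%nat by lia. eapply Rle_trans; [apply K|].
    pose proof (sum_n_le_Series b' (N + (n - S N)) Hb'0 Hb'). lra.
  - rewrite (csum_zero_prefix f), Cmod_0 by (intros; apply Hf0; lia).
    pose proof (sum_n_le_Series b' N Hb'0 Hb'). lra.
Qed.

(** * Majorants for the coefficients of the theta and divisor series *)

Definition ones : fps := fun _ => 1%R.

Lemma good_ones : good ones.
Proof.
  intros r Hr. apply ex_series_ext with (fun n => r ^ n)%R.
  - intros n; unfold ones; rewrite Rabs_R1, Rmult_1_l; reflexivity.
  - apply ex_series_geom. rewrite Rabs_right; lra.
Qed.

Lemma good_linear : good (fun n => INR (S n)).
Proof.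
  replace (fun n => INR (S n)) with (fmul ones ones); [apply good_mul; apply good_ones|].
  apply functional_extensionality; intros n. unfold fmul.
  induction n as [|n IH]; [unfold ones; simpl; ring|].
  cbn [conv]. change (ftail ones) with ones. rewrite IH. unfold ones. rewrite (S_INR (S n)). ring.
Qed.

Lemma good_quadratic : good (fun n => (INR n * INR n)%R).
Proof.
  apply good_le with (fmul (fun n => INR (S n)) (fun n => INR (S n)));
    [apply good_mul; apply good_linear|].
  (* The induction needs the offset [a], because the tail of [a + (m + 1)] is
     [(a + 1) + (m + 1)]. *)
  cut (forall n a, (0 <= a)%R -> (a * INR (S n) + INR n * INR n <= conv (fun m => a + INR (S m)) (fun m => INR (S m)) n)%R).
  { intros H n. rewrite Rabs_right.
    - specialize (H n 0%R (Rle_refl _)). unfold fmul.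
      replace (fun m : nat => (0 + INR (S m))%R) with (fun m : nat => INR (S m)) in H
        by (apply functional_extensionality; intros; ring). lra.
    - apply Rle_ge, Rmult_le_pos; apply pos_INR. }
  induction n as [|n IH]; intros a Ha; [simpl; lra|].
  cbn [conv]. replace (ftail (fun m => (a + INR (S m))%R)) with (fun m => ((a + 1) + INR (S m))%R).
  2: { apply functional_extensionality; intros m; unfold ftail. rewrite (S_INR (S m)). ring. }
  specialize (IH (a + 1)%R ltac:(lra)). rewrite !S_INR in *. simpl (INR 0) in *.
  pose proof (pos_INR n). nra.
Qed.

Lemma mono_bounds k n : (0 <= mono k n <= 1)%R.
Proof. unfold mono; destruct (Nat.eqb n k); lra. Qed.

Lemma phi_trunc_bound N n : (0 <= phi_trunc N n <= 2 * INR N + 1)%R.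
Proof.
  unfold phi_trunc. induction N as [|N IH]; cbn [fwsum].
  - pose proof (mono_bounds 0 n). simpl (INR 0). unfold msq. simpl Z.to_nat. lra.
  - unfold fadd at 1 2. unfold fadd, msq. rewrite S_INR.
    match goal with |- context [mono ?a n] => pose proof (mono_bounds a n) end.
    match goal with |- context [(_ + mono ?a n)%R] => pose proof (mono_bounds a n) end.
    unfold msq in *. lra.
Qed.

Lemma psi_trunc_bound N n : (0 <= psi_trunc N n <= INR N + 1)%R.
Proof.
  induction N as [|N IH]; cbn [psi_trunc].
  - pose proof (mono_bounds 0 n). rewrite mono_0 in H. simpl (INR 0). lra.
  - unfold fadd. rewrite S_INR. pose proof (mono_bounds (S N * (S N + 1) / 2) n). lra.
Qed.

(** The coefficient of [q^n] is stationary from [N = n] on, so the crude bound by the number of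
    terms is needed only for the window [min(N, n)]; this makes it uniform in [N]. *)
Lemma phi_trunc_dom N n : (Rabs (phi_trunc N n) <= 2 * INR (S n))%R.
Proof.
  rewrite Rabs_right by (apply Rle_ge, phi_trunc_bound). rewrite S_INR.
  destruct (le_lt_dec n N) as [H|H].
  - rewrite <- (phi_eqm N n) by lia. rewrite (phi_eqm n n) by lia.
    pose proof (phi_trunc_bound n n). lra.
  - apply lt_INR in H. pose proof (phi_trunc_bound N n). lra.
Qed.

Lemma psi_trunc_dom N n : (Rabs (psi_trunc N n) <= INR (S n))%R.
Proof.
  rewrite Rabs_right by (apply Rle_ge, psi_trunc_bound). rewrite S_INR.
  destruct (le_lt_dec n N) as [H|H].
  - rewrite <- (psi_eqm N n) by lia. rewrite (psi_eqm n n) by lia.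
    pose proof (psi_trunc_bound n n). lra.
  - apply lt_INR in H. pose proof (psi_trunc_bound N n). lra.
Qed.

Lemma good_2linear : good (fun n => (2 * INR (S n))%R).
Proof.
  replace (fun n => (2 * INR (S n))%R) with (fadd (fun n => INR (S n)) (fun n => INR (S n))).
  - apply good_add; apply good_linear.
  - apply functional_extensionality; intros n; unfold fadd; ring.
Qed.

Lemma good_phi : good phi.
Proof. apply good_le with (1 := good_2linear). intros n; apply phi_trunc_dom. Qed.

Lemma good_psi : good psi.
Proof. apply good_le with (1 := good_linear). intros n; apply psi_trunc_dom. Qed.

Lemma good_sigf : good sigf.
Proof.
  apply good_le with (1 := good_quadratic). intros n. unfold sigf.
  rewrite Rabs_right by (apply Rle_ge, pos_INR). rewrite <- mult_INR. apply le_INR.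
  unfold sigma1.
  assert (H : forall m f, (list_sum (filter f (seq 1 m)) <= m * m)%nat).
  { induction m as [|m IH]; intros f; [simpl; lia|].
    rewrite seq_S, filter_app, list_sum_app. specialize (IH f).
    cbn [filter]. change (1 + m)%nat with (S m). destruct (f (S m)); simpl list_sum; lia. }
  apply H.
Qed.

(** * The infinite product *)

(** Has nonnegative coefficients and majorises the partial products of Euler's product
    coefficientwise. *)
Definition Q_trunc : nat -> fps := fprod (fun i => fadd (fconst 1) (mono (S i))).
Definition Qf := flim Q_trunc.

Lemma Q_trunc_coef N n : Q_trunc (S N) n = (Q_trunc N n + fmul (mono (S N)) (Q_trunc N) n)%R.
Proof.
  change (Q_trunc (S N)) with (fmul (Q_trunc N) (fadd (fconst 1) (mono (S N)))).
  replace (fmul (Q_trunc N) (fadd (fconst 1) (mono (S N))))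
    with (fadd (Q_trunc N) (fmul (mono (S N)) (Q_trunc N))) by ring.
  reflexivity.
Qed.

Lemma P_trunc_coef N n : P_trunc (S N) n = (P_trunc N n - fmul (mono (S N)) (P_trunc N) n)%R.
Proof.
  change (P_trunc (S N)) with (fmul (P_trunc N) (fsub (fconst 1) (mono (S N)))).
  replace (fmul (P_trunc N) (fsub (fconst 1) (mono (S N))))
    with (fsub (P_trunc N) (fmul (mono (S N)) (P_trunc N))) by ring.
  reflexivity.
Qed.

Lemma mono_mul_case k (a : fps) n :
  fmul (mono k) a n = if le_lt_dec k n then a (n - k)%nat else 0%R.
Proof.
  destruct (le_lt_dec k n) as [H|H]; [|apply mono_mul_low, H].
  replace n with (k + (n - k))%nat at 1 by lia. apply mono_mul_add.
Qed.

Lemma Q_trunc_pos N n : (0 <= Q_trunc N n)%R.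
Proof.
  revert n; induction N as [|N IH]; intros n.
  - change (Q_trunc 0) with (fconst 1). destruct n; simpl; lra.
  - rewrite Q_trunc_coef, mono_mul_case. destruct le_lt_dec; [|specialize (IH n); lra].
    pose proof (IH n). pose proof (IH (n - S N)%nat). lra.
Qed.

Lemma P_trunc_le_Q N n : (Rabs (P_trunc N n) <= Q_trunc N n)%R.
Proof.
  revert n; induction N as [|N IH]; intros n.
  - change (Q_trunc 0) with (fconst 1). change (P_trunc 0) with (fconst 1).
    rewrite Rabs_right; [lra|]. destruct n; simpl; lra.
  - rewrite Q_trunc_coef, P_trunc_coef, !mono_mul_case.
    unfold Rminus. eapply Rle_trans; [apply Rabs_triang|]. rewrite Rabs_Ropp.
    apply Rplus_le_compat; [apply IH|]. destruct le_lt_dec; [apply IH|rewrite Rabs_R0; lra].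
Qed.

Lemma Q_eqm N : eqm (S N) Qf (Q_trunc N).
Proof.
  apply flim_eqm; clear N; intros N n Hn.
  rewrite Q_trunc_coef, mono_mul_low by lia. ring.
Qed.

Lemma Q_trunc_mono N M n : (N <= M)%nat -> (Q_trunc N n <= Q_trunc M n)%R.
Proof.
  intros H; induction H as [|M H IH]; [lra|].
  rewrite Q_trunc_coef, mono_mul_case. destruct le_lt_dec; [|lra].
  pose proof (Q_trunc_pos M (n - S M)). lra.
Qed.

Lemma Q_trunc_le N n : (Q_trunc N n <= Qf n)%R.
Proof.
  apply Rle_trans with (Q_trunc (N + n) n); [apply Q_trunc_mono; lia|].
  rewrite <- (Q_eqm (N + n) n) by lia. lra.
Qed.

Lemma fprod_good f N : (forall i, good (f i)) -> good (fprod f N).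
Proof.
  intros H; induction N as [|N IH]; [apply good_const|]. apply good_mul; auto.
Qed.

Lemma ev_fprod f N z : (forall i, good (f i)) -> (Cmod z < 1)%R ->
  ev (fprod f N) z = Cprod (fun i => ev (f i) z) N.
Proof.
  intros H Hz; induction N as [|N IH]; [apply ev_1|].
  cbn [fprod Cprod]. rewrite ev_mul, IH; auto. apply fprod_good, H.
Qed.

Lemma ev_P_trunc N z : (Cmod z < 1)%R -> ev (P_trunc N) z = Cprod (fun n => 1 - z ^ S n) N.
Proof.
  intros Hz. unfold P_trunc. rewrite ev_fprod; [|intros; apply good_sub; [apply good_const|apply good_mono]|exact Hz].
  induction N as [|N IH]; [reflexivity|]. cbn [Cprod].
  rewrite IH, ev_sub, ev_1, ev_mono; auto using good_const, good_mono.
Qed.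

Lemma exp_le (x y : R) : (x <= y)%R -> (exp x <= exp y)%R.
Proof. intros [H| ->]; [left; apply exp_increasing, H|apply Rle_refl]. Qed.

Lemma geom_sum_le (r : R) N : (0 <= r < 1)%R -> (sum_f_R0 (fun i => r ^ i) N <= / (1 - r))%R.
Proof.
  intros Hr. rewrite tech3 by lra. unfold Rdiv.
  rewrite <- (Rmult_1_l (/ (1 - r))) at 2. apply Rmult_le_compat_r.
  - left; apply Rinv_0_lt_compat; lra.
  - pose proof (pow_le r (S N) (proj1 Hr)). lra.
Qed.

(** [1 + r^(i+1) <= exp(r^i)] turns the product into the exponential of a geometric sum, a bound
    that does not depend on [N]. *)
Lemma Q_trunc_ev_le N (r : R) : (0 <= r < 1)%R ->
  (Series (fun n => Q_trunc N n * r ^ n) <= exp (/ (1 - r)))%R.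
Proof.
  intros Hr.
  assert (Hz : (Cmod r < 1)%R) by (rewrite Cmod_R, Rabs_right; lra).
  assert (Hg : forall i, good (fadd (fconst 1) (mono (S i))))
    by (intros; apply good_add; [apply good_const|apply good_mono]).
  assert (E : ev (Q_trunc N) r = RtoC (Series (fun n => Q_trunc N n * r ^ n)%R)).
  { rewrite ev_parts. apply injective_projections; cbn [fst snd RtoC].
    - apply Series_ext; intros n. rewrite <- RtoC_pow. reflexivity.
    - rewrite (Series_ext _ (fun _ => (0 * 0)%R)); [rewrite Series_scal_l; ring|].
      intros n. rewrite <- RtoC_pow. simpl. ring. }
  assert (B : exists y : R, ev (Q_trunc N) r = RtoC y /\ (0 <= y)%R /\
     (y <= exp (match N with O => 0 | S m => sum_f_R0 (fun i => r ^ i) m end))%R).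
  { clear E. unfold Q_trunc. rewrite ev_fprod by assumption. induction N as [|N [y [E [H0 H1]]]].
    - exists 1%R. simpl. rewrite exp_0. split; [reflexivity|lra].
    - exists (y * (1 + r ^ S N))%R. cbn [Cprod].
      rewrite E, ev_add, ev_1, ev_mono, RtoC_mult, RtoC_plus, RtoC_pow;
        auto using good_const, good_mono.
      pose proof (pow_le r N (proj1 Hr)) as Hp. pose proof (pow_le r (S N) (proj1 Hr)) as Hp'.
      assert (Hp2 : (r ^ S N <= r ^ N)%R) by (simpl; nra).
      split; [reflexivity|]. split; [apply Rmult_le_pos; lra|].
      assert (K : (1 + r ^ S N <= exp (r ^ N))%R) by (pose proof (exp_ineq1_le (r ^ N)); lra).
      replace (sum_f_R0 (fun i => r ^ i)%R N)
        with (match N with O => 0 | S m => sum_f_R0 (fun i => r ^ i) m end + r ^ N)%R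
        by (destruct N; simpl; ring).
      rewrite exp_plus. apply Rmult_le_compat; lra. }
  destruct B as [y [E' [_ Hy]]]. rewrite E in E'. apply RtoC_inj in E'. rewrite E'.
  apply Rle_trans with (1 := Hy). apply exp_le.
  destruct N; [left; apply Rinv_0_lt_compat; lra|apply geom_sum_le, Hr].
Qed.

Lemma good_Q : good Qf.
Proof.
  intros r Hr. apply ex_series_bounded with (exp (/ (1 - r))).
  - intros n; apply Rmult_le_pos; [apply Rabs_pos|apply pow_le, Hr].
  - intros n.
    assert (E : sum_n (fun k => (Rabs (Qf k) * r ^ k)%R) n = sum_n (fun k => (Q_trunc n k * r ^ k)%R) n).
    { apply sum_n_ext_loc; intros k Hk. rewrite (Q_eqm n k) by lia.
      rewrite Rabs_right by (apply Rle_ge, Q_trunc_pos). reflexivity. }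
    rewrite E. eapply Rle_trans; [|apply (Q_trunc_ev_le n), Hr].
    apply sum_n_le_Series.
    + intros k; apply Rmult_le_pos; [apply Q_trunc_pos|apply pow_le, Hr].
    + assert (G : good (Q_trunc n)).
      { apply fprod_good; intros; apply good_add; [apply good_const|apply good_mono]. }
      apply ex_series_ext with (2 := G r Hr). intros k.
      rewrite Rabs_right by (apply Rle_ge, Q_trunc_pos). reflexivity.
Qed.

Lemma P_trunc_dom N n : (Rabs (P_trunc N n) <= Qf n)%R.
Proof. apply Rle_trans with (Q_trunc N n); [apply P_trunc_le_Q|apply Q_trunc_le]. Qed.

Lemma good_P : good Pf.
Proof. apply good_le with (1 := good_Q). intros n; apply P_trunc_dom. Qed.

Lemma P_product z : (Cmod z < 1)%R -> Clim (Cprod (fun n => 1 - z ^ S n)) (ev Pf z).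
Proof.
  intros Hz. apply Clim_ext with (fun N => ev (P_trunc N) z); [intros; apply ev_P_trunc, Hz|].
  apply ev_dominated with Qf; [apply good_Q|apply P_trunc_dom|apply P_eqm|exact Hz].
Qed.

Lemma one_minus_exp (r x : R) : (0 <= x <= r)%R -> (r < 1)%R -> (exp (- (x / (1 - r))) <= 1 - x)%R.
Proof.
  intros Hx Hr.
  assert (H1 : (x / (1 - x) <= x / (1 - r))%R).
  { apply Rmult_le_compat_l; [lra|]. apply Rinv_le_contravar; lra. }
  apply Rle_trans with (exp (- (x / (1 - x)))); [apply exp_le; lra|].
  rewrite exp_Ropp. pose proof (exp_ineq1_le (x / (1 - x))) as H.
  replace (1 + x / (1 - x))%R with (/ (1 - x))%R in H by (field; lra).
  replace (1 - x)%R with (/ / (1 - x))%R at 2 by (apply Rinv_inv).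
  apply Rinv_le_contravar; [apply Rinv_0_lt_compat; lra|exact H].
Qed.

(** [|1 - z^n| >= 1 - r^n >= exp(- r^n/(1 - r))], and the exponents again add up to a geometric
    series. Uniformity in [N] keeps the infinite product away from 0, which is needed to divide by
    [eta (2 tau)]. *)
Lemma Cprod_lower z N : (Cmod z < 1)%R ->
  (exp (- (/ (1 - Cmod z) / (1 - Cmod z))) <= Cmod (Cprod (fun n => 1 - z ^ S n)%C N))%R.
Proof.
  intros Hz. set (r := Cmod z) in *. assert (Hr : (0 <= r < 1)%R) by (split; [apply Cmod_ge_0|exact Hz]).
  assert (Hi : (0 < / (1 - r))%R) by (apply Rinv_0_lt_compat; lra).
  apply Rle_trans with
    (exp (- (match N with O => 0 | S m => sum_f_R0 (fun i => r ^ i) m end / (1 - r)))%R).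
  { apply exp_le, Ropp_le_contravar, Rmult_le_compat_r; [lra|].
    destruct N; [lra|apply geom_sum_le, Hr]. }
  induction N as [|N IH].
  - simpl. rewrite Cmod_1. unfold Rdiv. rewrite Rmult_0_l, Ropp_0, exp_0; lra.
  - cbn [Cprod]. rewrite Cmod_mult.
    replace (sum_f_R0 (fun i => r ^ i)%R N)
        with (match N with O => 0 | S m => sum_f_R0 (fun i => r ^ i) m end + r ^ N)%R
        by (destruct N; simpl; ring).
    rewrite Rdiv_plus_distr, Ropp_plus_distr, exp_plus.
    apply Rmult_le_compat; [left; apply exp_pos|left; apply exp_pos|exact IH|].
    pose proof (pow_le r N (proj1 Hr)) as Hp. pose proof (pow_le r (S N) (proj1 Hr)) as Hp'.
    assert (Hp2 : (r ^ S N <= r ^ N)%R) by (simpl; nra).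
    assert (Hp3 : (r ^ S N <= r)%R).
    { simpl. rewrite <- (Rmult_1_r r) at 3. apply Rmult_le_compat_l; [lra|].
      rewrite <- (pow1 N). apply pow_incr; lra. }
    apply Rle_trans with (exp (- (r ^ S N / (1 - r)))).
    + apply exp_le, Ropp_le_contravar, Rmult_le_compat_r; lra.
    + eapply Rle_trans; [apply one_minus_exp; [split; [exact Hp'|exact Hp3]|lra]|].
      pose proof (Cmod_triangle (1 - z ^ S N)%C (z ^ S N)%C) as T.
      replace ((1 - z ^ S N) + z ^ S N)%C with (RtoC 1) in T by ring.
      rewrite Cmod_1, Cmod_pow in T. fold r in T. lra.
Qed.

Lemma P_neq0 z : (Cmod z < 1)%R -> ev Pf z <> 0.
Proof.
  intros Hz E. pose proof (P_product z Hz) as H. rewrite E in H. unfold Clim in H.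
  set (c := exp (- (/ (1 - Cmod z) / (1 - Cmod z)))).
  assert (L : Rbar_le c 0%R).
  { refine (is_lim_seq_le (fun _ => c) _ c 0%R _ (is_lim_seq_const c) H).
    intros n. replace (Cprod (fun n0 => 1 - z ^ S n0) n - 0)%C with (Cprod (fun n0 => 1 - z ^ S n0) n) by ring.
    apply Cprod_lower, Hz. }
  simpl in L. pose proof (exp_pos (- (/ (1 - Cmod z) / (1 - Cmod z)))). unfold c in L. lra.
Qed.

(** * Sums over the integers *)

Fixpoint zsum (f : Z -> C) (M : nat) : C :=
  match M with
  | O => f 0%Z
  | S m => zsum f m + (f (Z.of_nat (S m)) + f (- Z.of_nat (S m))%Z)
  end.

Lemma zsum_csum f M :
  zsum f M = csum (fun n => f (Z.of_nat n)) (S M) + csum (fun n => f (- Z.of_nat (S n))%Z) M.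
Proof.
  induction M as [|M IH]; [simpl; ring|]. cbn [zsum]. rewrite IH. cbn [csum]. ring.
Qed.

Lemma ZSeries_Clim f (b : nat -> R) :
  (forall n, (Cmod (f (Z.of_nat n)) <= b n)%R) ->
  (forall n, (Cmod (f (- Z.of_nat n)%Z) <= b n)%R) -> ex_series b ->
  Clim (zsum f) (ZSeries f).
Proof.
  intros H1 H2 Hb. unfold ZSeries.
  apply Clim_ext with (fun M => csum (fun n => f (Z.of_nat n)) (S M) + csum (fun n => f (- Z.of_nat (S n))%Z) M).
  { intros M; symmetry; apply zsum_csum. }
  apply Clim_plus.
  - apply (Clim_subseq (csum _) _ S); [lia|]. apply CSeries_Clim with b; assumption.
  - apply CSeries_Clim with (fun n => b (S n)); [intros; apply H2|].
    apply (ex_series_incr_1 (V := R_NormedModule) b), Hb.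
Qed.

Lemma good_msq k : good (msq k).
Proof. apply good_mono. Qed.

Lemma good_fwsum f M : (forall k, good (f k)) -> good (fwsum f M).
Proof.
  intros H; induction M as [|M IH]; [apply H|]. apply good_add; [exact IH|apply good_add; apply H].
Qed.

Lemma ev_phi_trunc N z : (Cmod z < 1)%R ->
  ev (phi_trunc N) z = zsum (fun k => z ^ Z.to_nat (k ^ 2)) N.
Proof.
  intros Hz. unfold phi_trunc. induction N as [|N IH]; cbn [fwsum zsum].
  - unfold msq. rewrite ev_mono. reflexivity.
  - rewrite !ev_add, IH; auto using good_fwsum, good_msq, good_add.
    unfold msq. rewrite !ev_mono, !Z.pow_2_r. reflexivity.
Qed.

Lemma ev_phi z : (Cmod z < 1)%R -> ev phi z = ZSeries (fun k => z ^ Z.to_nat (k ^ 2)).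
Proof.
  intros Hz. apply Clim_unique with (zsum (fun k => z ^ Z.to_nat (k ^ 2))).
  - apply Clim_ext with (fun N => ev (phi_trunc N) z); [intros; apply ev_phi_trunc, Hz|].
    apply ev_dominated with (fun n => (2 * INR (S n))%R);
      [apply good_2linear|apply phi_trunc_dom|apply phi_eqm|exact Hz].
  - assert (K : forall n, (Cmod z ^ Z.to_nat (Z.of_nat n ^ 2) <= Cmod z ^ n)%R).
    { intros n. rewrite Z.pow_2_r, <- Nat2Z.inj_mul, Nat2Z.id.
      replace (n * n)%nat with (n + (n * n - n))%nat by nia. rewrite pow_add.
      rewrite <- (Rmult_1_r (Cmod z ^ n)) at 2.
      pose proof (Cmod_ge_0 z).
      apply Rmult_le_compat_l; [apply pow_le; assumption|].
      rewrite <- (pow1 (n * n - n)). apply pow_incr; lra. }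
    apply ZSeries_Clim with (fun n => (Cmod z ^ n)%R).
    + intros n; rewrite Cmod_pow; apply K.
    + intros n; rewrite Cmod_pow, Z.pow_opp_even by (exists 1%Z; reflexivity). apply K.
    + apply ex_series_geom. rewrite Rabs_right by (apply Rle_ge, Cmod_ge_0). exact Hz.
Qed.

(** * The complex exponential *)

Lemma Cexp_plus a b : Cexp (a + b) = Cexp a * Cexp b.
Proof.
  unfold Cexp. rewrite re_plus, Im_plus, exp_plus, cos_plus, sin_plus.
  unfold Cmult; cbn [fst snd]. f_equal; ring.
Qed.

Lemma Cexp_0 : Cexp 0 = 1.
Proof. unfold Cexp; simpl. rewrite exp_0, cos_0, sin_0. unfold RtoC; f_equal; ring. Qed.

Lemma Cmod_Cexp z : Cmod (Cexp z) = exp (Re z).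
Proof.
  unfold Cexp, Cmod; cbn [fst snd].
  replace ((exp (Re z) * cos (Im z)) ^ 2 + (exp (Re z) * sin (Im z)) ^ 2)%R
    with (exp (Re z) ^ 2 * ((sin (Im z))² + (cos (Im z))²))%R by (unfold Rsqr; ring).
  rewrite sin2_cos2, Rmult_1_r. apply sqrt_pow2. left; apply exp_pos.
Qed.

Lemma Cexp_neq0 z : Cexp z <> 0.
Proof. apply Cmod_gt_0. rewrite Cmod_Cexp. apply exp_pos. Qed.

Lemma Cexp_opp_l z : Cexp (- z) * Cexp z = 1.
Proof. rewrite <- Cexp_plus. replace (- z + z) with (RtoC 0) by ring. apply Cexp_0. Qed.

Lemma Cexp_nat n z : Cexp (INR n * z) = Cexp z ^ n.
Proof.
  induction n as [|n IH].
  - simpl INR. rewrite Cmult_0_l. apply Cexp_0.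
  - rewrite S_INR, RtoC_plus, Cmult_plus_distr_r, Cexp_plus, IH, Cmult_1_l. simpl. ring.
Qed.

Lemma Cexp_2PI_nat n : Cexp (2 * PI * Ci * INR n) = 1.
Proof.
  replace (2 * PI * Ci * INR n) with (INR n * (2 * PI * Ci)) by ring. rewrite Cexp_nat.
  replace (Cexp (2 * PI * Ci)) with (RtoC 1); [apply Cpow_1_l|].
  unfold Cexp. replace (Re (2 * PI * Ci)) with 0%R by (simpl; ring).
  replace (Im (2 * PI * Ci)) with (2 * PI)%R by (simpl; ring).
  rewrite exp_0, cos_2PI, sin_2PI. unfold RtoC; f_equal; ring.
Qed.

Lemma Cexp_2PI_Z k : Cexp (2 * PI * Ci * IZR k) = 1.
Proof.
  destruct (Z_le_gt_dec 0 k).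
  - rewrite <- (Z2Nat.id k) by assumption. rewrite <- INR_IZR_INZ. apply Cexp_2PI_nat.
  - assert (H : Cexp (2 * PI * Ci * IZR (- k)) = 1).
    { rewrite <- (Z2Nat.id (- k)) by lia. rewrite <- INR_IZR_INZ. apply Cexp_2PI_nat. }
    rewrite <- (Cmult_1_r (Cexp _)), <- H at 1. rewrite <- Cexp_plus, opp_IZR, RtoC_opp.
    replace (2 * PI * Ci * IZR k + 2 * PI * Ci * - IZR k) with (RtoC 0) by ring. apply Cexp_0.
Qed.

(** Two applications of the mean value theorem: [f 1 = f' c = c * f'' d]. *)
Lemma second_order_bound (f f' f'' : R -> R) (M : R) :
  (forall t, is_derive f t (f' t)) -> (forall t, is_derive f' t (f'' t)) ->
  f 0%R = 0%R -> f' 0%R = 0%R -> (forall t, (0 <= t <= 1)%R -> (Rabs (f'' t) <= M)%R) ->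
  (Rabs (f 1%R) <= M)%R.
Proof.
  intros H1 H2 E0 E1 HM.
  destruct (MVT_gen f 0 1 f') as [c [Hc Ec]].
  { intros; apply H1. }
  { intros x _. apply continuity_pt_filterlim, (ex_derive_continuous f). exists (f' x); apply H1. }
  destruct (MVT_gen f' 0 c f'') as [d [Hd Ed]].
  { intros; apply H2. }
  { intros x _. apply continuity_pt_filterlim, (ex_derive_continuous f'). exists (f'' x); apply H2. }
  rewrite Rmin_left, Rmax_right in Hc by lra. rewrite Rmin_left, Rmax_right in Hd by lra.
  rewrite E0 in Ec. rewrite E1 in Ed.
  replace (f 1%R) with (f'' d * c)%R by lra.
  rewrite Rabs_mult, (Rabs_right c) by lra.
  specialize (HM d ltac:(lra)). pose proof (Rabs_pos (f'' d)). nra.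
Qed.

Lemma trig_comb_bound (A B x : R) : (Rabs (A * cos x + B * sin x) <= Rabs A + Rabs B)%R.
Proof.
  eapply Rle_trans; [apply Rabs_triang|]. rewrite !Rabs_mult.
  assert (Rabs (cos x) <= 1)%R by (apply Rabs_le, COS_bound).
  assert (Rabs (sin x) <= 1)%R by (apply Rabs_le, SIN_bound).
  pose proof (Rabs_pos A). pose proof (Rabs_pos B). nra.
Qed.

Lemma Cexp_taylor z : (Cmod (Cexp z - 1 - z) <= 4 * Cmod z ^ 2 * exp (Cmod z))%R.
Proof.
  set (a := Re z). set (b := Im z). set (m := Cmod z).
  assert (Ha : (Rabs a <= m)%R) by apply re_le_Cmod.
  assert (Hb : (Rabs b <= m)%R) by apply im_le_Cmod.
  assert (Hm : (a * a + b * b = m ^ 2)%R).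
  { unfold m, Cmod. rewrite pow2_sqrt; [unfold a, b, Re, Im; ring|]. nra. }
  (* Real and imaginary part of [z^2], which govern the second derivatives in [t] of the two
     components of [exp(t z)]. *)
  assert (Hab : (Rabs (a * a - b * b) + Rabs (2 * a * b) <= 2 * m ^ 2)%R).
  { rewrite <- Hm. apply Rle_trans with ((a * a + b * b) + (a * a + b * b))%R; [|lra].
    pose proof (Rle_0_sqr a). pose proof (Rle_0_sqr b).
    pose proof (Rle_0_sqr (a + b)). pose proof (Rle_0_sqr (a - b)). unfold Rsqr in *.
    apply Rplus_le_compat; apply Rabs_le; split; lra. }
  assert (He : forall t, (0 <= t <= 1)%R -> (exp (t * a) <= exp m)%R).
  { intros t Ht. apply exp_le. apply Rle_trans with (Rabs (t * a)); [apply Rle_abs|].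
    rewrite Rabs_mult, (Rabs_right t) by lra. pose proof (Rabs_pos a). nra. }
  assert (B1 : (Rabs (Re (Cexp z - 1 - z)) <= 2 * m ^ 2 * exp m)%R).
  { replace (Re (Cexp z - 1 - z)) with ((fun t => exp (t * a) * cos (t * b) - 1 - t * a)%R 1%R).
    2: { rewrite !Re_minus. unfold Cexp. fold a b. simpl. rewrite !Rmult_1_l. reflexivity. }
    apply second_order_bound with (f := fun t => (exp (t * a) * cos (t * b) - 1 - t * a)%R)
      (f' := fun t => (exp (t * a) * (a * cos (t * b) - b * sin (t * b)) - a)%R)
      (f'' := fun t => (exp (t * a) * ((a * a - b * b) * cos (t * b) + (- (2 * a * b)) * sin (t * b)))%R).
    - intros t; auto_derive; [auto|ring].
    - intros t; auto_derive; [auto|ring].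
    - rewrite !Rmult_0_l, exp_0, cos_0; ring.
    - rewrite !Rmult_0_l, exp_0, cos_0, sin_0; ring.
    - intros t Ht. rewrite Rabs_mult, Rabs_right by (apply Rle_ge; left; apply exp_pos).
      rewrite Rmult_comm. apply Rmult_le_compat.
      + apply Rabs_pos.
      + left; apply exp_pos.
      + eapply Rle_trans; [apply trig_comb_bound|]. rewrite Rabs_Ropp; exact Hab.
      + apply He, Ht. }
  assert (B2 : (Rabs (Im (Cexp z - 1 - z)) <= 2 * m ^ 2 * exp m)%R).
  { replace (Im (Cexp z - 1 - z)) with ((fun t => exp (t * a) * sin (t * b) - t * b)%R 1%R).
    2: { rewrite !Im_minus. unfold Cexp. fold a b. simpl. rewrite !Rmult_1_l. ring. }
    apply second_order_bound with (f := fun t => (exp (t * a) * sin (t * b) - t * b)%R)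
      (f' := fun t => (exp (t * a) * (a * sin (t * b) + b * cos (t * b)) - b)%R)
      (f'' := fun t => (exp (t * a) * ((2 * a * b) * cos (t * b) + (a * a - b * b) * sin (t * b)))%R).
    - intros t; auto_derive; [auto|ring].
    - intros t; auto_derive; [auto|ring].
    - rewrite !Rmult_0_l, exp_0, sin_0; ring.
    - rewrite !Rmult_0_l, exp_0, cos_0, sin_0; ring.
    - intros t Ht. rewrite Rabs_mult, Rabs_right by (apply Rle_ge; left; apply exp_pos).
      rewrite Rmult_comm. apply Rmult_le_compat.
      + apply Rabs_pos.
      + left; apply exp_pos.
      + eapply Rle_trans; [apply trig_comb_bound|]. lra.
      + apply He, Ht. }
  eapply Rle_trans; [apply Cmod_le_re_im|]. lra.
Qed.

(** * Gaussian estimates *)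

Definition gauss (y : C) : C := Cexp (- (PI * y ^ 2)).

(** The error of the linear approximation of [gauss] at [y], relative to [gauss y]: with this factor
    kept apart, its decay can absorb the growth of the error along a line. *)
Definition grem (y e : C) : C :=
  Cexp (- (2 * PI * y * e) - PI * e ^ 2) - 1 + 2 * PI * y * e.

Lemma gauss_shift y e : gauss (y + e) = gauss y * (1 - 2 * PI * y * e + grem y e).
Proof.
  unfold gauss, grem.
  replace (- (PI * (y + e) ^ 2)) with (- (PI * y ^ 2) + (- (2 * PI * y * e) - PI * e ^ 2)) by (simpl; ring).
  rewrite Cexp_plus. ring.
Qed.

Lemma PI_ge_3 : (3 <= PI)%R.
Proof. pose proof PI2_3_2. lra. Qed.

(** [X] stands for [1 + |x|] along a line and [h] for the mesh. The exponent has modulus at most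
    [Z = 3 pi K^2 h X^2]; [36 pi^2 K^4] is [4 Z^2] stripped of [h] and [X], and [pi K^2] comes from
    the term [- pi e^2]. *)
Lemma grem_bound (K X h : R) y e :
  (1 <= K)%R -> (1 <= X)%R -> (0 <= h <= 1)%R ->
  (Cmod y <= K * X)%R -> (Cmod e <= h * (K * X))%R ->
  (Cmod (grem y e) <=
     (36 * PI ^ 2 * K ^ 4 + PI * K ^ 2) * h ^ 2 * X ^ 4 * exp (3 * PI * K ^ 2 * h * X ^ 2))%R.
Proof.
  intros HK HX Hh Hy He. pose proof PI_ge_3 as HP.
  set (z := - (2 * PI * y * e) - PI * e ^ 2).
  pose proof (Cmod_ge_0 y) as Py. pose proof (Cmod_ge_0 e) as Pe.
  assert (HKX : (1 <= K * X)%R) by nra.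
  assert (E1 : (Cmod y * Cmod e <= (K * X) * (h * (K * X)))%R) by (apply Rmult_le_compat; assumption).
  assert (E2 : (Cmod e ^ 2 <= h * (h * (K * X) ^ 2))%R).
  { replace (h * (h * (K * X) ^ 2))%R with ((h * (K * X)) ^ 2)%R by ring. apply pow_incr; lra. }
  assert (E3 : (h * (h * (K * X) ^ 2) <= h * (K * X) ^ 2)%R).
  { apply Rmult_le_compat_l; [lra|]. pose proof (pow2_ge_0 (K * X)). nra. }
  assert (Cz : (Cmod z <= 3 * PI * K ^ 2 * h * X ^ 2)%R).
  { unfold z. eapply Rle_trans; [apply Cmod_triangle|]. rewrite !Cmod_opp, !Cmod_mult, Cmod_pow, !Cmod_R.
    rewrite (Rabs_right 2), (Rabs_right PI) by lra.
    apply Rle_trans with (2 * PI * ((K * X) * (h * (K * X))) + PI * (h * (K * X) ^ 2))%R.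
    - apply Rplus_le_compat; [rewrite !Rmult_assoc; rewrite !Rmult_assoc in E1|].
      + do 2 (apply Rmult_le_compat_l; [lra|]). exact E1.
      + apply Rmult_le_compat_l; lra.
    - apply Req_le; ring. }
  replace (grem y e) with ((Cexp z - 1 - z) + - (PI * e ^ 2)) by (unfold grem, z; ring).
  eapply Rle_trans; [apply Cmod_triangle|].
  rewrite Cmod_opp, Cmod_mult, Cmod_pow, Cmod_R, (Rabs_right PI) by lra.
  set (Z := (3 * PI * K ^ 2 * h * X ^ 2)%R) in *. pose proof (Cmod_ge_0 z) as Pz.
  assert (T : (Cmod (Cexp z - 1 - z) <= 4 * Z ^ 2 * exp Z)%R).
  { eapply Rle_trans; [apply Cexp_taylor|]. apply Rmult_le_compat.
    - pose proof (pow2_ge_0 (Cmod z)); lra.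
    - left; apply exp_pos.
    - apply Rmult_le_compat_l; [lra|]. apply pow_incr; lra.
    - apply exp_le, Cz. }
  assert (T2 : (PI * Cmod e ^ 2 <= PI * K ^ 2 * h ^ 2 * X ^ 4 * exp Z)%R).
  { apply Rle_trans with (PI * (K ^ 2 * h ^ 2 * X ^ 2))%R.
    - apply Rmult_le_compat_l; [lra|]. eapply Rle_trans; [exact E2|]. apply Req_le; ring.
    - rewrite <- (Rmult_1_r (PI * (K ^ 2 * h ^ 2 * X ^ 2))). apply Rmult_le_compat; try lra.
      + apply Rmult_le_pos; [lra|]. apply Rmult_le_pos; [apply Rmult_le_pos|]; apply pow2_ge_0.
      + replace (PI * (K ^ 2 * h ^ 2 * X ^ 2))%R with ((PI * K ^ 2 * h ^ 2) * X ^ 2)%R by ring.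
        apply Rmult_le_compat_l; [apply Rmult_le_pos; [apply Rmult_le_pos; [lra|]|]; apply pow2_ge_0|].
        apply Rle_pow; [lra|lia].
      + rewrite <- exp_0. apply exp_le. lra. }
  replace ((36 * PI ^ 2 * K ^ 4 + PI * K ^ 2) * h ^ 2 * X ^ 4 * exp Z)%R
    with (4 * Z ^ 2 * exp Z + PI * K ^ 2 * h ^ 2 * X ^ 4 * exp Z)%R by (unfold Z; ring).
  lra.
Qed.

(** From [(u/4)^4 <= exp(u)] with [u = a X^2], whence [256 = 4^4]. The eighth power leaves a
    summable [1/X^2] beside factors up to [X^6]. *)
Lemma pow8_exp_bound (a X : R) : (0 < a)%R -> (X ^ 8 * exp (- (a * X ^ 2)) <= 256 / a ^ 4)%R.
Proof.
  intros Ha. set (u := (a * X ^ 2)%R).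
  assert (Hu : (0 <= u)%R) by (apply Rmult_le_pos; [lra|apply pow2_ge_0]).
  assert (E : (exp u = exp (u / 4) ^ 4)%R).
  { simpl. rewrite Rmult_1_r, <- !exp_plus. f_equal; field. }
  assert (H : ((u / 4) ^ 4 <= exp u)%R).
  { rewrite E. apply pow_incr. split; [lra|]. pose proof (exp_ineq1_le (u / 4)). lra. }
  rewrite exp_Ropp. pose proof (exp_pos u) as Pe.
  apply Rmult_le_reg_r with (exp u); [exact Pe|].
  replace (X ^ 8 * / exp u * exp u)%R with (X ^ 8)%R by (field; lra).
  replace (X ^ 8)%R with (256 / a ^ 4 * (u / 4) ^ 4)%R by (unfold u; field; lra).
  apply Rmult_le_compat_l; [|exact H].
  apply Rmult_le_pos; [lra|]. left; apply Rinv_0_lt_compat, pow_lt, Ha.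
Qed.

Lemma exp_decay_bound (a X : R) p : (0 < a)%R -> (1 <= X)%R -> (p <= 6)%nat ->
  (X ^ p * exp (- (a * X ^ 2)) <= 256 / a ^ 4 / X ^ 2)%R.
Proof.
  intros Ha HX Hp. pose proof (pow8_exp_bound a X Ha) as H.
  assert (HX2 : (0 < X ^ 2)%R) by (apply pow_lt; lra).
  pose proof (exp_pos (- (a * X ^ 2))) as Pe.
  apply Rle_trans with (X ^ 6 * exp (- (a * X ^ 2)))%R.
  - apply Rmult_le_compat_r; [lra|]. apply Rle_pow; [lra|exact Hp].
  - apply Rmult_le_reg_r with (X ^ 2)%R; [exact HX2|].
    replace (256 / a ^ 4 / X ^ 2 * X ^ 2)%R with (256 / a ^ 4)%R by (field; lra).
    replace (X ^ 6 * exp (- (a * X ^ 2)) * X ^ 2)%R with (X ^ 8 * exp (- (a * X ^ 2)))%R by ring. exact H.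
Qed.

Lemma sqr_abs (x : R) : (x ^ 2 = Rabs x ^ 2)%R.
Proof. rewrite RPow_abs, Rabs_right; [reflexivity|apply Rle_ge, pow2_ge_0]. Qed.

Lemma Cmod_gauss y : Cmod (gauss y) = exp (- (PI * Re (y ^ 2))).
Proof.
  unfold gauss. rewrite Cmod_Cexp. f_equal.
  replace (- (PI * y ^ 2)) with (RtoC (- PI) * y ^ 2) by (rewrite RtoC_opp; ring).
  rewrite re_scal_l. ring.
Qed.

(* On the lines [U x + W] with slope in the sector [|arg U| < pi/4] the Gaussian
   decays uniformly; [m] measures the distance of [U] from the boundary. *)
Lemma gauss_line_bound (m K : R) (U W : C) (x : R) :
  (0 < m)%R -> (m <= Re U - Rabs (Im U))%R -> (1 <= K)%R -> (Cmod U <= K)%R -> (Cmod W <= K)%R ->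
  (Cmod (gauss (U * x + W)) <=
     exp (PI * (2 * K ^ 4 / m ^ 2 + K ^ 2 + m ^ 2 / 2) - PI * m ^ 2 / 4 * (1 + Rabs x) ^ 2))%R.
Proof.
  intros Hm HR HK HRK HWK. rewrite Cmod_gauss. apply exp_le. pose proof PI_ge_3 as HP.
  assert (E : Re ((U * x + W) ^ 2) = (Re (U ^ 2) * x ^ 2 + 2 * x * Re (U * W) + Re (W ^ 2))%R).
  { replace ((U * x + W) ^ 2) with (U ^ 2 * RtoC (x ^ 2) + RtoC (2 * x) * (U * W) + W ^ 2)
      by (rewrite RtoC_pow, RtoC_mult; simpl; ring).
    rewrite !re_plus, re_scal_r, re_scal_l. reflexivity. }
  assert (H1 : (m ^ 2 <= Re (U ^ 2))%R).
  { replace (Re (U ^ 2)) with (Re U * Re U - Im U * Im U)%R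
      by (change (U ^ 2) with (U * (U * 1)); rewrite Cmult_1_r, re_mult; ring).
    assert (Im U * Im U = Rabs (Im U) * Rabs (Im U))%R by (rewrite <- Rabs_mult, Rabs_right; nra).
    pose proof (Rabs_pos (Im U)). nra. }
  assert (H2 : (Rabs (Re (U * W)) <= K ^ 2)%R).
  { eapply Rle_trans; [apply re_le_Cmod|]. rewrite Cmod_mult.
    pose proof (Cmod_ge_0 U). pose proof (Cmod_ge_0 W). simpl. rewrite Rmult_1_r.
    apply Rmult_le_compat; assumption. }
  assert (H3 : (Rabs (Re (W ^ 2)) <= K ^ 2)%R).
  { eapply Rle_trans; [apply re_le_Cmod|]. rewrite Cmod_pow. apply pow_incr.
    split; [apply Cmod_ge_0|exact HWK]. }
  assert (H4 : (- (2 * Rabs x * K ^ 2) <= 2 * x * Re (U * W))%R).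
  { assert (Rabs (2 * x * Re (U * W)) <= 2 * Rabs x * K ^ 2)%R.
    { rewrite !Rabs_mult, (Rabs_right 2) by lra. apply Rmult_le_compat_l; [|exact H2].
      pose proof (Rabs_pos x); lra. }
    apply Rabs_le_between in H. lra. }
  apply Rabs_le_between in H3.
  assert (Hx : (x ^ 2 = Rabs x ^ 2)%R) by apply sqr_abs.
  rewrite E, Hx in *. set (s := Rabs x) in *. assert (Hs : (0 <= s)%R) by apply Rabs_pos.
  assert (Hm2 : (0 < m ^ 2)%R) by (apply pow_lt; lra).
  (* Half of the quadratic decay pays for the linear term, by completing the square; the other half
     becomes the rate [m^2/4] through [(1 + s)^2 <= 2 + 2 s^2]. *)
  assert (H5 : (0 <= m ^ 2 * s ^ 2 / 2 - 2 * K ^ 2 * s + 2 * K ^ 4 / m ^ 2)%R).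
  { replace (m ^ 2 * s ^ 2 / 2 - 2 * K ^ 2 * s + 2 * K ^ 4 / m ^ 2)%R
      with ((m * s - 2 * K ^ 2 / m) ^ 2 / 2)%R by (field; lra).
    pose proof (pow2_ge_0 (m * s - 2 * K ^ 2 / m)). lra. }
  assert (H6 : (m ^ 2 * s ^ 2 <= Re (U ^ 2) * s ^ 2)%R)
    by (apply Rmult_le_compat_r; [apply pow2_ge_0|exact H1]).
  assert (H7 : (m ^ 2 * (1 + s) ^ 2 <= m ^ 2 * (2 + 2 * s ^ 2))%R).
  { apply Rmult_le_compat_l; [lra|]. pose proof (pow2_ge_0 (1 - s)). nra. }
  cut (m ^ 2 / 4 * (1 + s) ^ 2 - (2 * K ^ 4 / m ^ 2 + K ^ 2 + m ^ 2 / 2)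
       <= Re (U ^ 2) * s ^ 2 + 2 * x * Re (U * W) + Re (W ^ 2))%R; [intros; nra|].
  lra.
Qed.

(** * Sampled sums over the integers *)

(** [f m] is thought of as a sample at the point [h m]. In the applications [B] is controlled
    separately from the mesh, and sums are of order [B/h]. *)
Definition decay (h B : R) (f : Z -> C) : Prop :=
  forall m, (Cmod (f m) <= B / (1 + Rabs (h * IZR m)) ^ 2)%R.

(** Comparison with a telescoping sum; the subtracted term carries the induction. *)
Lemma sample_bound (h : R) M : (0 < h)%R ->
  (sum_f_R0 (fun n => / (1 + h * INR n) ^ 2) M <= 1 + / h - / (h * (1 + h * INR M)))%R.
Proof.
  intros Hh. induction M as [|M IH].
  - simpl. replace (1 + h * 0)%R with 1%R by ring. apply Req_le. field. lra.
  - cbn [sum_f_R0]. rewrite S_INR. set (x := INR M) in *.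
    assert (Hx : (0 <= x)%R) by apply pos_INR.
    assert (Hhx : (0 <= h * x)%R) by (apply Rmult_le_pos; lra).
    assert (K : (/ (1 + h * (x + 1)) ^ 2 <= / (h * (1 + h * x)) - / (h * (1 + h * (x + 1))))%R).
    { replace (/ (h * (1 + h * x)) - / (h * (1 + h * (x + 1))))%R
        with (/ ((1 + h * x) * (1 + h * (x + 1))))%R by (field; lra).
      apply Rinv_le_contravar; [apply Rmult_lt_0_compat; lra|]. simpl. rewrite Rmult_1_r.
      apply Rmult_le_compat_r; lra. }
    lra.
Qed.

Lemma decay_nonneg h B f : decay h B f -> (0 <= B)%R.
Proof.
  intros H. specialize (H 0%Z). rewrite Rmult_0_r, Rabs_R0 in H.
  pose proof (Cmod_ge_0 (f 0%Z)). lra.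
Qed.

Lemma abs_h_nat (h : R) n : (0 < h)%R -> Rabs (h * IZR (Z.of_nat n)) = (h * INR n)%R.
Proof.
  intros H. rewrite <- INR_IZR_INZ. apply Rabs_right, Rle_ge, Rmult_le_pos; [lra|apply pos_INR].
Qed.

Lemma abs_h_opp (h : R) k : Rabs (h * IZR (- k)) = Rabs (h * IZR k).
Proof. rewrite opp_IZR, Ropp_mult_distr_r_reverse. apply Rabs_Ropp. Qed.

Lemma decay_Clim h B f : (0 < h)%R -> decay h B f -> Clim (zsum f) (ZSeries f).
Proof.
  intros Hh H. pose proof (decay_nonneg _ _ _ H) as HB.
  apply ZSeries_Clim with (fun n => (B * / (1 + h * INR n) ^ 2)%R).
  - intros n. rewrite <- abs_h_nat by exact Hh. apply H.
  - intros n. rewrite <- abs_h_nat, <- abs_h_opp by exact Hh. apply H.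
  - apply (ex_series_scal_l (V := R_NormedModule) B).
    apply ex_series_bounded with (1 + / h)%R.
    + intros n. left. apply Rinv_0_lt_compat, pow_lt.
      pose proof (Rmult_le_pos h (INR n) (Rlt_le _ _ Hh) (pos_INR n)). lra.
    + intros n. rewrite sum_n_Reals. eapply Rle_trans; [apply sample_bound, Hh|].
      assert (0 < / (h * (1 + h * INR n)))%R; [|lra].
      apply Rinv_0_lt_compat, Rmult_lt_0_compat; [lra|].
      pose proof (Rmult_le_pos h (INR n) (Rlt_le _ _ Hh) (pos_INR n)). lra.
Qed.

Lemma decay_lim_bound h B f l : (0 < h <= 1)%R -> decay h B f -> Clim (zsum f) l ->
  (Cmod l <= 4 * B / h)%R.
Proof.
  intros Hh H Hl. pose proof (decay_nonneg _ _ _ H) as HB.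
  apply Clim_Cmod_le with (2 := Hl). intros M.
  assert (K : (Cmod (zsum f M) <= 2 * B * sum_f_R0 (fun n => / (1 + h * INR n) ^ 2) M)%R).
  { induction M as [|M IH].
    - simpl zsum. specialize (H 0%Z). rewrite Rmult_0_r, Rabs_R0 in H. simpl sum_f_R0. simpl INR.
      rewrite Rmult_0_r. unfold Rdiv in H. rewrite !Rplus_0_r, pow1, Rinv_1 in *. lra.
    - cbn [zsum sum_f_R0]. rewrite Rmult_plus_distr_l.
      eapply Rle_trans; [apply Cmod_triangle|]. apply Rplus_le_compat; [exact IH|].
      eapply Rle_trans; [apply Cmod_triangle|].
      pose proof (H (Z.of_nat (S M))) as H1. pose proof (H (- Z.of_nat (S M))%Z) as H2.
      rewrite abs_h_opp in H2. rewrite abs_h_nat in H1, H2 by lra. unfold Rdiv in *. lra. }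
  eapply Rle_trans; [exact K|].
  pose proof (sample_bound h M (proj1 Hh)) as S.
  assert (0 < / (h * (1 + h * INR M)))%R.
  { apply Rinv_0_lt_compat, Rmult_lt_0_compat; [lra|].
    pose proof (Rmult_le_pos h (INR M) (Rlt_le _ _ (proj1 Hh)) (pos_INR M)). lra. }
  assert (1 <= / h)%R by (rewrite <- Rinv_1; apply Rinv_le_contravar; lra).
  replace (4 * B / h)%R with (2 * B * (/ h + / h))%R by (unfold Rdiv; ring).
  apply Rmult_le_compat_l; lra.
Qed.

Lemma zsum_plus f g M : zsum (fun k => f k + g k) M = zsum f M + zsum g M.
Proof. induction M as [|M IH]; cbn [zsum]; [reflexivity|rewrite IH; ring]. Qed.

Lemma zsum_scal c f M : zsum (fun k => c * f k) M = c * zsum f M.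
Proof. induction M as [|M IH]; cbn [zsum]; [reflexivity|rewrite IH; ring]. Qed.

Lemma zsum_ext f g M :
  (forall k, (Z.abs k <= Z.of_nat M)%Z -> f k = g k) -> zsum f M = zsum g M.
Proof.
  intros H; induction M as [|M IH]; cbn [zsum]; [apply H; lia|].
  rewrite IH, !H by lia || (intros; apply H; lia). reflexivity.
Qed.

Lemma zsum_succ f M :
  zsum (fun k => f (k + 1)%Z) M = zsum f M + f (Z.of_nat (S M)) - f (- Z.of_nat M)%Z.
Proof.
  induction M as [|M IH]; [cbn [zsum]; simpl; ring|].
  cbn [zsum]; rewrite IH.
  replace (- Z.of_nat (S M) + 1)%Z with (- Z.of_nat M)%Z by lia.
  replace (Z.of_nat (S M) + 1)%Z with (Z.of_nat (S (S M)))%Z by lia. ring.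
Qed.

Definition is_zsum (f : Z -> C) (l : C) : Prop := Clim (zsum f) l.

Lemma is_zsum_plus f g l m : is_zsum f l -> is_zsum g m -> is_zsum (fun k => f k + g k) (l + m).
Proof.
  intros H1 H2. apply Clim_ext with (2 := Clim_plus _ _ _ _ H1 H2). intros n; symmetry; apply zsum_plus.
Qed.

Lemma is_zsum_scal c f l : is_zsum f l -> is_zsum (fun k => c * f k) (c * l).
Proof.
  intros H. apply Clim_ext with (2 := Clim_scal c _ _ H). intros n; symmetry; apply zsum_scal.
Qed.

Lemma is_zsum_ext f g l : (forall k, f k = g k) -> is_zsum f l -> is_zsum g l.
Proof.
  intros H. apply Clim_ext. intros n; apply zsum_ext; intros; apply H.
Qed.

Lemma is_zsum_minus f g l m : is_zsum f l -> is_zsum g m -> is_zsum (fun k => f k - g k) (l - m).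
Proof.
  intros H1 H2. apply is_zsum_ext with (fun k => f k + (-1) * g k); [intros; ring|].
  replace (l - m) with (l + (-1) * m) by ring. apply is_zsum_plus; [exact H1|apply is_zsum_scal, H2].
Qed.

Lemma decay_tail h B f : (0 < h)%R -> decay h B f ->
  is_lim_seq (fun n => Cmod (f (Z.of_nat n))) 0%R /\
  is_lim_seq (fun n => Cmod (f (- Z.of_nat n)%Z)) 0%R.
Proof.
  intros Hh H. pose proof (decay_nonneg _ _ _ H) as HB.
  assert (L : is_lim_seq (fun n => B * / (1 + h * INR n) ^ 2)%R 0%R).
  { apply lim0_scal. apply lim0_le with (fun n => (1 + / h) * / INR (S n))%R.
    - intros n. pose proof (pos_INR n) as Pn. pose proof (Rmult_le_pos h (INR n) (Rlt_le _ _ Hh) Pn) as Hp.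
      split; [left; apply Rinv_0_lt_compat, pow_lt; lra|]. rewrite S_INR.
      apply Rle_trans with (/ (1 + h * INR n))%R.
      + apply Rinv_le_contravar; [lra|]. nra.
      + apply Rmult_le_reg_r with ((1 + h * INR n) * (INR n + 1))%R; [apply Rmult_lt_0_compat; lra|].
        replace (/ (1 + h * INR n) * ((1 + h * INR n) * (INR n + 1)))%R with (INR n + 1)%R by (field; lra).
        replace ((1 + / h) * / (INR n + 1) * ((1 + h * INR n) * (INR n + 1)))%R
          with (1 + h * INR n + / h + INR n)%R by (field; lra).
        pose proof (Rinv_0_lt_compat h Hh). lra.
    - apply lim0_scal. apply lim_inv_INR. }
  split; revert L; apply lim0_le; intros n; split; try apply Cmod_ge_0.
  - rewrite <- abs_h_nat by exact Hh. apply H.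
  - rewrite <- abs_h_nat, <- abs_h_opp by exact Hh. apply H.
Qed.

Lemma is_zsum_succ h B f l : (0 < h)%R -> decay h B f ->
  is_zsum f l -> is_zsum (fun k => f (k + 1)%Z) l.
Proof.
  intros Hh H Hl. destruct (decay_tail h B f Hh H) as [T1 T2].
  apply is_lim_seq_incr_1 in T1.
  apply Clim_of_diff with (1 := Hl).
  generalize (lim0_plus _ _ T1 T2); apply lim0_le. intros n; split; [apply Cmod_ge_0|].
  rewrite zsum_succ.
  replace (zsum f n + f (Z.of_nat (S n)) - f (- Z.of_nat n)%Z - zsum f n)
    with (f (Z.of_nat (S n)) + - f (- Z.of_nat n)%Z) by ring.
  eapply Rle_trans; [apply Cmod_triangle|]. rewrite Cmod_opp. lra.
Qed.

Lemma is_zsum_pred h B f l : (0 < h)%R -> decay h B f ->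
  is_zsum f l -> is_zsum (fun k => f (k - 1)%Z) l.
Proof.
  intros Hh H Hl.
  assert (R : forall g M, zsum (fun k => g (- k)%Z) M = zsum g M).
  { intros g M; induction M as [|M IH]; cbn [zsum]; [reflexivity|].
    rewrite IH, Z.opp_involutive. ring. }
  apply Clim_ext with (zsum (fun k => f (- (k + 1))%Z)).
  { intros M. rewrite <- (R (fun k => f (k - 1)%Z)). apply zsum_ext; intros k _. f_equal; lia. }
  apply (is_zsum_succ h B (fun k => f (- k)%Z)); [exact Hh| |].
  - intros k. rewrite <- abs_h_opp. apply H.
  - apply Clim_ext with (2 := Hl). intros M; symmetry; apply R.
Qed.

(** * Sums of Gaussians along lines in the complex plane *)

Section Lines.

(** The lines [(1 + t rho) x + t w], [0 <= t <= 1], run from the real line to [r x + w] with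
    [r = 1 + rho]; [Hsector] keeps all their slopes in the sector of decay. The constants below
    depend on [rho], [w] and [m] only, not on [t] or the mesh. *)
Variables (rho w : C) (m : R).
Hypothesis Hm : (0 < m)%R.
Let K : R := (1 + Cmod rho + Cmod w)%R.
Let slope (t : R) : C := 1 + t * rho.
Let offset (t : R) : C := t * w.
Hypothesis Hsector : forall t : R, (0 <= t <= 1)%R ->
  (m <= Re (slope t) - Rabs (Im (slope t)))%R.

(** [A0] and [c0] are the exponents of [gauss_line_bound], [C0] is the constant of [grem_bound].
    Below the mesh [h0] the exponential in [grem_bound] uses up at most half of the rate [c0]; [D0]
    comes from [exp_decay_bound] for the other half. *)
Let A0 : R := (PI * (2 * K ^ 4 / m ^ 2 + K ^ 2 + m ^ 2 / 2))%R.
Let c0 : R := (PI * m ^ 2 / 4)%R.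
Let C0 : R := (36 * PI ^ 2 * K ^ 4 + PI * K ^ 2)%R.
Let h0 : R := Rmin 1 (c0 / (2 * (3 * PI * K ^ 2)))%R.
Let D0 : R := (exp A0 * (256 / (c0 / 2) ^ 4))%R.

Lemma K_ge1 : (1 <= K)%R.
Proof. unfold K. pose proof (Cmod_ge_0 rho). pose proof (Cmod_ge_0 w). lra. Qed.

Lemma c0_pos : (0 < c0)%R.
Proof.
  unfold c0. pose proof PI_ge_3. pose proof (pow_lt m 2 Hm).
  apply Rmult_lt_0_compat; [apply Rmult_lt_0_compat|]; lra.
Qed.

Lemma h0_pos : (0 < h0)%R.
Proof.
  unfold h0. apply Rmin_pos; [lra|]. pose proof PI_ge_3. pose proof K_ge1. pose proof c0_pos.
  apply Rdiv_lt_0_compat; [assumption|].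
  apply Rmult_lt_0_compat; [lra|]. apply Rmult_lt_0_compat; [lra|]. apply pow_lt; lra.
Qed.

Lemma slope_le t : (0 <= t <= 1)%R -> (Cmod (slope t) <= K)%R.
Proof.
  intros Ht. unfold slope, K. eapply Rle_trans; [apply Cmod_triangle|].
  rewrite Cmod_1, Cmod_mult, Cmod_R, Rabs_right by lra.
  pose proof (Cmod_ge_0 rho). pose proof (Cmod_ge_0 w). nra.
Qed.

Lemma offset_le t : (0 <= t <= 1)%R -> (Cmod (offset t) <= K)%R.
Proof.
  intros Ht. unfold offset, K.
  rewrite Cmod_mult, Cmod_R, Rabs_right by lra.
  pose proof (Cmod_ge_0 rho). pose proof (Cmod_ge_0 w). nra.
Qed.

Lemma gauss_poly_bound (t x h : R) p : (0 <= t <= 1)%R -> (0 <= h <= h0)%R -> (p <= 6)%nat ->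
  (Cmod (gauss (slope t * x + offset t)) * ((1 + Rabs x) ^ p * exp (3 * PI * K ^ 2 * h * (1 + Rabs x) ^ 2))
   <= D0 / (1 + Rabs x) ^ 2)%R.
Proof.
  intros Ht Hh Hp. pose proof c0_pos as Hc. pose proof K_ge1 as HK. pose proof PI_ge_3 as HP.
  set (X := (1 + Rabs x)%R). assert (HX : (1 <= X)%R) by (unfold X; pose proof (Rabs_pos x); lra).
  assert (HK2 : (0 < 3 * PI * K ^ 2)%R) by (apply Rmult_lt_0_compat; [lra|apply pow_lt; lra]).
  assert (Hh' : (3 * PI * K ^ 2 * h <= c0 / 2)%R).
  { apply Rle_trans with (3 * PI * K ^ 2 * (c0 / (2 * (3 * PI * K ^ 2))))%R.
    - apply Rmult_le_compat_l; [lra|]. apply Rle_trans with (1 := proj2 Hh). apply Rmin_r.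
    - apply Req_le. field. split; nra. }
  apply Rle_trans with (exp (A0 - c0 * X ^ 2) * (X ^ p * exp (c0 / 2 * X ^ 2)))%R.
  - apply Rmult_le_compat.
    + apply Cmod_ge_0.
    + apply Rmult_le_pos; [apply pow_le; lra|left; apply exp_pos].
    + eapply Rle_trans; [apply (gauss_line_bound m K); auto using slope_le, offset_le|].
      apply Req_le. unfold A0, c0, X. reflexivity.
    + apply Rmult_le_compat_l; [apply pow_le; lra|]. apply exp_le.
      apply Rmult_le_compat_r; [apply pow2_ge_0|exact Hh'].
  - replace (exp (A0 - c0 * X ^ 2) * (X ^ p * exp (c0 / 2 * X ^ 2)))%R
      with (exp A0 * (X ^ p * exp (- (c0 / 2 * X ^ 2))))%R.
    2: { replace (A0 - c0 * X ^ 2)%R with (A0 + (- (c0 / 2 * X ^ 2) + - (c0 / 2 * X ^ 2)))%R by field.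
         rewrite !exp_plus, (exp_Ropp (c0 / 2 * X ^ 2)). field.
         apply Rgt_not_eq, exp_pos. }
    replace (D0 / X ^ 2)%R with (exp A0 * (256 / (c0 / 2) ^ 4 / X ^ 2))%R
      by (unfold D0, Rdiv; ring).
    apply Rmult_le_compat_l; [left; apply exp_pos|]. apply exp_decay_bound; [lra|exact HX|exact Hp].
Qed.

Lemma gauss_line_decay (t x : R) p : (0 <= t <= 1)%R -> (p <= 6)%nat ->
  (Cmod (gauss (slope t * x + offset t)) * (1 + Rabs x) ^ p <= D0 / (1 + Rabs x) ^ 2)%R.
Proof.
  intros Ht Hp. pose proof (gauss_poly_bound t x 0 p Ht) as H.
  rewrite !Rmult_0_r, !Rmult_0_l, exp_0, Rmult_1_r in H. apply H; [|exact Hp].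
  pose proof h0_pos; lra.
Qed.

Let point (t x : R) : C := slope t * x + offset t.

Lemma point_le (t x : R) : (0 <= t <= 1)%R -> (Cmod (point t x) <= K * (1 + Rabs x))%R.
Proof.
  intros Ht. unfold point. eapply Rle_trans; [apply Cmod_triangle|]. rewrite Cmod_mult, Cmod_R.
  pose proof (slope_le t Ht). pose proof (offset_le t Ht). pose proof (Rabs_pos x).
  pose proof (Cmod_ge_0 (slope t)). nra.
Qed.

Lemma velocity_le (x : R) : (Cmod (rho * x + w) <= K * (1 + Rabs x))%R.
Proof.
  eapply Rle_trans; [apply Cmod_triangle|]. rewrite Cmod_mult, Cmod_R. unfold K.
  pose proof (Cmod_ge_0 rho). pose proof (Cmod_ge_0 w). pose proof (Rabs_pos x). nra.
Qed.

Lemma grem_line_bound (t x h : R) e : (0 <= t <= 1)%R -> (0 <= h <= h0)%R ->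
  (Cmod e <= h * (K * (1 + Rabs x)))%R ->
  (Cmod (grem (point t x) e) <=
     C0 * h ^ 2 * (1 + Rabs x) ^ 4 * exp (3 * PI * K ^ 2 * h * (1 + Rabs x) ^ 2))%R.
Proof.
  intros Ht Hh He. apply grem_bound; [apply K_ge1| | |apply point_le, Ht|exact He].
  - pose proof (Rabs_pos x); lra.
  - split; [apply Hh|]. apply Rle_trans with (1 := proj2 Hh), Rmin_l.
Qed.

Lemma C0_pos : (0 < C0)%R.
Proof.
  unfold C0. pose proof PI_ge_3. pose proof K_ge1.
  apply Rplus_lt_0_compat; apply Rmult_lt_0_compat; try (apply pow_lt; lra); [|lra].
  apply Rmult_lt_0_compat; [lra|apply pow_lt; lra].
Qed.

(** The terms of first order in [h] cancel and only two remainders [grem] survive. *)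
Lemma second_difference_bound (t x h : R) : (0 <= t <= 1)%R -> (0 <= h <= h0)%R ->
  (Cmod (gauss (point t (x + h)) + gauss (point t (x - h)) - 2 * gauss (point t x))
     <= 2 * C0 * D0 * h ^ 2 / (1 + Rabs x) ^ 2)%R.
Proof.
  intros Ht Hh. pose proof C0_pos as HC.
  replace (point t (x + h)) with (point t x + h * slope t)
    by (unfold point; rewrite RtoC_plus; ring).
  replace (point t (x - h)) with (point t x + - (h * slope t))
    by (unfold point; rewrite RtoC_minus; ring).
  rewrite !gauss_shift.
  match goal with |- (Cmod ?u <= _)%R => replace u with
    (gauss (point t x) * (grem (point t x) (h * slope t) + grem (point t x) (- (h * slope t)))) by ring end.
  assert (He : (Cmod (h * slope t) <= h * (K * (1 + Rabs x)))%R).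
  { rewrite Cmod_mult, Cmod_R, Rabs_right by lra. apply Rmult_le_compat_l; [lra|].
    pose proof (slope_le t Ht). pose proof (Rabs_pos x). pose proof K_ge1. nra. }
  pose proof (grem_line_bound t x h (h * slope t) Ht Hh He) as G1.
  pose proof (grem_line_bound t x h (- (h * slope t)) Ht Hh ltac:(rewrite Cmod_opp; exact He)) as G2.
  rewrite Cmod_mult. pose proof (Cmod_ge_0 (gauss (point t x))) as Pg.
  pose proof (gauss_poly_bound t x h 4 Ht Hh ltac:(lia)) as GB. fold (point t x) in GB.
  set (E := exp (3 * PI * K ^ 2 * h * (1 + Rabs x) ^ 2)) in *. set (X := (1 + Rabs x)%R) in *.
  set (g := Cmod (gauss (point t x))) in *.
  apply Rle_trans with (g * (2 * (C0 * h ^ 2 * X ^ 4 * E)))%R.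
  - apply Rmult_le_compat_l; [exact Pg|]. eapply Rle_trans; [apply Cmod_triangle|]. lra.
  - replace (g * (2 * (C0 * h ^ 2 * X ^ 4 * E)))%R with (2 * C0 * h ^ 2 * (g * (X ^ 4 * E)))%R by ring.
    replace (2 * C0 * D0 * h ^ 2 / X ^ 2)%R with (2 * C0 * h ^ 2 * (D0 / X ^ 2))%R by (unfold Rdiv; ring).
    apply Rmult_le_compat_l; [|exact GB].
    apply Rmult_le_pos; [lra|apply pow2_ge_0].
Qed.

Let C2 : R := (4 * PI * K ^ 3 + 4 * K * C0)%R.

(* [d/dt (slope t * gauss (point t x)) = d/dx ((rho x + w) * gauss (point t x))]
   in discrete form, up to second order. *)
Lemma homotopy_bound (t x h : R) : (0 <= t <= 1)%R -> (0 <= h <= h0)%R ->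
  (Cmod ((slope (t + h) * gauss (point (t + h) x) - slope t * gauss (point t x))
     - ((rho * (x + h)%R + w) * gauss (point t (x + h)) - (rho * x + w) * gauss (point t x)))
   <= C2 * D0 * h ^ 2 / (1 + Rabs x) ^ 2)%R.
Proof.
  intros Ht Hh. pose proof C0_pos as HC. pose proof K_ge1 as HK. pose proof PI_ge_3 as HP.
  assert (Hh1 : (h <= 1)%R) by (apply Rle_trans with (1 := proj2 Hh), Rmin_l).
  set (v := rho * x + w). set (y := point t x). set (U := slope t).
  replace (point t (x + h)) with (y + h * U) by (unfold y, U, point; rewrite RtoC_plus; ring).
  replace (point (t + h) x) with (y + h * v)
    by (unfold y, v, point, slope, offset; rewrite RtoC_plus; ring).
  replace (slope (t + h)) with (U + h * rho) by (unfold U, slope; rewrite RtoC_plus; ring).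
  replace (rho * (x + h)%R + w) with (v + h * rho) by (unfold v; rewrite RtoC_plus; ring).
  rewrite !gauss_shift.
  match goal with |- (Cmod ?u <= _)%R => replace u with
    (gauss y * ((U + h * rho) * grem y (h * v) + - ((v + h * rho) * grem y (h * U))
                + - (2 * PI * y * (h * h * rho * (v - U))))) by ring end.
  pose proof (Rabs_pos x) as Hx.
  set (X := (1 + Rabs x)%R). assert (HX : (1 <= X)%R) by (unfold X; lra).
  assert (Hv : (Cmod v <= K * X)%R) by apply velocity_le.
  assert (HU : (Cmod U <= K)%R) by (apply slope_le, Ht).
  assert (Hy : (Cmod y <= K * X)%R) by (apply point_le, Ht).
  assert (Hrho : (Cmod rho <= K)%R) by (unfold K; pose proof (Cmod_ge_0 w); pose proof (Cmod_ge_0 rho); lra).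
  assert (HKX : (K <= K * X)%R) by nra.
  assert (G1 : (Cmod (grem y (h * v)) <= C0 * h ^ 2 * X ^ 4 * exp (3 * PI * K ^ 2 * h * X ^ 2))%R).
  { apply grem_line_bound; [exact Ht|exact Hh|]. rewrite Cmod_mult, Cmod_R, Rabs_right by lra.
    apply Rmult_le_compat_l; [lra|exact Hv]. }
  assert (G2 : (Cmod (grem y (h * U)) <= C0 * h ^ 2 * X ^ 4 * exp (3 * PI * K ^ 2 * h * X ^ 2))%R).
  { apply grem_line_bound; [exact Ht|exact Hh|]. rewrite Cmod_mult, Cmod_R, Rabs_right by lra.
    apply Rmult_le_compat_l; [lra|]. apply Rle_trans with (1 := HU), HKX. }
  pose proof (gauss_poly_bound t x h 5 Ht Hh ltac:(lia)) as GB5.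
  fold (point t x) y X in GB5.
  set (E := exp (3 * PI * K ^ 2 * h * X ^ 2)) in *.
  assert (HE : (1 <= E)%R).
  { unfold E; rewrite <- exp_0. apply exp_le.
    apply Rmult_le_pos; [|apply pow2_ge_0]. apply Rmult_le_pos; [|lra].
    apply Rmult_le_pos; [lra|apply pow2_ge_0]. }
  assert (PX4 : (0 < X ^ 4)%R) by (apply pow_lt; lra).
  assert (PG : (0 <= C0 * h ^ 2 * X ^ 4 * E)%R).
  { pose proof (pow2_ge_0 h). apply Rmult_le_pos; [apply Rmult_le_pos; [apply Rmult_le_pos|]|]; lra. }
  set (G := (C0 * h ^ 2 * X ^ 4 * E)%R) in *.
  assert (T1 : (Cmod ((U + h * rho) * grem y (h * v)) <= 2 * K * G)%R).
  { rewrite Cmod_mult. apply Rmult_le_compat; try apply Cmod_ge_0; [|exact G1].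
    eapply Rle_trans; [apply Cmod_triangle|]. rewrite Cmod_mult, Cmod_R, Rabs_right by lra.
    pose proof (Cmod_ge_0 rho). nra. }
  assert (T2 : (Cmod ((v + h * rho) * grem y (h * U)) <= 2 * (K * X) * G)%R).
  { rewrite Cmod_mult. apply Rmult_le_compat; try apply Cmod_ge_0; [|exact G2].
    eapply Rle_trans; [apply Cmod_triangle|]. rewrite Cmod_mult, Cmod_R, Rabs_right by lra.
    pose proof (Cmod_ge_0 rho). nra. }
  assert (T3 : (Cmod (2 * PI * y * (h * h * rho * (v - U))) <= 4 * PI * K ^ 3 * h ^ 2 * X ^ 2)%R).
  { rewrite !Cmod_mult, !Cmod_R, (Rabs_right 2), (Rabs_right PI), (Rabs_right h) by lra.
    assert (B : (Cmod (v - U) <= 2 * (K * X))%R).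
    { eapply Rle_trans; [apply Cmod_triangle|]. rewrite Cmod_opp. lra. }
    replace (4 * PI * K ^ 3 * h ^ 2 * X ^ 2)%R with (2 * PI * (K * X) * (h * h * K * (2 * (K * X))))%R by ring.
    pose proof (Cmod_ge_0 y). pose proof (Cmod_ge_0 rho). pose proof (Cmod_ge_0 (v - U)).
    assert (Hhh : (0 <= h * h)%R) by (apply Rmult_le_pos; lra).
    apply Rmult_le_compat.
    - apply Rmult_le_pos; lra.
    - apply Rmult_le_pos; [apply Rmult_le_pos|]; lra.
    - apply Rmult_le_compat_l; lra.
    - apply Rmult_le_compat; [apply Rmult_le_pos; lra|lra|apply Rmult_le_compat_l; lra|lra]. }
  rewrite Cmod_mult. pose proof (Cmod_ge_0 (gauss y)) as Pg. set (g := Cmod (gauss y)) in *.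
  apply Rle_trans with (g * (C2 * h ^ 2 * (X ^ 5 * E)))%R.
  - apply Rmult_le_compat_l; [exact Pg|].
    eapply Rle_trans; [apply Cmod_triangle|]. rewrite Cmod_opp.
    apply Rle_trans with (2 * K * G + 2 * (K * X) * G + 4 * PI * K ^ 3 * h ^ 2 * X ^ 2)%R.
    + apply Rplus_le_compat; [|exact T3]. eapply Rle_trans; [apply Cmod_triangle|]. rewrite Cmod_opp. lra.
    + replace (C2 * h ^ 2 * (X ^ 5 * E))%R
        with (4 * (K * X) * G + 4 * PI * K ^ 3 * h ^ 2 * (X ^ 5 * E))%R by (unfold C2, G; ring).
      apply Rplus_le_compat; [nra|].
      apply Rmult_le_compat_l.
      * pose proof (pow2_ge_0 h). pose proof (pow_lt K 3 ltac:(lra)).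
        apply Rmult_le_pos; [apply Rmult_le_pos; [lra|]|]; lra.
      * rewrite <- (Rmult_1_r (X ^ 2)). apply Rmult_le_compat; [apply pow2_ge_0|lra| |exact HE].
        apply Rle_pow; [lra|lia].
  - replace (g * (C2 * h ^ 2 * (X ^ 5 * E)))%R with (C2 * h ^ 2 * (g * (X ^ 5 * E)))%R by ring.
    replace (C2 * D0 * h ^ 2 / X ^ 2)%R with (C2 * h ^ 2 * (D0 / X ^ 2))%R by (unfold Rdiv; ring).
    apply Rmult_le_compat_l; [|exact GB5].
    apply Rmult_le_pos; [|apply pow2_ge_0]. unfold C2.
    pose proof (pow_lt K 3 ltac:(lra)).
    apply Rplus_le_le_0_compat; [apply Rmult_le_pos; lra|]. apply Rmult_le_pos; lra.
Qed.

Lemma line_decay (t h : R) (f : R -> C) (F : R) : (0 <= t <= 1)%R ->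
  (forall x, (Cmod (f x) <= F * (1 + Rabs x))%R) ->
  decay h (F * D0) (fun k => f (h * IZR k)%R * gauss (point t (h * IZR k))).
Proof.
  intros Ht Hf k. set (x := (h * IZR k)%R). rewrite Cmod_mult.
  pose proof (gauss_line_decay t x 1 Ht ltac:(lia)) as H. fold (point t x) in H.
  specialize (Hf x). rewrite pow_1 in H.
  pose proof (Cmod_ge_0 (gauss (point t x))) as Pg. pose proof (Cmod_ge_0 (f x)) as Pf'.
  assert (HF : (0 <= F)%R) by (pose proof (Rabs_pos x); nra).
  apply Rle_trans with (F * (Cmod (gauss (point t x)) * (1 + Rabs x)))%R.
  - rewrite Rmult_comm, (Rmult_comm _ (1 + Rabs x)), <- Rmult_assoc, Rmult_comm.
    apply Rmult_le_compat_r; assumption.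
  - replace (F * D0 / (1 + Rabs x) ^ 2)%R with (F * (D0 / (1 + Rabs x) ^ 2))%R by (unfold Rdiv; ring).
    apply Rmult_le_compat_l; assumption.
Qed.

Let lsum (h t : R) : C := ZSeries (fun k => slope t * gauss (point t (h * IZR k))).

Lemma lsum_lim h t : (0 < h)%R -> (0 <= t <= 1)%R ->
  is_zsum (fun k => slope t * gauss (point t (h * IZR k))) (lsum h t).
Proof.
  intros Hh Ht. apply decay_Clim with h (K * D0)%R; [exact Hh|].
  apply (line_decay t h (fun _ => slope t) K Ht). intros x.
  pose proof (slope_le t Ht). pose proof (Rabs_pos x). pose proof K_ge1. nra.
Qed.

(** Summed over all integers, the difference in [x] of [homotopy_bound] telescopes to 0, so what
    remains is [O(h^2)] per sample with quadratic decay, hence [O(h)] for the sum. *)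
Lemma lsum_step (h t : R) : (0 < h <= h0)%R -> (0 <= t)%R -> (t + h <= 1)%R ->
  (Cmod (lsum h (t + h) - lsum h t) <= 4 * (C2 * D0) * h)%R.
Proof.
  intros Hh Ht Hth.
  assert (Hh1 : (h <= 1)%R) by (apply Rle_trans with (1 := proj2 Hh), Rmin_l).
  assert (Ht1 : (0 <= t <= 1)%R) by lra.
  set (V := fun k : Z => (rho * (h * IZR k)%R + w) * gauss (point t (h * IZR k))).
  assert (DV : decay h (K * D0) V).
  { apply (line_decay t h (fun x => rho * x + w) K Ht1). intros x; apply velocity_le. }
  pose proof (decay_Clim h _ V ltac:(lra) DV) as HV.
  pose proof (is_zsum_succ h _ V _ ltac:(lra) DV HV) as HV'.
  pose proof (is_zsum_minus _ _ _ _ (is_zsum_minus _ _ _ _ (lsum_lim h (t + h) ltac:(lra) ltac:(lra)) (lsum_lim h t ltac:(lra) Ht1))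
                (is_zsum_minus _ _ _ _ HV' HV)) as H.
  replace (lsum h (t + h) - lsum h t - (ZSeries V - ZSeries V)) with (lsum h (t + h) - lsum h t) in H by ring.
  replace (4 * (C2 * D0) * h)%R with (4 * (C2 * D0 * h ^ 2) / h)%R by (field; lra).
  refine (decay_lim_bound h _ _ _ _ _ H); [lra|].
  intros k. unfold V. rewrite plus_IZR.
  replace (h * (IZR k + 1))%R with (h * IZR k + h)%R by ring.
  apply homotopy_bound; lra.
Qed.

(** [N] steps of length [h = 1/N], each costing [O(h)]; the total does not grow with [N]. *)
Lemma lsum_homotopy (N : nat) : (0 < N)%nat -> (/ INR N <= h0)%R ->
  (Cmod (lsum (/ INR N) 1 - lsum (/ INR N) 0) <= 4 * (C2 * D0))%R.
Proof.
  intros HN Hh. assert (PN : (0 < INR N)%R) by (apply lt_0_INR, HN).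
  assert (Ph : (0 < / INR N)%R) by (apply Rinv_0_lt_compat, PN).
  set (h := (/ INR N)%R) in *.
  assert (HhN : (INR N * h = 1)%R) by (unfold h; field; lra).
  assert (G : forall i, (i <= N)%nat -> (Cmod (lsum h (INR i * h) - lsum h 0) <= 4 * (C2 * D0) * (INR i * h))%R).
  { induction i as [|i IH]; intros Hi.
    - simpl INR. rewrite Rmult_0_l. replace (lsum h 0 - lsum h 0) with (RtoC 0) by ring.
      rewrite Cmod_0. lra.
    - replace (lsum h (INR (S i) * h) - lsum h 0)
        with ((lsum h (INR i * h) - lsum h 0) + (lsum h (INR (S i) * h) - lsum h (INR i * h))) by ring.
      eapply Rle_trans; [apply Cmod_triangle|]. rewrite S_INR.
      replace ((INR i + 1) * h)%R with (INR i * h + h)%R by ring.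
      assert (Hi1 : (INR i + 1 <= INR N)%R) by (rewrite <- S_INR; apply le_INR, Hi).
      assert (HS : (INR i * h + h <= 1)%R) by nra.
      pose proof (lsum_step h (INR i * h) (conj Ph Hh) (Rmult_le_pos _ _ (pos_INR i) (Rlt_le _ _ Ph)) HS).
      specialize (IH ltac:(lia)). lra. }
  specialize (G N ltac:(lia)). rewrite HhN, Rmult_1_r in G. exact G.
Qed.

End Lines.

(** The sector [|arg r| < pi/4], where [r^2] has positive real part; [Csqrt] maps the right
    half-plane into it. *)
Definition sector (r : C) : Prop := (Rabs (Im r) < Re r)%R.

(** [Re - |Im|] is affine along the segment from 1 to [r], hence at least the smaller of its end
    values. This supplies [Hsector] for [rho = r - 1]. *)
Lemma sector_segment r t : (0 <= t <= 1)%R ->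
  (Rmin 1 (Re r - Rabs (Im r)) <=
   Re (1 + RtoC t * (r - 1)) - Rabs (Im (1 + RtoC t * (r - 1))))%R.
Proof.
  intros Ht.
  replace (Re (1 + RtoC t * (r - 1))) with (1 - t + t * Re r)%R
    by (rewrite re_plus, re_scal_l, Re_minus, !re_RtoC; ring).
  replace (Im (1 + RtoC t * (r - 1))) with (t * Im r)%R
    by (rewrite Im_plus, im_scal_l, Im_minus, !im_RtoC; ring).
  rewrite Rabs_mult, (Rabs_right t) by lra.
  pose proof (Rmin_l 1 (Re r - Rabs (Im r))). pose proof (Rmin_r 1 (Re r - Rabs (Im r))).
  set (m := Rmin 1 (Re r - Rabs (Im r))) in *.
  apply Rle_trans with ((1 - t) * m + t * m)%R; [apply Req_le; ring|]. nra.
Qed.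

Lemma sector_min r : sector r -> (0 < Rmin 1 (Re r - Rabs (Im r)))%R.
Proof. unfold sector; intros H. apply Rmin_pos; lra. Qed.

Lemma sector_neq0 r : sector r -> r <> 0.
Proof.
  intros H E. unfold sector in H. rewrite E in H. simpl in H. rewrite Rabs_R0 in H. lra.
Qed.

Lemma sector_1 : sector 1.
Proof. unfold sector; simpl. rewrite Rabs_R0; lra. Qed.

Lemma sector_inv r : sector r -> sector (/ r).
Proof.
  intros H. pose proof (sector_neq0 r H) as Hr. unfold sector in *. destruct r as [a b]. simpl in *.
  assert (P : (0 < a * (a * 1) + b * (b * 1))%R).
  { pose proof (Rabs_pos b). nra. }
  unfold Rdiv. rewrite Rabs_mult, Rabs_Ropp, (Rabs_right (/ _)) by (left; apply Rinv_0_lt_compat, P).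
  apply Rmult_lt_compat_r; [apply Rinv_0_lt_compat, P|exact H].
Qed.

Lemma line_end (r w : C) (x : R) : (1 + 1 * (r - 1)) * x + 1 * w = r * x + w.
Proof. ring. Qed.

Lemma sector_decay r w : sector r ->
  exists B : R, forall h, decay h B (fun k => gauss (r * (h * IZR k)%R + w)).
Proof.
  intros H. eexists. intros h k.
  pose proof (gauss_line_decay (r - 1) w _ (sector_min r H) (fun t => sector_segment r t) 1 (h * IZR k) 0
                ltac:(lra) ltac:(lia)) as D.
  cbv beta in D. rewrite line_end, pow_O, Rmult_1_r in D. exact D.
Qed.

Lemma sector_second_difference r : sector r ->
  exists C h0 : R, (0 < h0)%R /\ forall h, (0 <= h <= h0)%R ->
    decay h (C * h ^ 2) (fun k => gauss (r * (h * IZR (k + 1))%R) + gauss (r * (h * IZR (k - 1))%R)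
                                  - 2 * gauss (r * (h * IZR k)%R)).
Proof.
  intros H.
  pose proof (second_difference_bound (r - 1) 0 _ (sector_min r H) (fun t => sector_segment r t) 1) as D.
  pose proof (h0_pos (r - 1) 0 _ (sector_min r H)) as P.
  eexists. eexists. split; [exact P|]. intros h Hh k.
  specialize (D (h * IZR k)%R h ltac:(lra) Hh). cbv beta zeta in D.
  rewrite plus_IZR, minus_IZR, Rmult_plus_distr_l, Rmult_minus_distr_l, Rmult_1_r.
  assert (E : forall x : R, (1 + 1 * (r - 1)) * x + 1 * 0 = r * x) by (intros; ring).
  rewrite !E in D. exact D.
Qed.

Lemma sector_homotopy r w : sector r ->
  exists (C : R) (N0 : nat), forall N, (N0 <= N)%nat -> (0 < N)%nat ->
    (Cmod (r * ZSeries (fun k => gauss (r * (/ INR N * IZR k)%R + w))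
           - ZSeries (fun k => gauss ((/ INR N * IZR k)%R))) <= C)%R.
Proof.
  intros H.
  pose proof (lsum_homotopy (r - 1) w _ (sector_min r H) (fun t => sector_segment r t)) as D.
  pose proof (h0_pos (r - 1) w _ (sector_min r H)) as P. cbv zeta in D.
  destruct (archimed_cor1 _ P) as [N0 [HN0 HN0p]].
  eexists. exists N0. intros N HN HNp.
  assert (Hle : (/ INR N <= / INR N0)%R).
  { apply Rinv_le_contravar; [apply lt_0_INR, HN0p|apply le_INR, HN]. }
  specialize (D N HNp (Rle_trans _ _ _ Hle (Rlt_le _ _ HN0))).
  eapply Rle_trans; [|exact D]. apply Req_le. f_equal. f_equal.
  - symmetry. apply Clim_unique with (1 := lsum_lim (r - 1) w _ (sector_min r H) (fun t => sector_segment r t) (/ INR N) 1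
       (Rinv_0_lt_compat _ (lt_0_INR _ HNp)) (conj Rle_0_1 (Rle_refl 1))).
    destruct (sector_decay r w H) as [B HB].
    apply is_zsum_ext with (fun k => r * gauss (r * (/ INR N * IZR k)%R + w)).
    + intros k. rewrite line_end. f_equal. ring.
    + apply is_zsum_scal, decay_Clim with (h := (/ INR N)%R) (B := B); [|apply HB].
      apply Rinv_0_lt_compat, lt_0_INR, HNp.
  - f_equal. f_equal. apply functional_extensionality; intros k.
    replace ((1 + 0 * (r - 1)) * (/ INR N * IZR k)%R + 0 * w) with (RtoC (/ INR N * IZR k)%R) by ring.
    ring.
Qed.

(** * Finite Fourier analysis *)

Definition cis (x : R) : C := Cexp (2 * PI * Ci * x).

Lemma cis_plus x y : cis (x + y) = cis x * cis y.
Proof. unfold cis. rewrite <- Cexp_plus, RtoC_plus. f_equal. ring. Qed.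

Lemma cis_Z k : cis (IZR k) = 1.
Proof. apply Cexp_2PI_Z. Qed.

Lemma cis_0 : cis 0 = 1.
Proof. apply (cis_Z 0). Qed.

Lemma cis_val x : cis x = (cos (2 * PI * x), sin (2 * PI * x))%R.
Proof.
  unfold cis, Cexp.
  replace (Re (2 * PI * Ci * x)) with 0%R by (simpl; ring).
  replace (Im (2 * PI * Ci * x)) with (2 * PI * x)%R by (simpl; ring).
  rewrite exp_0, !Rmult_1_l. reflexivity.
Qed.

Lemma Cmod_cis x : Cmod (cis x) = 1%R.
Proof.
  unfold cis. rewrite Cmod_Cexp. replace (Re (2 * PI * Ci * x)) with 0%R by (simpl; ring). apply exp_0.
Qed.

Lemma cis_second_difference x : cis x + cis (- x) - 2 = RtoC (- (4 * sin (PI * x) ^ 2))%R.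
Proof.
  rewrite !cis_val. replace (2 * PI * - x)%R with (- (2 * PI * x))%R by ring.
  rewrite cos_neg, sin_neg. replace (2 * PI * x)%R with (2 * (PI * x))%R by ring.
  rewrite cos_2a_sin. apply injective_projections; simpl; ring.
Qed.

(** A crude form of Jordan's inequality from the alternating Taylor polynomial: since [x <= 2], the
    bracket left after taking out [x] is at least 1/4. *)
Lemma sin_lower x : (0 <= x <= PI / 2)%R -> (x / 4 <= sin x)%R.
Proof.
  intros Hx. pose proof PI_4 as HP. pose proof PI_ge_3 as HP3.
  assert (H : (sin_lb x <= sin x)%R) by (apply SIN; lra).
  apply Rle_trans with (2 := H).
  unfold sin_lb, sin_approx, sin_term. simpl.
  assert (Hx2 : (x <= 2)%R) by lra.
  assert (E : (0 <= x * x <= 4)%R) by nra.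
  set (s := (x * x)%R) in *.
  match goal with |- (_ <= ?e)%R => replace e with (x * (1 - s / 6 + s * s / 120 - s * s * s / 5040))%R by (unfold s; field) end.
  assert (1 / 4 <= 1 - s / 6 + s * s / 120 - s * s * s / 5040)%R by nra.
  nra.
Qed.

Lemma cis_neq1 x : (0 < x < 1)%R -> cis x <> 1.
Proof.
  intros Hx E. pose proof (cis_second_difference x) as H.
  assert (E' : cis (- x) = 1).
  { replace (cis (- x)) with (cis (- x) * cis x) by (rewrite E; ring).
    rewrite <- cis_plus. replace (- x + x)%R with 0%R by ring. apply cis_0. }
  rewrite E, E' in H. replace (1 + 1 - 2) with (RtoC 0) in H by ring. apply RtoC_inj in H.
  assert (0 < sin (PI * x))%R by (pose proof PI_RGT_0; apply sin_gt_0; nra).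
  assert (0 < sin (PI * x) ^ 2)%R by (apply pow_lt; assumption). lra.
Qed.

(** [N] is odd, so the symmetric window is a full residue system. Shifting it multiplies the sum by
    [cis x] but only exchanges the ends [-M] and [M + 1], which agree modulo [N]; for [cis x <> 1]
    the sum is therefore 0. *)
Lemma cis_orthogonality M m :
  let N := (2 * M + 1)%nat in
  zsum (fun k => cis (IZR k * (/ INR N * IZR m))) M =
  if Z.eqb (m mod Z.of_nat N) 0 then RtoC (INR N) else 0.
Proof.
  intros N. assert (HN : (0 < INR N)%R) by (apply lt_0_INR; lia).
  pose proof (Z_div_mod_eq_full m (Z.of_nat N)) as Hm.
  pose proof (Z.mod_pos_bound m (Z.of_nat N) ltac:(lia)) as Hj.
  set (j := (m mod Z.of_nat N)%Z) in *. set (d := (m / Z.of_nat N)%Z) in *.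
  assert (Ex : (/ INR N * IZR m = IZR d + IZR j / INR N)%R).
  { rewrite Hm, plus_IZR, mult_IZR, <- INR_IZR_INZ. field. lra. }
  rewrite Ex. set (x := (IZR j / INR N)%R).
  rewrite (zsum_ext _ (fun k => cis (IZR k * x))).
  2: { intros k _. rewrite Rmult_plus_distr_l, cis_plus, <- mult_IZR, cis_Z. ring. }
  destruct (Z.eqb_spec j 0) as [Hj0|Hj0].
  - assert (Hx : x = 0%R) by (unfold x; rewrite Hj0; unfold Rdiv; ring).
    rewrite Hx, (zsum_ext _ (fun _ => 1)) by (intros; rewrite Rmult_0_r; apply cis_0).
    unfold N. clear. induction M as [|M IH]; [simpl; reflexivity|].
    cbn [zsum]. rewrite IH. replace (2 * S M + 1)%nat with (S (S (2 * M + 1))) by lia.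
    rewrite !S_INR, !RtoC_plus. ring.
  - assert (Hx : (0 < x < 1)%R).
    { unfold x. assert (0 < IZR j)%R by (apply IZR_lt; lia).
      assert (IZR j < INR N)%R by (rewrite INR_IZR_INZ; apply IZR_lt; lia).
      split; [apply Rdiv_lt_0_compat; lra|].
      apply Rmult_lt_reg_r with (INR N); [lra|]. unfold Rdiv.
      rewrite Rmult_assoc, Rinv_l by lra. lra. }
    pose proof (zsum_succ (fun k => cis (IZR k * x)) M) as T. cbv beta in T.
    rewrite (zsum_ext _ (fun k => cis x * cis (IZR k * x))), zsum_scal in T.
    2: { intros k _. rewrite plus_IZR, Rmult_plus_distr_r, cis_plus, Rmult_1_l. ring. }
    assert (P : cis (IZR (Z.of_nat (S M)) * x) = cis (IZR (- Z.of_nat M) * x)).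
    { replace (Z.of_nat (S M)) with (- Z.of_nat M + Z.of_nat N)%Z by lia.
      rewrite plus_IZR, Rmult_plus_distr_r, cis_plus.
      replace (IZR (Z.of_nat N) * x)%R with (IZR j)
        by (unfold x; rewrite <- INR_IZR_INZ; field; lra).
      rewrite cis_Z. ring. }
    rewrite P in T. set (z := zsum (fun k => cis (IZR k * x)) M) in *.
    assert (Z0 : (cis x - 1) * z = 0).
    { replace ((cis x - 1) * z) with (cis x * z - z) by ring. rewrite T. ring. }
    destruct (Ceq_dec z 0) as [|Hz]; [assumption|]. exfalso.
    revert Z0. apply Cmult_neq_0; [|exact Hz].
    apply Cminus_eq_contra, cis_neq1, Hx.
Qed.

Lemma zsum_multiples f N J : (0 < N)%nat ->
  zsum (fun m => if Z.eqb (m mod Z.of_nat N) 0 then f m else 0) (N * J) =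
  zsum (fun j => f (Z.of_nat N * j)%Z) J.
Proof.
  intros HN. set (g := fun m => if Z.eqb (m mod Z.of_nat N) 0 then f m else 0).
  induction J as [|J IH].
  - rewrite Nat.mul_0_r. cbn [zsum]. unfold g. rewrite Z.mod_0_l, Z.mul_0_r by lia. reflexivity.
  - assert (G : forall i, (i < N)%nat -> zsum g (N * J + i) = zsum g (N * J)).
    { induction i as [|i IHi]; intros Hi; [f_equal; lia|].
      rewrite Nat.add_succ_r. cbn [zsum]. rewrite IHi by lia.
      assert (Hz : forall m, (Z.abs m = Z.of_nat (S (N * J + i)))%Z -> g m = 0).
      { intros m Hm. unfold g. destruct (Z.eqb_spec (m mod Z.of_nat N) 0) as [E|]; [|reflexivity].
        exfalso. apply Z.mod_divide in E; [|lia]. apply Z.divide_abs_r in E. destruct E as [c Hc].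
        rewrite Hm in Hc. assert (Z.of_nat (S (N * J + i)) = Z.of_nat N * Z.of_nat J + Z.of_nat (S i))%Z by lia.
        assert (Z.of_nat J < c)%Z by nia. assert (c < Z.of_nat J + 1)%Z by nia. lia. }
      rewrite !Hz by lia. ring. }
    replace (N * S J)%nat with (S (N * J + (N - 1))) by lia.
    cbn [zsum]. rewrite G, IH by lia.
    replace (Z.of_nat (S (N * J + (N - 1)))) with (Z.of_nat N * Z.of_nat (S J))%Z by lia.
    rewrite <- Z.mul_opp_r. unfold g.
    rewrite !(Z.mul_comm (Z.of_nat N)), !Z.mod_mul by lia. cbn [Z.eqb]. reflexivity.
Qed.

(** Not normalised: [1/N] times it is a Riemann sum of mesh [1/N] for the Fourier transform of
    [x -> gauss (r x)] at the frequency [k]. *)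
Definition dft (r : C) (N : nat) (k : Z) : C :=
  ZSeries (fun m => gauss (r * (/ INR N * IZR m)%R) * cis (IZR k * (/ INR N * IZR m))).

Lemma inv_INR_bounds N : (0 < N)%nat -> (0 < / INR N <= 1)%R.
Proof.
  intros H. split; [apply Rinv_0_lt_compat, lt_0_INR, H|].
  rewrite <- Rinv_1. apply Rinv_le_contravar; [lra|]. apply (le_INR 1); lia.
Qed.

Lemma gauss_decay r : sector r -> exists B : R, forall h, decay h B (fun k => gauss (r * (h * IZR k)%R)).
Proof.
  intros H. destruct (sector_decay r 0 H) as [B HB]. exists B. intros h k.
  specialize (HB h k). cbv beta in HB. rewrite Cplus_0_r in HB. exact HB.
Qed.

Lemma dft_sum r N k : sector r -> (0 < N)%nat ->
  is_zsum (fun m => gauss (r * (/ INR N * IZR m)%R) * cis (IZR k * (/ INR N * IZR m))) (dft r N k).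
Proof.
  intros H HN. destruct (gauss_decay r H) as [B HB].
  apply decay_Clim with (/ INR N)%R B; [apply inv_INR_bounds, HN|].
  intros m. rewrite Cmod_mult, Cmod_cis, Rmult_1_r. apply HB.
Qed.

(** By orthogonality the sum over the frequencies kills the samples at those points [m/N] that are
    not integers. *)
Lemma dft_inversion r M : sector r ->
  let N := (2 * M + 1)%nat in
  zsum (dft r N) M = INR N * ZSeries (fun n => gauss (r * IZR n)).
Proof.
  intros H N. assert (HN : (0 < N)%nat) by lia.
  set (G := fun k m => gauss (r * (/ INR N * IZR m)%R) * cis (IZR k * (/ INR N * IZR m))).
  assert (E : forall J, is_zsum (fun m => zsum (fun k => G k m) J) (zsum (dft r N) J)).
  { induction J as [|J IH]; cbn [zsum]; [apply dft_sum; assumption|].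
    apply is_zsum_plus; [exact IH|]. apply is_zsum_plus; apply dft_sum; assumption. }
  specialize (E M).
  apply Clim_unique with (u := fun J => zsum (fun m => zsum (fun k => G k m) M) (N * J)).
  { apply (Clim_subseq (zsum _) _ (fun J => N * J)%nat); [intros; nia|exact E]. }
  destruct (gauss_decay r H) as [B HB].
  assert (F : is_zsum (fun n => gauss (r * IZR n)) (ZSeries (fun n => gauss (r * IZR n)))).
  { apply decay_Clim with 1%R B; [lra|]. intros m. specialize (HB 1%R m). rewrite !Rmult_1_l in *. exact HB. }
  apply Clim_ext with (2 := Clim_scal (INR N) _ _ F). intros J.
  rewrite <- zsum_scal.
  rewrite (zsum_ext (fun m => zsum (fun k => G k m) M)
    (fun m => if Z.eqb (m mod Z.of_nat N) 0 then gauss (r * (/ INR N * IZR m)%R) * INR N else 0)).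
  2: { intros m _. unfold G. rewrite zsum_scal. unfold N. rewrite cis_orthogonality.
       fold N. destruct Z.eqb; ring. }
  rewrite (zsum_multiples (fun m => gauss (r * (/ INR N * IZR m)%R) * INR N)) by exact HN.
  apply zsum_ext. intros j _. rewrite mult_IZR, <- INR_IZR_INZ.
  replace (/ INR N * (INR N * IZR j))%R with (IZR j); [ring|].
  field. apply not_0_INR; lia.
Qed.

(** Summation by parts twice: second differences of the samples multiply the coefficient by
    [-4 sin^2(pi k/N)], of size at least [k^2/N^2], whereas these differences are [O(1/N^2)] and
    their sum [O(1/N)]. The range [2|k| <= N] keeps the sine away from its next zero. *)
Lemma dft_bound r : sector r ->
  exists (C : R) (N0 : nat), forall N k, (N0 <= N)%nat -> (0 < N)%nat -> k <> 0%Z ->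
    (2 * Z.abs k <= Z.of_nat N)%Z -> (Cmod (dft r N k) <= C * INR N / IZR k ^ 2)%R.
Proof.
  intros H. destruct (sector_second_difference r H) as [C [h0 [Hh0 HC]]].
  destruct (archimed_cor1 _ Hh0) as [N0 [HN0 HN0p]].
  destruct (gauss_decay r H) as [B HB].
  exists (4 * C)%R, N0. intros N k HN HNp Hk0 Hk.
  destruct (inv_INR_bounds N HNp) as [Hh Hh1].
  assert (Hhh0 : (/ INR N <= h0)%R).
  { apply Rle_trans with (/ INR N0)%R; [|lra].
    apply Rinv_le_contravar; [apply lt_0_INR, HN0p|apply le_INR, HN]. }
  assert (HNI : INR N = (/ / INR N)%R) by (symmetry; apply Rinv_inv).
  set (h := (/ INR N)%R) in *.
  set (f := fun m => gauss (r * (h * IZR m)%R) * cis (IZR k * (h * IZR m))).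
  assert (Df : decay h B f).
  { intros m. unfold f. rewrite Cmod_mult, Cmod_cis, Rmult_1_r. apply HB. }
  pose proof (dft_sum r N k H HNp : is_zsum f (dft r N k)) as S0.
  pose proof (is_zsum_succ h B f _ Hh Df S0) as S1.
  pose proof (is_zsum_pred h B f _ Hh Df S0) as S2.
  (* The phases undo the shift of the character, so that the combination [T] consists of second
     differences of the Gaussian times the unshifted character. *)
  apply (is_zsum_scal (cis (- (IZR k * h)))) in S1.
  apply (is_zsum_scal (cis (IZR k * h))) in S2.
  apply (is_zsum_scal 2) in S0.
  pose proof (is_zsum_minus _ _ _ _ (is_zsum_plus _ _ _ _ S1 S2) S0) as T.
  set (D := dft r N k) in *.
  replace (cis (- (IZR k * h)) * D + cis (IZR k * h) * D - 2 * D)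
    with ((cis (IZR k * h) + cis (- (IZR k * h)) - 2) * D) in T by ring.
  rewrite cis_second_difference in T.
  assert (L : (Cmod (RtoC (- (4 * sin (PI * (IZR k * h)) ^ 2))%R * D) <= 4 * (C * h ^ 2) / h)%R).
  { refine (decay_lim_bound h _ _ _ (conj Hh Hh1) _ T). intros m.
    specialize (HC h (conj (Rlt_le _ _ Hh) Hhh0) m). cbv beta in HC.
    match goal with |- (Cmod ?u <= _)%R =>
      replace u with ((gauss (r * (h * IZR (m + 1))%R) + gauss (r * (h * IZR (m - 1))%R)
                       - 2 * gauss (r * (h * IZR m)%R)) * cis (IZR k * (h * IZR m))) end.
    { rewrite Cmod_mult, Cmod_cis, Rmult_1_r. exact HC. }
    unfold f. rewrite plus_IZR, minus_IZR.
    replace (IZR k * (h * (IZR m + 1)))%R with (IZR k * (h * IZR m) + IZR k * h)%R by ring.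
    replace (IZR k * (h * (IZR m - 1)))%R with (IZR k * (h * IZR m) + - (IZR k * h))%R by ring.
    rewrite !cis_plus.
    assert (U : cis (IZR k * h) * cis (- (IZR k * h)) = 1).
    { rewrite <- cis_plus. rewrite Rplus_opp_r. apply cis_0. }
    set (u := cis (IZR k * h)) in *. set (v := cis (- (IZR k * h))) in *.
    set (g1 := gauss (r * (h * (IZR m + 1))%R)). set (g2 := gauss (r * (h * (IZR m - 1))%R)).
    set (g := gauss (r * (h * IZR m)%R)). set (c := cis (IZR k * (h * IZR m))).
    transitivity ((u * v) * (g1 * c) + (u * v) * (g2 * c) - 2 * (g * c)); [rewrite U; ring|ring]. }
  (* With [u = |k| h <= 1/2]: [sin(pi u) >= pi u/4 >= u/2]. *)
  assert (Hs : (IZR k ^ 2 * h ^ 2 <= 4 * sin (PI * (IZR k * h)) ^ 2)%R).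
  { assert (Q : (sin (PI * (IZR k * h)) ^ 2 = sin (PI * (Rabs (IZR k) * h)) ^ 2)%R).
    { unfold Rabs; destruct Rcase_abs; [|reflexivity].
      replace (PI * (- IZR k * h))%R with (- (PI * (IZR k * h)))%R by ring.
      rewrite sin_neg. ring. }
    rewrite Q. replace (IZR k ^ 2)%R with (Rabs (IZR k) ^ 2)%R
      by (symmetry; apply sqr_abs).
    set (s := Rabs (IZR k)). assert (Ps : (0 <= s)%R) by apply Rabs_pos.
    assert (Bs : (s * h <= / 2)%R).
    { unfold s. rewrite <- abs_IZR. apply IZR_le in Hk. rewrite mult_IZR, <- INR_IZR_INZ in Hk.
      apply Rmult_le_reg_r with (INR N); [apply lt_0_INR, HNp|].
      rewrite Rmult_assoc. unfold h. rewrite Rinv_l by (apply not_0_INR; lia). lra. }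
    pose proof PI_ge_3 as HP.
    assert (Psh : (0 <= s * h)%R) by (apply Rmult_le_pos; lra).
    assert (L1 : (PI * (s * h) / 4 <= sin (PI * (s * h)))%R) by (apply sin_lower; split; nra).
    replace (s ^ 2 * h ^ 2)%R with ((s * h) ^ 2)%R by ring.
    assert (L2 : (s * h / 2 <= sin (PI * (s * h)))%R) by nra.
    assert (L3 : ((s * h / 2) ^ 2 <= sin (PI * (s * h)) ^ 2)%R) by (apply pow_incr; lra).
    replace ((s * h / 2) ^ 2)%R with ((s * h) ^ 2 / 4)%R in L3 by field. lra. }
  rewrite Cmod_mult, Cmod_R, Rabs_Ropp, Rabs_right in L
    by (apply Rle_ge, Rmult_le_pos; [lra|apply pow2_ge_0]).
  assert (Pk : (0 < IZR k ^ 2)%R) by (apply pow2_gt_0, not_0_IZR, Hk0).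
  assert (Ph2 : (0 < h ^ 2)%R) by (apply pow_lt, Hh).
  rewrite HNI. apply Rmult_le_reg_l with (IZR k ^ 2 * h ^ 2)%R; [apply Rmult_lt_0_compat; assumption|].
  replace (IZR k ^ 2 * h ^ 2 * (4 * C * / h / IZR k ^ 2))%R with (4 * (C * h ^ 2) / h)%R
    by (field; split; [lra|apply not_0_IZR, Hk0]).
  apply Rle_trans with (2 := L). apply Rmult_le_compat_r; [apply Cmod_ge_0|exact Hs].
Qed.

(** Telescoping, [1/(n+1)^2 <= 1/n - 1/(n+1)], with a factor 2 for the two signs. *)
Lemma zsum_tail_bound (f : Z -> C) (B : R) K M : (0 <= B)%R -> (0 < K)%nat -> (K <= M)%nat ->
  (forall k, k <> 0%Z -> (Z.abs k <= Z.of_nat M)%Z -> (Cmod (f k) <= B / IZR k ^ 2)%R) ->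
  (Cmod (zsum f M - zsum f K) <= 2 * B * (/ INR K - / INR M))%R.
Proof.
  intros HB HK HKM. induction HKM as [|M HKM IH]; intros H.
  - replace (zsum f K - zsum f K) with (RtoC 0) by ring. rewrite Cmod_0. lra.
  - cbn [zsum].
    replace (zsum f M + (f (Z.of_nat (S M)) + f (- Z.of_nat (S M))%Z) - zsum f K)
      with ((zsum f M - zsum f K) + (f (Z.of_nat (S M)) + f (- Z.of_nat (S M))%Z)) by ring.
    eapply Rle_trans; [apply Cmod_triangle|].
    pose proof (IH ltac:(intros; apply H; lia)) as IH'.
    pose proof (H (Z.of_nat (S M)) ltac:(lia) ltac:(lia)) as H1.
    pose proof (H (- Z.of_nat (S M))%Z ltac:(lia) ltac:(lia)) as H2.
    pose proof (Cmod_triangle (f (Z.of_nat (S M))) (f (- Z.of_nat (S M))%Z)) as T.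
    rewrite opp_IZR in H2. replace ((- IZR (Z.of_nat (S M))) ^ 2)%R with (IZR (Z.of_nat (S M)) ^ 2)%R in H2 by ring.
    rewrite <- INR_IZR_INZ in H1, H2.
    assert (PM : (0 < INR M)%R) by (apply lt_0_INR; lia).
    assert (Q : (B / INR (S M) ^ 2 <= B * (/ INR M - / INR (S M)))%R).
    { apply Rmult_le_compat_l; [exact HB|]. rewrite S_INR.
      replace (/ INR M - / (INR M + 1))%R with (/ (INR M * (INR M + 1)))%R by (field; lra).
      apply Rinv_le_contravar; [apply Rmult_lt_0_compat; lra|]. nra. }
    lra.
Qed.

Lemma tannery (c : nat -> Z -> C) (B : R) (M0 : nat) : (0 <= B)%R ->
  (forall M k, (M0 <= M)%nat -> k <> 0%Z -> (Z.abs k <= Z.of_nat M)%Z ->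
     (Cmod (c M k) <= B / IZR k ^ 2)%R) ->
  (forall k, is_lim_seq (fun M => Cmod (c M k)) 0%R) ->
  is_lim_seq (fun M => Cmod (zsum (c M) M)) 0%R.
Proof.
  intros HB Hb Hl. apply is_lim_seq_spec. intros eps.
  (* Chosen so that the tail beyond [K], at most [2 B/K], is below [eps/2]; [B + 1] guards against
     [B = 0]. *)
  destruct (archimed_cor1 (eps / (4 * (B + 1)))) as [K [HK HKp]].
  { apply Rdiv_lt_0_compat; [apply cond_pos|lra]. }
  assert (F : is_lim_seq (fun M => Cmod (zsum (c M) K)) 0%R).
  { clear HK HKp. induction K as [|K IH]; [apply Hl|].
    generalize (lim0_plus _ _ IH (lim0_plus _ _ (Hl (Z.of_nat (S K))) (Hl (- Z.of_nat (S K))%Z))).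
    apply lim0_le. intros n; split; [apply Cmod_ge_0|]. cbn [zsum].
    eapply Rle_trans; [apply Cmod_triangle|]. apply Rplus_le_compat_l, Cmod_triangle. }
  apply is_lim_seq_spec in F. destruct (F (pos_div_2 eps)) as [N1 HN1].
  exists (M0 + K + N1)%nat. intros M HM.
  specialize (HN1 M ltac:(lia)). rewrite Rminus_0_r, Rabs_right in * by (apply Rle_ge, Cmod_ge_0).
  simpl in HN1.
  pose proof (zsum_tail_bound (c M) B K M HB HKp ltac:(lia) (fun k => Hb M k ltac:(lia))) as T.
  pose proof (Cmod_triangle (zsum (c M) K) (zsum (c M) M - zsum (c M) K)) as T2.
  replace (zsum (c M) K + (zsum (c M) M - zsum (c M) K)) with (zsum (c M) M) in T2 by ring.
  assert (0 < / INR M)%R by (apply Rinv_0_lt_compat, lt_0_INR; lia).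
  assert (PK : (0 < / INR K)%R) by (apply Rinv_0_lt_compat, lt_0_INR, HKp).
  assert (Q : (2 * B * / INR K < eps / 2)%R).
  { apply Rmult_lt_compat_l with (r := (2 * (B + 1))%R) in HK; [|lra].
    replace (2 * (B + 1) * (eps / (4 * (B + 1))))%R with (eps / 2)%R in HK by (field; lra). nra. }
  assert (2 * B * (/ INR K - / INR M) <= 2 * B * / INR K)%R by (apply Rmult_le_compat_l; lra).
  lra.
Qed.

(** * Poisson summation for [exp(-pi r^2 x^2)] *)

Definition gsum (r : C) : C := ZSeries (fun n => gauss (r * IZR n)).

Lemma gsum_decay r : sector r -> exists B : R, decay 1 B (fun n => gauss (r * IZR n)).
Proof.
  intros H. destruct (gauss_decay r H) as [B HB]. exists B. intros m.
  specialize (HB 1%R m). rewrite !Rmult_1_l in *. exact HB.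
Qed.

Lemma gsum_lim r : sector r -> is_zsum (fun n => gauss (r * IZR n)) (gsum r).
Proof.
  intros H. destruct (gsum_decay r H) as [B HB]. apply decay_Clim with (2 := HB). lra.
Qed.

Definition riemann_gauss (N : nat) : C := / INR N * ZSeries (fun k => gauss (/ INR N * IZR k)%R).

Lemma riemann_gauss_bound : exists B : R, forall N, (0 < N)%nat -> (Cmod (riemann_gauss N) <= B)%R.
Proof.
  destruct (gauss_decay 1 sector_1) as [B HB]. exists (4 * B)%R. intros N HN.
  destruct (inv_INR_bounds N HN) as [Hh Hh1]. unfold riemann_gauss.
  assert (D : decay (/ INR N) B (fun k => gauss (/ INR N * IZR k)%R)).
  { intros k. specialize (HB (/ INR N)%R k). cbv beta in HB. rewrite Cmult_1_l in HB. exact HB. }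
  pose proof (decay_lim_bound _ _ _ _ (conj Hh Hh1) D (decay_Clim _ _ _ Hh D)) as L.
  assert (PN : (0 < INR N)%R) by (apply lt_0_INR, HN).
  rewrite <- RtoC_inv by lra. rewrite Cmod_mult, Cmod_R, Rabs_right by lra.
  apply Rmult_le_compat_l with (r := (/ INR N)%R) in L; [|lra].
  eapply Rle_trans; [exact L|]. apply Req_le. field. lra.
Qed.

(** Completing the square, [gauss (r x) * cis (k x)] is [gauss (k/r)] times [gauss (r x - i k/r)].
    The homotopy moves this line to the real axis with bounded error, which the factor [1/N] sends
    to 0. *)
Lemma dft_limit r k : sector r ->
  is_lim_seq (fun M => let N := (2 * M + 1)%nat in
    Cmod (/ INR N * dft r N k - riemann_gauss N * (/ r * gauss (/ r * IZR k)))) 0%R.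
Proof.
  intros H. pose proof (sector_neq0 r H) as Hr.
  destruct (sector_homotopy r (- (Ci * IZR k / r)) H) as [C [N0 HC]].
  set (a := gauss (/ r * IZR k)).
  assert (E : forall N, (0 < N)%nat ->
    a * ZSeries (fun m => gauss (r * (/ INR N * IZR m)%R + - (Ci * IZR k / r))) = dft r N k).
  { intros N HN. destruct (sector_decay r (- (Ci * IZR k / r)) H) as [B HB].
    apply Clim_unique with (2 := dft_sum r N k H HN).
    apply is_zsum_ext with (fun m => a * gauss (r * (/ INR N * IZR m)%R + - (Ci * IZR k / r))).
    - intros m. unfold a, gauss, cis. rewrite <- !Cexp_plus. f_equal.
      rewrite (RtoC_mult (IZR k)). set (x := (/ INR N * IZR m)%R).
      assert (CI : Ci * Ci = -1) by (apply injective_projections; simpl; ring).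
      (* [Ci] is an atom for [field]; the two exponents differ by a multiple of [1 + Ci * Ci]. *)
      transitivity (- (PI * (r * x) ^ 2) + 2 * PI * Ci * (IZR k * x)
        - PI * (1 + Ci * Ci) * (IZR k * / r) ^ 2).
      + simpl. field. exact Hr.
      + rewrite CI. ring.
    - apply is_zsum_scal. apply decay_Clim with (/ INR N)%R B; [apply inv_INR_bounds, HN|apply HB]. }
  assert (L : is_lim_seq (fun M => (Cmod a * / Cmod r * Rabs C) * / INR (S M))%R 0%R).
  { apply lim0_scal. apply lim_inv_INR. }
  apply is_lim_seq_ext_loc with
    (u := fun M => if le_lt_dec N0 (2 * M + 1) then
       (Cmod (/ INR (2 * M + 1) * dft r (2 * M + 1) k - riemann_gauss (2 * M + 1) * (/ r * a))) else 0%R).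
  { exists N0. intros M HM. destruct le_lt_dec; [reflexivity|lia]. }
  revert L. apply lim0_le. intros M.
  assert (HN : (0 < 2 * M + 1)%nat) by lia.
  set (N := (2 * M + 1)%nat) in *.
  assert (Pr : (0 < / Cmod r)%R) by (apply Rinv_0_lt_compat, Cmod_gt_0, Hr).
  assert (PSM : (0 < / INR (S M))%R) by (apply Rinv_0_lt_compat, lt_0_INR; lia).
  assert (PA : (0 <= Cmod a * / Cmod r)%R) by (apply Rmult_le_pos; [apply Cmod_ge_0|lra]).
  destruct le_lt_dec as [HN0|HN0].
  2: { split; [lra|]. apply Rmult_le_pos; [|lra]. apply Rmult_le_pos; [exact PA|apply Rabs_pos]. }
  split; [apply Cmod_ge_0|].
  specialize (HC N HN0 HN). rewrite <- (E N HN). unfold riemann_gauss.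
  set (X := ZSeries (fun m => gauss (r * (/ INR N * IZR m)%R + - (Ci * IZR k / r)))) in *.
  set (Y := ZSeries (fun k0 => gauss (/ INR N * IZR k0)%R)) in *.
  replace (/ INR N * (a * X) - / INR N * Y * (/ r * a)) with (a * / r * (r * X - Y) * / INR N).
  2: { field. split; [exact Hr|]. intros Q. apply RtoC_inj in Q. revert Q. apply not_0_INR; lia. }
  assert (PN : (0 < INR N)%R) by (apply lt_0_INR, HN).
  rewrite <- RtoC_inv by lra.
  rewrite !Cmod_mult, Cmod_inv, Cmod_R by exact Hr.
  assert (HI : (0 < / INR N <= / INR (S M))%R).
  { split; [apply Rinv_0_lt_compat, PN|]. apply Rinv_le_contravar; [apply lt_0_INR; lia|]. apply le_INR; unfold N; lia. }
  rewrite Rabs_right by lra.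
  apply Rmult_le_compat; try lra.
  - apply Rmult_le_pos; [exact PA|apply Cmod_ge_0].
  - apply Rmult_le_compat_l; [exact PA|]. apply Rle_trans with (1 := HC). apply Rle_abs.
Qed.

Lemma inv_sqr_shift k : k <> 0%Z -> (/ (1 + Rabs (1 * IZR k)) ^ 2 <= / IZR k ^ 2)%R.
Proof.
  intros Hk. rewrite Rmult_1_l.
  replace (IZR k ^ 2)%R with (Rabs (IZR k) ^ 2)%R
    by (symmetry; apply sqr_abs).
  assert (0 < Rabs (IZR k))%R by (apply Rabs_pos_lt, not_0_IZR, Hk).
  apply Rinv_le_contravar; [apply pow_lt; lra|]. apply pow_incr; lra.
Qed.

(* The Riemann sums [riemann_gauss] converge to the Gaussian integral, whose
   value is only determined afterwards by taking [r = 1]. *)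
Lemma poisson_limit r : sector r ->
  Clim (fun M => riemann_gauss (2 * M + 1) * (/ r * gsum (/ r))) (gsum r).
Proof.
  intros H. pose proof (sector_neq0 r H) as Hr. pose proof (sector_inv r H) as Hi.
  destruct riemann_gauss_bound as [BR HBR].
  destruct (dft_bound r H) as [CD [N0 HCD]].
  destruct (gsum_decay (/ r) Hi) as [BG HBG].
  pose proof (decay_nonneg _ _ _ HBG) as PBG.
  assert (PBR : (0 <= BR)%R) by (apply Rle_trans with (2 := HBR 1%nat ltac:(lia)), Cmod_ge_0).
  (* Normalised Fourier coefficient minus its asymptotic value. The first is dominated through
     [dft_bound], the second through the decay of the dual Gaussian. *)
  set (c := fun M k => / INR (2 * M + 1) * dft r (2 * M + 1) k
                       - riemann_gauss (2 * M + 1) * (/ r * gauss (/ r * IZR k))).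
  assert (Pr : (0 < / Cmod r)%R) by (apply Rinv_0_lt_compat, Cmod_gt_0, Hr).
  set (B2 := (BR * (/ Cmod r * BG))%R).
  assert (PB2 : (0 <= B2)%R) by (unfold B2; apply Rmult_le_pos; [exact PBR|apply Rmult_le_pos; lra]).
  assert (T : is_lim_seq (fun M => Cmod (zsum (c M) M)) 0%R).
  { apply tannery with (Rabs CD + B2)%R N0.
    - pose proof (Rabs_pos CD). lra.
    - intros M k HM Hk0 Hk. unfold c. set (N := (2 * M + 1)%nat).
      assert (HN : (0 < N)%nat) by (unfold N; lia).
      assert (PN : (0 < INR N)%R) by (apply lt_0_INR, HN).
      assert (Pk : (0 < IZR k ^ 2)%R) by (apply pow2_gt_0, not_0_IZR, Hk0).
      assert (Pk' : (0 < / IZR k ^ 2)%R) by (apply Rinv_0_lt_compat, Pk).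
      eapply Rle_trans; [apply Cmod_triangle|]. rewrite Cmod_opp, !Cmod_mult.
      rewrite <- RtoC_inv, Cmod_R, Cmod_inv by (exact Hr || lra).
      rewrite (Rabs_right (/ INR N)) by (left; apply Rinv_0_lt_compat, PN).
      unfold Rdiv. rewrite Rmult_plus_distr_r. apply Rplus_le_compat.
      + specialize (HCD N k ltac:(unfold N; lia) HN Hk0 ltac:(unfold N; lia)).
        apply Rmult_le_compat_l with (r := (/ INR N)%R) in HCD; [|left; apply Rinv_0_lt_compat, PN].
        apply Rle_trans with (1 := HCD).
        replace (/ INR N * (CD * INR N / IZR k ^ 2))%R with (CD * / IZR k ^ 2)%R
          by (field; split; [apply not_0_IZR, Hk0|lra]).
        apply Rmult_le_compat_r; [lra|apply Rle_abs].
      + unfold B2. rewrite Rmult_assoc. apply Rmult_le_compat.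
        * apply Cmod_ge_0.
        * apply Rmult_le_pos; [lra|apply Cmod_ge_0].
        * apply HBR, HN.
        * rewrite Rmult_assoc. apply Rmult_le_compat_l; [lra|].
          eapply Rle_trans; [apply HBG|]. unfold Rdiv. apply Rmult_le_compat_l; [exact PBG|].
          apply inv_sqr_shift, Hk0.
    - intros k. apply dft_limit, H. }
  assert (E : forall M, zsum (c M) M =
     gsum r - riemann_gauss (2 * M + 1) * (/ r * zsum (fun k => gauss (/ r * IZR k)) M)).
  { intros M. unfold c. set (N := (2 * M + 1)%nat).
    rewrite (zsum_ext _ (fun k => / INR N * dft r N k + (- riemann_gauss N * / r) * gauss (/ r * IZR k)))
      by (intros; ring).
    rewrite zsum_plus, !zsum_scal. unfold N at 2. rewrite dft_inversion by exact H. fold N (gsum r).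
    assert (PN : RtoC (INR N) <> 0).
    { intros Q. apply RtoC_inj in Q. revert Q. apply not_0_INR. unfold N; lia. }
    field. split; assumption. }
  pose proof (gsum_lim _ Hi) as G. unfold is_zsum, Clim in G.
  generalize (lim0_plus _ _ T (lim0_scal (BR * / Cmod r) _ G)). apply lim0_le.
  intros M. split; [apply Cmod_ge_0|]. rewrite E.
  set (N := (2 * M + 1)%nat). set (z := zsum (fun k => gauss (/ r * IZR k)) M).
  replace (riemann_gauss N * (/ r * gsum (/ r)) - gsum r)
    with (- (gsum r - riemann_gauss N * (/ r * z)) + - (riemann_gauss N * / r * (z - gsum (/ r)))) by ring.
  eapply Rle_trans; [apply Cmod_triangle|]. rewrite !Cmod_opp. apply Rplus_le_compat_l.
  rewrite !Cmod_mult, Cmod_inv by exact Hr. apply Rmult_le_compat_r; [apply Cmod_ge_0|].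
  apply Rmult_le_compat_r; [lra|]. apply HBR. unfold N; lia.
Qed.

(** All terms have nonnegative real part and the central one is 1. *)
Lemma gsum_1_neq0 : gsum 1 <> 0.
Proof.
  intros E. pose proof (gsum_lim 1 sector_1) as H. apply Clim_Re in H. rewrite E in H.
  assert (P : forall k, (0 <= Re (gauss (1 * IZR k)))%R).
  { intros k. rewrite Cmult_1_l. unfold gauss.
    replace (- (PI * IZR k ^ 2)) with (RtoC (- (PI * IZR k ^ 2))) by (rewrite RtoC_opp, RtoC_mult, RtoC_pow; reflexivity).
    unfold Cexp. simpl. rewrite cos_0, Rmult_1_r. left; apply exp_pos. }
  assert (L : Rbar_le 1%R 0%R).
  { refine (is_lim_seq_le (fun _ => 1%R) _ 1%R 0%R _ (is_lim_seq_const 1%R) H).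
    intros n. induction n as [|n IH]; cbn [zsum].
    - rewrite Cmult_1_l. unfold gauss. replace (- (PI * 0 ^ 2)) with (RtoC 0) by (simpl; ring).
      rewrite Cexp_0. simpl. lra.
    - rewrite !re_plus. pose proof (P (Z.of_nat (S n))). pose proof (P (- Z.of_nat (S n))%Z). lra. }
  simpl in L. lra.
Qed.

(** At [r = 1] the Riemann sums times [gsum 1] tend to [gsum 1], which is nonzero; so they tend to
    1, and uniqueness of limits gives every other [r]. *)
Theorem poisson_gauss r : sector r -> r * gsum r = gsum (/ r).
Proof.
  intros H. pose proof (sector_neq0 r H) as Hr.
  pose proof (poisson_limit 1 sector_1) as L1.
  assert (I1 : / 1 = 1) by (apply injective_projections; simpl; field).
  rewrite I1 in L1. rewrite Cmult_1_l in L1.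
  assert (L : Clim (fun M => riemann_gauss (2 * M + 1)) 1).
  { apply Clim_scal with (c := / gsum 1) in L1. rewrite Cinv_l in L1 by apply gsum_1_neq0.
    apply Clim_ext with (2 := L1). intros n. field. apply gsum_1_neq0. }
  pose proof (poisson_limit r H) as L2.
  apply Clim_scal with (c := / r * gsum (/ r)) in L.
  rewrite Cmult_1_r in L.
  assert (E : gsum r = / r * gsum (/ r)).
  { apply Clim_unique with (1 := L2). apply Clim_ext with (2 := L). intros n; ring. }
  rewrite E. field. exact Hr.
Qed.

(** * Analytic identities in the nome *)

#[local] Create HintDb good_db.
#[local] Hint Resolve good_add good_sub good_mul good_const good_mono good_dbl good_phi good_psi good_P
  good_sigf Cmod_sqr_lt1 : good_db.

Ltac ev_expand H :=
  repeat (rewrite ?ev_add, ?ev_sub, ?ev_mul, ?ev_dbl, ?ev_mono, ?ev_1 in H by auto 20 with good_db).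

Lemma theta_dissection y : (Cmod y < 1)%R ->
  ev phi y = ev phi (y ^ 4) + 2 * y * ev psi (y ^ 8).
Proof.
  intros Hy. pose proof (f_equal (fun a => ev a y) phi_dissection) as H. cbv beta in H.
  ev_expand H.
  replace (y ^ 4) with ((y ^ 2) ^ 2) by (simpl; ring).
  replace (y ^ 8) with (((y ^ 2) ^ 2) ^ 2) by (simpl; ring).
  rewrite H. simpl. ring.
Qed.

Lemma theta_sqr z : (Cmod z < 1)%R ->
  ev phi z ^ 2 = ev phi (z ^ 2) ^ 2 + 4 * z * ev psi (z ^ 4) ^ 2.
Proof.
  intros Hz. pose proof (f_equal (fun a => ev a z) phi_sqr) as H. unfold th_a, th_c in H. cbv beta in H.
  ev_expand H.
  replace (z ^ 4) with ((z ^ 2) ^ 2) by (simpl; ring).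
  replace (ev phi z ^ 2) with (ev phi z * ev phi z) by (simpl; ring).
  rewrite H. simpl. ring.
Qed.

Lemma lambert_theta4 z : (Cmod z < 1)%R ->
  1 + 8 * ev sigf z - 32 * ev sigf (z ^ 4) =
  (ev phi (z ^ 2) ^ 2 + 4 * z * ev psi (z ^ 4) ^ 2) ^ 2.
Proof.
  intros Hz. pose proof (f_equal (fun a => ev a z) lambert_E42) as H. unfold th_a, th_c, sig4 in H.
  cbv beta in H. ev_expand H.
  replace (z ^ 4) with ((z ^ 2) ^ 2) by (simpl; ring).
  match type of H with ?l = ?r => transitivity l; [ring|rewrite H; simpl; ring] end.
Qed.

Lemma lambert_theta4' z : (Cmod z < 1)%R ->
  1 - 24 * ev sigf z + 96 * ev sigf (z ^ 2) - 96 * ev sigf (z ^ 4) =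
  (ev phi (z ^ 2) ^ 2 - 4 * z * ev psi (z ^ 4) ^ 2) ^ 2
  - 16 * z * ev phi (z ^ 2) ^ 2 * ev psi (z ^ 4) ^ 2.
Proof.
  intros Hz. pose proof (f_equal (fun a => ev a z) lambert_E42') as H. unfold th_a, th_c, sig4, sig2 in H.
  cbv beta in H. ev_expand H.
  replace (z ^ 4) with ((z ^ 2) ^ 2) by (simpl; ring).
  match type of H with ?l = ?r => transitivity l; [ring|rewrite H; simpl; ring] end.
Qed.

Lemma theta_product z : (Cmod z < 1)%R ->
  ev phi (z ^ 2) * ev psi (z ^ 4) * (ev phi (z ^ 2) ^ 2 - 4 * z * ev psi (z ^ 4) ^ 2)
    * ev Pf (z ^ 2) ^ 4 = ev Pf z ^ 4 * ev Pf (z ^ 4) ^ 4.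
Proof.
  intros Hz. pose proof (f_equal (fun a => ev a z) theta_eta_product) as H. unfold th_a, th_c, P4 in H.
  cbv beta in H. ev_expand H.
  replace (z ^ 4) with ((z ^ 2) ^ 2) by (simpl; ring).
  match type of H with ?l = ?r => transitivity l; [simpl; ring|rewrite H; simpl; ring] end.
Qed.

(** * Modular forms on the upper half-plane *)

Lemma qpow_Cmod r tau : Cmod (qpow r tau) = exp (- (2 * PI * r * Im tau)).
Proof.
  unfold qpow. rewrite Cmod_Cexp. f_equal.
  replace (2 * PI * Ci * r * tau) with (RtoC (2 * PI * r) * (tau * Ci)) by (rewrite !RtoC_mult; ring).
  rewrite re_scal_l, re_mult_Ci. ring.
Qed.

Lemma qpow_lt1 r tau : (0 < r)%R -> (0 < Im tau)%R -> (Cmod (qpow r tau) < 1)%R.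
Proof.
  intros Hr Ht. rewrite qpow_Cmod, <- exp_0. apply exp_increasing.
  pose proof PI_RGT_0. assert (0 < 2 * PI * r * Im tau)%R by (apply Rmult_lt_0_compat; [apply Rmult_lt_0_compat|]; lra). lra.
Qed.

Lemma qpow_pow r tau n : qpow r tau ^ n = qpow (INR n * r) tau.
Proof.
  unfold qpow. rewrite <- Cexp_nat. f_equal. rewrite RtoC_mult. ring.
Qed.

Lemma qpow_scal r (c : R) tau : qpow r (c * tau) = qpow (r * c) tau.
Proof. unfold qpow. f_equal. rewrite RtoC_mult. ring. Qed.

Lemma Im_scal (c : R) tau : (0 < c)%R -> (0 < Im tau)%R -> (0 < Im (c * tau))%R.
Proof. intros Hc Ht. rewrite im_scal_l. apply Rmult_lt_0_compat; assumption. Qed.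

Lemma theta_ev tau : (0 < Im tau)%R -> theta tau = ev phi (q tau).
Proof. intros H. symmetry. apply ev_phi. apply qpow_lt1; [lra|exact H]. Qed.

Lemma E2_ev tau : (0 < Im tau)%R -> E2 tau = 1 - 24 * ev sigf (q tau).
Proof.
  intros H. unfold E2. f_equal. f_equal. f_equal.
  assert (Hz : (Cmod (q tau) < 1)%R) by (apply qpow_lt1; [lra|exact H]).
  apply CSeries_unique.
  apply Clim_ext with (fun n => csum (fun k => RtoC (sigf k) * q tau ^ k) (S n)).
  - intros n; induction n as [|n IH].
    + unfold sigf, sigma1. simpl. ring.
    + cbn [csum] in *. rewrite <- IH. reflexivity.
  - apply (Clim_subseq (csum _) _ S); [lia|]. apply ev_Clim; [apply good_sigf|exact Hz].
Qed.

Lemma eta_ev tau : (0 < Im tau)%R -> eta tau = qpow (1 / 24) tau * ev Pf (q tau).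
Proof.
  intros H. unfold eta. f_equal. apply CLim_seq_unique, P_product. apply qpow_lt1; [lra|exact H].
Qed.

Lemma q_scal (c : nat) tau : q (INR c * tau) = q tau ^ c.
Proof. unfold q. rewrite qpow_scal, qpow_pow. f_equal. ring. Qed.

Definition half (tau : C) : C := qpow (1 / 2) tau.
Definition tA (tau : C) : C := ev phi (half tau ^ 4).
Definition tB (tau : C) : C := 2 * half tau * ev psi (half tau ^ 8).

Lemma half_sqr tau : half tau ^ 2 = q tau.
Proof. unfold half, q. rewrite qpow_pow. f_equal. simpl; field. Qed.

Lemma q_sqr tau : q tau ^ 2 = half tau ^ 4.
Proof. rewrite <- half_sqr. simpl; ring. Qed.

Lemma q_pow4 tau : q tau ^ 4 = half tau ^ 8.
Proof. rewrite <- half_sqr. simpl; ring. Qed.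

(** In the dissection the even part is a function of [y^4] and the odd part is [y] times a function
    of [y^8], so a fourth root of unity [u] only scales the odd part. The values [1, -1] serve
    [g_{4,j}], the values [i, -i] serve [f_{4,j}]. *)
Lemma theta_nome tau (u tau' : C) : (0 < Im tau)%R -> (0 < Im tau')%R ->
  q tau' = u * half tau -> u ^ 4 = 1 -> theta tau' = tA tau + u * tB tau.
Proof.
  intros Ht Ht' E U. rewrite theta_ev by exact Ht'.
  rewrite theta_dissection by (apply qpow_lt1; [lra|exact Ht']).
  unfold tA, tB. rewrite E.
  assert (U8 : u ^ 8 = 1) by (replace (u ^ 8) with ((u ^ 4) * (u ^ 4)) by (simpl; ring); rewrite U; ring).
  rewrite !Cpow_mult_l, U, U8, !Cmult_1_l. ring.
Qed.

Lemma Cexp_PI_half : Cexp (PI / 2 * Ci) = Ci.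
Proof.
  unfold Cexp. replace (Re (PI / 2 * Ci)) with 0%R by (simpl; field).
  replace (Im (PI / 2 * Ci)) with (PI / 2)%R by (simpl; field).
  rewrite exp_0, cos_PI2, sin_PI2. unfold Ci; f_equal; ring.
Qed.

Lemma Ci_sqr : Ci * Ci = -1.
Proof. apply injective_projections; simpl; ring. Qed.

Lemma Cexp_PI_Ci : Cexp (PI * Ci) = -1.
Proof.
  unfold Cexp. replace (Re (PI * Ci)) with 0%R by (simpl; ring).
  replace (Im (PI * Ci)) with PI by (simpl; ring).
  rewrite exp_0, cos_PI, sin_PI. unfold RtoC; f_equal; ring.
Qed.

Lemma sgn_cases j : (sgn j = 1 /\ sgn (j + 1) = -1 /\ Cexp (PI * Ci * IZR j) = 1) \/
                    (sgn j = -1 /\ sgn (j + 1) = 1 /\ Cexp (PI * Ci * IZR j) = -1).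
Proof.
  assert (S : forall k, sgn (k + 1) = - sgn k).
  { intros k. unfold sgn. rewrite powerRZ_add by lra.
    replace (powerRZ (-1) 1) with (-1)%R by (simpl; ring). rewrite RtoC_mult. ring. }
  assert (D : forall k, sgn (2 * k) = 1).
  { intros k. unfold sgn. replace (2 * k)%Z with (k + k)%Z by lia.
    rewrite powerRZ_add by lra. rewrite <- powerRZ_mult.
    replace (-1 * -1)%R with 1%R by ring.
    destruct k; simpl; rewrite ?pow1, ?Rinv_1; reflexivity. }
  destruct (Z.Even_or_Odd j) as [[k ->]|[k ->]]; [left|right].
  - rewrite S, D. split; [reflexivity|]. split; [ring|].
    rewrite mult_IZR, RtoC_mult. replace (PI * Ci * (2 * IZR k)) with (2 * PI * Ci * IZR k) by ring.
    apply Cexp_2PI_Z.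
  - rewrite !S, D. split; [ring|]. split; [ring|].
    rewrite plus_IZR, mult_IZR, RtoC_plus, RtoC_mult.
    replace (PI * Ci * (2 * IZR k + 1)) with (2 * PI * Ci * IZR k + PI * Ci) by ring.
    rewrite Cexp_plus, Cexp_2PI_Z, Cexp_PI_Ci. ring.
Qed.

Lemma f4_AB j tau : (0 < Im tau)%R -> f4 j tau = tA tau - sgn j * Ci * tB tau.
Proof.
  intros Ht. unfold f4.
  assert (Hs : exists e : R, sgn j = RtoC e /\ (e = 1%R \/ e = (-1)%R)).
  { destruct (sgn_cases j) as [[-> _]|[-> _]]; eexists; split; reflexivity || auto. }
  destruct Hs as [e [-> He]].
  replace (tA tau - e * Ci * tB tau) with (tA tau + (- (e * Ci)) * tB tau) by ring.
  assert (Eim : Im (tau / 2 - e / 4) = (Im tau / 2)%R).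
  { replace (tau / 2 - e / 4) with (RtoC (/ 2) * tau - RtoC (e / 4)).
    - rewrite Im_minus, im_scal_l, im_RtoC. field.
    - rewrite RtoC_inv, RtoC_div by lra. field. }
  apply theta_nome; [exact Ht|rewrite Eim; lra| |].
  (* The shift by [e/4] multiplies the nome by [exp(-pi i e/2)], which is [-e i] for [e = 1, -1]. *)
  - unfold q, half, qpow.
    replace (2 * PI * Ci * 1 * (tau / 2 - e / 4)) with
      (- (e * (PI / 2 * Ci)) + 2 * PI * Ci * (1 / 2)%R * tau) by (rewrite RtoC_div by lra; field).
    rewrite Cexp_plus. f_equal.
    destruct He as [-> | ->].
    + rewrite Cmult_1_l, Cmult_1_l. pose proof (Cexp_opp_l (PI / 2 * Ci)) as H. rewrite Cexp_PI_half in H.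
      transitivity (Cexp (- (PI / 2 * Ci)) * Ci * - Ci); [|rewrite H; ring].
      transitivity (Cexp (- (PI / 2 * Ci)) * - (Ci * Ci)); [rewrite Ci_sqr; ring|ring].
    + replace (- (-1 * (PI / 2 * Ci))) with (PI / 2 * Ci) by ring. rewrite Cexp_PI_half. ring.
  - destruct He as [-> | ->].
    + transitivity ((Ci * Ci) * (Ci * Ci)); [simpl; ring|rewrite Ci_sqr; ring].
    + transitivity ((Ci * Ci) * (Ci * Ci)); [simpl; ring|rewrite Ci_sqr; ring].
Qed.

Lemma theta_2tau tau : (0 < Im tau)%R -> theta (2 * tau) = tA tau.
Proof.
  intros Ht. rewrite theta_ev by (apply Im_scal; [lra|exact Ht]).
  unfold tA. f_equal. rewrite <- q_sqr. apply (q_scal 2).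
Qed.

Lemma theta_half tau j : (0 < Im tau)%R ->
  theta ((tau + IZR j) / 2) = tA tau + sgn j * tB tau.
Proof.
  intros Ht.
  assert (Eim : Im ((tau + IZR j) / 2) = (Im tau / 2)%R).
  { replace ((tau + IZR j) / 2) with (RtoC (/ 2) * (tau + IZR j)).
    - rewrite im_scal_l, Im_plus, im_RtoC. field.
    - rewrite RtoC_inv by lra. field. }
  assert (E : Cexp (PI * Ci * IZR j) = sgn j /\ sgn j ^ 4 = 1).
  { destruct (sgn_cases j) as [[-> [_ ->]]|[-> [_ ->]]]; split; try reflexivity; simpl; ring. }
  destruct E as [E1 E2]. apply theta_nome; [exact Ht|rewrite Eim; lra| |exact E2].
  rewrite <- E1. unfold q, half, qpow. rewrite <- Cexp_plus. f_equal. rewrite RtoC_div by lra. field.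
Qed.

Lemma g4_AB j tau : (0 < Im tau)%R ->
  g4 j tau = tA tau ^ 2 - tB tau ^ 2 - 2 * sgn j * tA tau * tB tau.
Proof.
  intros Ht. unfold g4. rewrite theta_2tau, theta_half by exact Ht.
  destruct (sgn_cases j) as [[-> _]|[-> _]]; simpl; ring.
Qed.

Lemma theta_sqr_AB tau : (0 < Im tau)%R -> theta tau ^ 2 = tA tau ^ 2 + tB tau ^ 2.
Proof.
  intros Ht. rewrite theta_ev, theta_sqr by (exact Ht || (apply qpow_lt1; [lra|exact Ht])).
  rewrite q_sqr, q_pow4, <- half_sqr. unfold tA, tB. simpl. ring.
Qed.

Lemma E2_scal (c : nat) tau : (0 < c)%nat -> (0 < Im tau)%R ->
  E2 (INR c * tau) = 1 - 24 * ev sigf (q tau ^ c).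
Proof.
  intros Hc Ht. rewrite E2_ev, q_scal; [reflexivity|]. apply Im_scal; [apply lt_0_INR, Hc|exact Ht].
Qed.

Lemma E42_AB tau : (0 < Im tau)%R -> E42 tau = (tA tau ^ 2 + tB tau ^ 2) ^ 2.
Proof.
  intros Ht. unfold E42.
  pose proof (E2_scal 4 tau ltac:(lia) Ht) as E4. rewrite INR_IZR_INZ in E4. simpl IZR in E4.
  rewrite E4, E2_ev by exact Ht.
  assert (Hz : (Cmod (q tau) < 1)%R) by (apply qpow_lt1; [lra|exact Ht]).
  pose proof (lambert_theta4 _ Hz) as H.
  transitivity (1 + 8 * ev sigf (q tau) - 32 * ev sigf (q tau ^ 4)); [field|].
  rewrite H, q_sqr, q_pow4, <- half_sqr. unfold tA, tB. simpl. ring.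
Qed.

Lemma E42'_AB tau : (0 < Im tau)%R ->
  E42' tau = (tA tau ^ 2 - tB tau ^ 2) ^ 2 - 4 * tA tau ^ 2 * tB tau ^ 2.
Proof.
  intros Ht. unfold E42'.
  pose proof (E2_scal 4 tau ltac:(lia) Ht) as E4. rewrite INR_IZR_INZ in E4. simpl IZR in E4.
  pose proof (E2_scal 2 tau ltac:(lia) Ht) as E22. rewrite INR_IZR_INZ in E22. simpl IZR in E22.
  rewrite E4, E22, E2_ev by exact Ht.
  assert (Hz : (Cmod (q tau) < 1)%R) by (apply qpow_lt1; [lra|exact Ht]).
  pose proof (lambert_theta4' _ Hz) as H.
  transitivity (1 - 24 * ev sigf (q tau) + 96 * ev sigf (q tau ^ 2) - 96 * ev sigf (q tau ^ 4)); [ring|].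
  rewrite H, q_sqr, q_pow4, <- half_sqr. unfold tA, tB. simpl. ring.
Qed.

Lemma eta_scal (c : nat) tau : (0 < c)%nat -> (0 < Im tau)%R ->
  eta (INR c * tau) = qpow (1 / 24 * INR c) tau * ev Pf (q tau ^ c).
Proof.
  intros Hc Ht. rewrite eta_ev, q_scal, qpow_scal; [reflexivity|].
  apply Im_scal; [apply lt_0_INR, Hc|exact Ht].
Qed.

(** The powers of [q] in [eta_4^4] combine to [q^(4(1 + 4 - 2)/24) = q^(1/2)], the factor [half tau]
    of [tB tau]; the rest is [theta_product], divided by a power of [ev Pf (q tau ^ 2)]. *)
Lemma eta4_AB tau : (0 < Im tau)%R ->
  tA tau * tB tau * (tA tau ^ 2 - tB tau ^ 2) = 2 * eta4 tau ^ 4.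
Proof.
  intros Ht. unfold eta4.
  pose proof (eta_scal 4 tau ltac:(lia) Ht) as E4. replace (INR 4) with 4%R in E4 by (simpl; ring).
  pose proof (eta_scal 2 tau ltac:(lia) Ht) as E22. replace (INR 2) with 2%R in E22 by (simpl; ring).
  rewrite E4, E22, eta_ev by exact Ht.
  assert (Hz : (Cmod (q tau) < 1)%R) by (apply qpow_lt1; [lra|exact Ht]).
  pose proof (theta_product _ Hz) as H. pose proof (P_neq0 _ (Cmod_sqr_lt1 _ Hz)) as HP.
  set (u := qpow (1 / 24) tau) in *.
  assert (U2 : qpow (1 / 24 * 2) tau = u ^ 2).
  { unfold u. rewrite qpow_pow. f_equal. simpl; field. }
  assert (U4 : qpow (1 / 24 * 4) tau = u ^ 4).
  { unfold u. rewrite qpow_pow. f_equal. simpl; field. }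
  assert (U12 : half tau = u ^ 12).
  { unfold u, half. rewrite qpow_pow. f_equal. simpl; field. }
  assert (HU : u <> 0) by apply Cexp_neq0.
  rewrite U2, U4.
  assert (E : tA tau * tB tau * (tA tau ^ 2 - tB tau ^ 2) * ev Pf (q tau ^ 2) ^ 4 =
              2 * half tau * (ev Pf (q tau) ^ 4 * ev Pf (q tau ^ 4) ^ 4)).
  { rewrite <- H. unfold tA, tB. rewrite q_sqr, q_pow4. rewrite <- half_sqr. simpl. ring. }
  assert (HP4 : ev Pf (q tau ^ 2) ^ 4 <> 0) by (apply Cpow_nz, HP).
  transitivity (2 * half tau * (ev Pf (q tau) ^ 4 * ev Pf (q tau ^ 4) ^ 4) / ev Pf (q tau ^ 2) ^ 4).
  - rewrite <- E. field. exact HP.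
  - rewrite U12. field. split; assumption.
Qed.

(** * The inversion [tau -> -1/(4 tau)] *)

Lemma Csqrt_sqr z : (0 < Re z)%R -> Csqrt z * Csqrt z = z.
Proof.
  intros Hz. pose proof (re_le_Cmod z) as H. rewrite Rabs_right in H by lra.
  assert (M : (Cmod z * Cmod z = Re z * Re z + Im z * Im z)%R).
  { unfold Cmod. rewrite sqrt_sqrt; [unfold Re, Im; ring|]. pose proof (pow2_ge_0 (fst z)). pose proof (pow2_ge_0 (snd z)). lra. }
  set (p := ((Cmod z + Re z) / 2)%R). set (m := ((Cmod z - Re z) / 2)%R).
  assert (Hp : (0 <= p)%R) by (unfold p; lra). assert (Hm : (0 <= m)%R) by (unfold m; lra).
  (* [p m = (|z|^2 - (Re z)^2)/4 = (Im z)^2/4]. *)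
  assert (E : (sqrt p * sqrt m = Rabs (Im z) / 2)%R).
  { rewrite <- sqrt_mult by assumption.
    replace (p * m)%R with ((Rabs (Im z) / 2) * (Rabs (Im z) / 2))%R.
    - apply sqrt_square. pose proof (Rabs_pos (Im z)). lra.
    - unfold p, m. replace (Rabs (Im z) / 2 * (Rabs (Im z) / 2))%R with (Rabs (Im z) * Rabs (Im z) / 4)%R by field.
      rewrite <- Rabs_mult, Rabs_right by nra. nra. }
  unfold Csqrt. fold p m. apply injective_projections; unfold Cmult; cbn [fst snd].
  - replace (sqrt p * sqrt p)%R with p by (symmetry; apply sqrt_sqrt, Hp).
    destruct Rle_dec.
    + replace (1 * sqrt m * (1 * sqrt m))%R with (sqrt m * sqrt m)%R by ring.
      rewrite sqrt_sqrt by exact Hm. unfold p, m, Re. field.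
    + replace (-1 * sqrt m * (-1 * sqrt m))%R with (sqrt m * sqrt m)%R by ring.
      rewrite sqrt_sqrt by exact Hm. unfold p, m, Re. field.
  - destruct Rle_dec as [Hi|Hi].
    + replace (sqrt p * (1 * sqrt m) + 1 * sqrt m * sqrt p)%R with (2 * (sqrt p * sqrt m))%R by ring.
      rewrite E, Rabs_right by lra. unfold Im. field.
    + replace (sqrt p * (-1 * sqrt m) + -1 * sqrt m * sqrt p)%R with (- (2 * (sqrt p * sqrt m)))%R by ring.
      rewrite E, Rabs_left by lra. unfold Im. field.
Qed.

(** Brings every point of the upper half-plane within reach of [poisson_gauss], since [tau / i] has
    positive real part there. *)
Lemma Csqrt_sector z : (0 < Re z)%R -> sector (Csqrt z).
Proof.
  intros Hz. pose proof (re_le_Cmod z) as H. rewrite Rabs_right in H by lra.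
  unfold sector, Csqrt. cbn [Re Im fst snd].
  assert (L : (sqrt ((Cmod z - Re z) / 2) < sqrt ((Cmod z + Re z) / 2))%R) by (apply sqrt_lt_1; lra).
  pose proof (sqrt_pos ((Cmod z - Re z) / 2)).
  destruct Rle_dec; rewrite Rabs_mult, (Rabs_right (sqrt _)) by lra.
  - rewrite Rabs_R1; lra.
  - rewrite Rabs_left by lra. lra.
Qed.

Lemma Csqrt_4 z : Csqrt (4 * z) = 2 * Csqrt z.
Proof.
  assert (S4 : forall x, sqrt (4 * x) = (2 * sqrt x)%R).
  { intros x. replace 4%R with (2 * 2)%R by ring. rewrite sqrt_mult_alt by lra. rewrite sqrt_square by lra. reflexivity. }
  unfold Csqrt. rewrite Cmod_mult, Cmod_R, re_scal_l, im_scal_l, (Rabs_right 4) by lra.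
  replace ((4 * Cmod z + 4 * Re z) / 2)%R with (4 * ((Cmod z + Re z) / 2))%R by field.
  replace ((4 * Cmod z - 4 * Re z) / 2)%R with (4 * ((Cmod z - Re z) / 2))%R by field.
  rewrite !S4. apply injective_projections; simpl.
  - ring.
  - destruct (Rle_dec 0 (4 * Im z)), (Rle_dec 0 (Im z)); try lra; ring.
Qed.

Lemma theta_gsum tau r : (0 < Im tau)%R -> r * r = 2 * tau / Ci -> theta tau = gsum r.
Proof.
  intros Ht E. unfold theta, gsum. f_equal. apply functional_extensionality; intros k.
  unfold q. rewrite qpow_pow. unfold qpow, gauss. f_equal.
  rewrite RtoC_mult, INR_IZR_INZ, Z2Nat.id by nia.
  replace ((r * IZR k) ^ 2) with (r * r * (IZR k * IZR k)) by (simpl; ring).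
  rewrite E, Z.pow_2_r, mult_IZR, RtoC_mult.
  assert (CN : Ci <> 0) by apply Ci_nz.
  transitivity (- (Ci * Ci) * (2 * PI * tau * (IZR k * IZR k)) / Ci * -1).
  - field. exact CN.
  - rewrite Ci_sqr. field. exact CN.
Qed.

Lemma div_Ci z : z / Ci = - (Ci * z).
Proof.
  assert (CN : Ci <> 0) by apply Ci_nz.
  transitivity (- (Ci * Ci) * z / Ci); [rewrite Ci_sqr; field; exact CN|field; exact CN].
Qed.

Lemma Re_div_Ci z : Re (z / Ci) = Im z.
Proof. rewrite div_Ci, (Cmult_comm Ci), <- (Cmult_1_l (z * Ci)).
  replace (- (1 * (z * Ci))) with (- z * Ci) by ring. rewrite re_mult_Ci. destruct z; simpl; ring. Qed.

Lemma upper_neq0 tau : (0 < Im tau)%R -> tau <> 0.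
Proof. intros H E. rewrite E in H. simpl in H. lra. Qed.

Lemma Im_inversion tau : (0 < Im tau)%R -> (0 < Im (- 1 / (4 * tau)))%R.
Proof.
  intros Ht. pose proof (upper_neq0 tau Ht) as Hn.
  replace (- 1 / (4 * tau)) with (RtoC (/ 4) * - / tau) by (rewrite RtoC_inv by lra; field; exact Hn).
  apply Im_scal; [lra|]. destruct tau as [a b]. simpl in *.
  assert (0 < a * (a * 1) + b * (b * 1))%R by nra.
  replace (- (- b / (a * (a * 1) + b * (b * 1))))%R with (b / (a * (a * 1) + b * (b * 1)))%R by (field; lra).
  apply Rdiv_lt_0_compat; lra.
Qed.

(** With [r^2 = 2 tau / i], the point [-1/(4 tau)] belongs to [1/r], since
    [2 (-1/(4 tau)) / i = 1/r^2]. *)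
Theorem theta_inversion tau : (0 < Im tau)%R ->
  theta (- 1 / (4 * tau)) = Csqrt (2 * tau / Ci) * theta tau.
Proof.
  intros Ht. pose proof (upper_neq0 tau Ht) as Hn. assert (CN : Ci <> 0) by apply Ci_nz.
  assert (Hre : (0 < Re (2 * tau / Ci))%R) by (rewrite Re_div_Ci, im_scal_l; lra).
  pose proof (Csqrt_sqr _ Hre) as E. pose proof (Csqrt_sector _ Hre) as S.
  set (r := Csqrt (2 * tau / Ci)) in *. pose proof (sector_neq0 _ S) as Hr.
  rewrite (theta_gsum tau r Ht E).
  rewrite (theta_gsum (- 1 / (4 * tau)) (/ r) (Im_inversion tau Ht)).
  - symmetry; apply poisson_gauss, S.
  - transitivity (/ (r * r)); [field; exact Hr|]. rewrite E.
    transitivity (Ci * Ci / (2 * tau * Ci)); [field; split; assumption|].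
    rewrite Ci_sqr. field. split; assumption.
Qed.

(** [tA] is [theta] at the doubled argument, and [2 (-1/(4 tau)) = -1/(4 (tau/2))], so the inversion
    is applied at [tau/2]. *)
Lemma tA_inversion tau : (0 < Im tau)%R ->
  tA (- 1 / (4 * tau)) = Csqrt (tau / Ci) * (tA tau + tB tau).
Proof.
  intros Ht. pose proof (upper_neq0 tau Ht) as Hn. assert (CN : Ci <> 0) by apply Ci_nz.
  rewrite <- theta_2tau by (apply Im_inversion, Ht).
  replace (tA tau + tB tau) with (theta (tau / 2)).
  2: { pose proof (theta_half tau 0 Ht) as H. replace (sgn 0) with (RtoC 1) in H by reflexivity.
       rewrite Cplus_0_r, Cmult_1_l in H. exact H. }
  replace (2 * (- 1 / (4 * tau))) with (- 1 / (4 * (tau / 2))) by (field; exact Hn).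
  rewrite theta_inversion.
  - f_equal. f_equal. field. exact CN.
  - replace (tau / 2) with (RtoC (/ 2) * tau) by (rewrite RtoC_inv by lra; field).
    apply Im_scal; [lra|exact Ht].
Qed.

(** For [s = -1/(4 tau)] the inversion at [2 tau] yields [theta (s/2) = tA s + tB s], from which
    [tA s] is subtracted; [Csqrt_4] provides the factor 2. *)
Lemma tB_inversion tau : (0 < Im tau)%R ->
  tB (- 1 / (4 * tau)) = Csqrt (tau / Ci) * (tA tau - tB tau).
Proof.
  intros Ht. pose proof (upper_neq0 tau Ht) as Hn. assert (CN : Ci <> 0) by apply Ci_nz.
  set (s := - 1 / (4 * tau)).
  assert (H : tA s + tB s = 2 * Csqrt (tau / Ci) * tA tau).
  { pose proof (theta_half s 0 (Im_inversion tau Ht)) as H. replace (sgn 0) with (RtoC 1) in H by reflexivity.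
    rewrite Cplus_0_r, Cmult_1_l in H. rewrite <- H.
    unfold s. replace (- 1 / (4 * tau) / 2) with (- 1 / (4 * (2 * tau))) by (field; exact Hn).
    rewrite theta_inversion by (apply Im_scal; [lra|exact Ht]).
    rewrite theta_2tau by exact Ht. rewrite <- Csqrt_4. f_equal. f_equal. field. exact CN. }
  transitivity ((tA s + tB s) - tA s); [ring|]. rewrite H. unfold s. rewrite tA_inversion by exact Ht. ring.
Qed.

Lemma half_shift tau : half (tau + 1) = - half tau.
Proof.
  unfold half, qpow. rewrite Cmult_plus_distr_l, Cexp_plus.
  replace (2 * PI * Ci * (1 / 2)%R * 1) with (PI * Ci) by (rewrite RtoC_div by lra; field).
  rewrite Cexp_PI_Ci. ring.
Qed.

Lemma tA_shift tau : tA (tau + 1) = tA tau.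
Proof. unfold tA. rewrite half_shift. f_equal. simpl. ring. Qed.

Lemma tB_shift tau : tB (tau + 1) = - tB tau.
Proof.
  unfold tB. rewrite half_shift. replace ((- half tau) ^ 8) with (half tau ^ 8) by (simpl; ring). ring.
Qed.

Theorem mainTheorem8 :
  (forall (j : Z) (tau : C), (0 < Im tau)%R ->
     f4 j tau ^ 4 = F4 j tau /\
     f4 j tau * f4 (j + 1) tau = E42_half tau /\
     f4 j (tau + 1) = f4 (j + 1) tau /\
     f4 j (- 1 / (4 * tau)) =
       (1 - sgn j * Ci) * Csqrt (tau / Ci) * f4 (j + 1) tau) /\
  (forall (j : Z) (tau : C), (0 < Im tau)%R ->
     g4 j tau ^ 2 = G4 j tau /\
     g4 j tau * g4 (j + 1) tau = E42' tau /\
     g4 j (tau + 1) = g4 (j + 1) tau /\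
     g4 j (- 1 / (4 * tau)) = sgn j * 2 * Ci * tau * g4 j tau).
Proof.
  split; intros j tau Ht;
    assert (Ht1 : (0 < Im (tau + 1))%R) by (rewrite Im_plus, im_RtoC; lra);
    pose proof (Im_inversion tau Ht) as Hti.
  - unfold F4, E42_half.
    rewrite !f4_AB, tA_shift, tB_shift, tA_inversion, tB_inversion, theta_sqr_AB, E42'_AB by assumption.
    pose proof (eta4_AB tau Ht) as H. set (A := tA tau) in *. set (B := tB tau) in *.
    set (w := Csqrt (tau / Ci)).
    assert (H8 : forall e, e * (8 * Ci) * eta4 tau ^ 4 = e * 4 * Ci * (A * B * (A ^ 2 - B ^ 2)))
      by (intros e; rewrite H; ring).
    rewrite H8.
    (* [ring] treats [Ci] as an atom, so [Ci * Ci = -1] is supplied by adding a multiple of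
       [Ci * Ci + 1]; the cofactors [y] below are the quotients of the differences of both sides by
       it. *)
    assert (I2 : forall x y, x + (Ci * Ci + 1) * y = x) by (intros; rewrite Ci_sqr; ring).
    destruct (sgn_cases j) as [[-> [-> _]]|[-> [-> _]]]; repeat split.
    + etransitivity; [|apply (I2 _ (B ^ 4 * (Ci * Ci - 1) + 6 * A ^ 2 * B ^ 2 - 4 * A * B ^ 3 * Ci))]. simpl. ring.
    + rewrite <- (I2 (A ^ 2 + B ^ 2) (- B ^ 2)). simpl. ring.
    + ring.
    (* [(A + B) - i (A - B) = (1 - i)(A + i B)]. *)
    + rewrite <- (I2 ((1 - 1 * Ci) * w * (A - -1 * Ci * B)) (w * B)). ring.
    + etransitivity; [|apply (I2 _ (B ^ 4 * (Ci * Ci - 1) + 6 * A ^ 2 * B ^ 2 + 4 * A * B ^ 3 * Ci))]. simpl. ring.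
    + rewrite <- (I2 (A ^ 2 + B ^ 2) (- B ^ 2)). simpl. ring.
    + ring.
    + rewrite <- (I2 ((1 - -1 * Ci) * w * (A - 1 * Ci * B)) (w * B)). ring.
  - unfold G4.
    rewrite !g4_AB, tA_shift, tB_shift, tA_inversion, tB_inversion, E42_AB, E42'_AB by assumption.
    pose proof (eta4_AB tau Ht) as H. set (A := tA tau) in *. set (B := tB tau) in *.
    (* [g_{4,j}] is homogeneous of degree 2 in [A] and [B], so only [w^2 = -i tau] enters;
       [(A, B) -> (A + B, A - B)] exchanges [A^2 - B^2] and [2AB] up to a factor 2. *)
    assert (Hw : Csqrt (tau / Ci) * Csqrt (tau / Ci) = - (Ci * tau))
      by (rewrite Csqrt_sqr by (rewrite Re_div_Ci; exact Ht); apply div_Ci).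
    set (w := Csqrt (tau / Ci)) in *.
    assert (H8 : forall e, e * 8 * eta4 tau ^ 4 = e * 4 * (A * B * (A ^ 2 - B ^ 2)))
      by (intros e; rewrite H; ring).
    rewrite H8.
    destruct (sgn_cases j) as [[-> [-> _]]|[-> [-> _]]]; repeat split; try (simpl; ring).
    + transitivity (w * w * (4 * A * B - 2 * (A ^ 2 - B ^ 2))); [simpl; ring|rewrite Hw; simpl; ring].
    + transitivity (w * w * (4 * A * B + 2 * (A ^ 2 - B ^ 2))); [simpl; ring|rewrite Hw; simpl; ring].
Qed.
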